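(* Let $n\ge 3$ be an odd integer. There exists a function $g\in C_c^\infty(\mathbb{S}^{n-1}\times(0,2))$ such that $P(D^{n-3}t^{n-2}g)=0$ on $\mathbb{B}$, but $g\notin\operatorname{Range}(\mathcal{M})$, i.e. there is no $f\in C_c^\infty(\mathbb{B})$ with $g=\mathcal{M}f$. Consequently, the following assertion is false: every $g\in C_c^\infty(\mathbb{S}^{n-1}\times(0,2))$ for which $P(D^{n-3}t^{n-2}g)$ belongs to $I^2[C_c^\infty(\mathbb{B})]$ lies in $\operatorname{Range}(\mathcal{M})$.
   Context: $\mathbb{B}$ is the open unit ball in $\mathbb{R}^n$, $\mathbb{S}^{n-1}$ is the unit sphere, $dS$ is its surface measure, and $\omega_n$ is its total surface area. The spherical mean transform $\mathcal{M}:C_c^\infty(\mathbb{B})\to C_c^\infty(\mathbb{S}^{n-1}\times(0,2))$ is $$\mathcal{M}f(p,t)=\frac1{\omega_n}\int_{\mathbb{S}^{n-1}}f(p+t\theta)\,dS(\theta),$$ with $f$ extended by zero outside $\mathbb{B}$; $\operatorname{Range}(\mathcal{M})=\{\mathcal{M}f: f\in C_c^\infty(\mathbb{B})\}$. The backprojection operator is $$(PF)(x)=\frac1{\omega_n}\int_{\mathbb{S}^{n-1}}F(\theta,|x-\theta|)\,dS(\theta),\qquad x\in\mathbb{B}.$$ $D=\frac1t\frac{d}{dt}$ acts in the variable $t$, and $D^{n-3}t^{n-2}g$ means $D^{n-3}$ applied to $t^{n-2}g(\theta,t)$ (with $D^0$ the identity). The Riesz potential is $$(I^2f)(x)=\frac{\Gamma\left(\frac{n-2}{2}\right)}{4\pi^{n/2}}\int_{\mathbb{B}}\frac{f(y)}{|x-y|^{n-2}}\,dy,\qquad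 x\in\mathbb{B},$$ and $I^2[C_c^\infty(\mathbb{B})]=\{I^2f:f\in C_c^\infty(\mathbb{B})\}$. *)

(* Defs.v *)
From HB Require Import structures.
From mathcomp Require Import all_boot all_order all_algebra.
From mathcomp Require Import all_classical all_reals all_analysis.
From mathcomp Require Import measurable_realfun.

Set Implicit Arguments.
Unset Strict Implicit.
Unset Printing Implicit Defensive.

Import Order.TTheory GRing.Theory Num.Theory.
Import numFieldNormedType.Exports.

Local Open Scope classical_set_scope.
Local Open Scope ring_scope.

Section rV_measurable.
Context {R : realType} (n : nat).

Let coord (i : 'I_n) (x : 'rV[R]_n) : R := x ord0 i.

Let rV_set0 : g_sigma_preimage coord set0.
Proof. exact: sigma_algebra0. Qed.

Let rV_setC A : g_sigma_preimage coord A -> g_sigma_preimage coord (~` A).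
Proof. exact: sigma_algebraC. Qed.

Let rV_bigcup (F : (set 'rV[R]_n)^nat) :
  (forall i, g_sigma_preimage coord (F i)) ->
  g_sigma_preimage coord (\bigcup_i (F i)).
Proof. exact: sigma_algebra_bigcup. Qed.

(* The sigma-algebra generated by the coordinates, that is, the Borel sets. *)
HB.instance Definition _ := @isMeasurable.Build default_measure_display
  'rV[R]_n (g_sigma_preimage coord) rV_set0 rV_setC rV_bigcup.

Lemma measurable_coord (i : 'I_n) :
  measurable_fun [set: 'rV[R]_n] (fun x : 'rV[R]_n => x ord0 i).
Proof.
move=> _ Y mY; rewrite setTI; apply: sub_sigma_algebra => /=.
rewrite -bigcup_seq/=; exists i => /=; first by rewrite mem_index_enum.
by exists Y => //; rewrite setTI.
Qed.

Lemma measurable_fun_rVP d (T : measurableType d) (f : T -> 'rV[R]_n) :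
  (forall i, measurable_fun [set: T] (fun x => f x ord0 i)) ->
  measurable_fun [set: T] f.
Proof.
move=> mf; have prefS : g_sigma_preimage (fun i => coord i \o f) `<=` measurable.
  apply: smallest_sub; first exact: sigma_algebra_measurable.
  rewrite -bigcup_seq/=; apply: bigcup_sub => i _ A [B mB <-].
  exact: (mf i measurableT).
move=> _ A mA; apply: prefS; rewrite g_sigma_preimage_comp.
by exists A.
Qed.

End rV_measurable.

Section rV_cons.
Context {R : realType} (n : nat).

Definition rV_cons (p : measurableTypeR R * 'rV[R]_n) : 'rV[R]_n.+1 :=
  \row_i if unlift ord0 i is Some j then p.2 ord0 j else p.1.

Let rV_uncons (v : 'rV[R]_n.+1) : measurableTypeR R * 'rV[R]_n :=
  (v ord0 ord0, \row_j v ord0 (lift ord0 j)).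

Let rV_unconsK : cancel rV_uncons rV_cons.
Proof.
by move=> v; apply/rowP => i; rewrite mxE; case: unliftP => [j|] -> //=; rewrite mxE.
Qed.

Let rV_consK : cancel rV_cons rV_uncons.
Proof.
move=> [x v]; rewrite /rV_cons /rV_uncons/= mxE unlift_none; congr pair.
by apply/rowP => j; rewrite !mxE liftK.
Qed.

Lemma measurable_rV_cons : measurable_fun [set: _] rV_cons.
Proof.
apply: measurable_fun_rVP => i; under eq_fun do rewrite mxE.
case: unliftP => [j|] _ /=; last exact: measurable_fst.
by apply: (measurableT_comp (measurable_coord j)); exact: measurable_snd.
Qed.

Let measurable_rV_uncons : measurable_fun [set: _] rV_uncons.
Proof.
rewrite /rV_uncons; apply: measurable_fun_pair => /=.
  exact: (measurable_coord (ord0 : 'I_n.+1)).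
apply: measurable_fun_rVP => i /=; under eq_fun do rewrite mxE.
exact: measurable_coord.
Qed.

Variable mu : {sigma_finite_measure set 'rV[R]_n -> \bar R}.

Definition lebesgue_rV_step : set 'rV[R]_n.+1 -> \bar R :=
  pushforward (lebesgue_measure \x mu)%E rV_cons.

Let step0 : lebesgue_rV_step set0 = 0%E.
Proof. by rewrite /lebesgue_rV_step /pushforward preimage_set0 measure0. Qed.

Let step_ge0 A : (0 <= lebesgue_rV_step A)%E.
Proof. by rewrite /lebesgue_rV_step /pushforward measure_ge0. Qed.

Let step_sigma_additive : semi_sigma_additive lebesgue_rV_step.
Proof.
pose m := measure_function_pushforward__canonical__measure_function_Measure
  (lebesgue_measure \x mu)%E measurable_rV_cons.
exact: (@measure_semi_sigma_additive _ _ _ m).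
Qed.

HB.instance Definition _ := isMeasure.Build _ _ _ lebesgue_rV_step
  step0 step_ge0 step_sigma_additive.

Let step_sigma_finite : sigma_finite [set: 'rV[R]_n.+1] lebesgue_rV_step.
Proof.
have /sigma_finiteP[F [TF ndF Foo]] := sigma_finiteT (@lebesgue_measure R).
have /sigma_finiteP[G [TG ndG Goo]] := sigma_finiteT mu.
exists (fun k => rV_uncons @^-1` (F k `*` G k)).
  rewrite predeqE => v; split=> // _.
  have [k _ Fk] : (\bigcup_k F k) (rV_uncons v).1 by rewrite -TF.
  have [l _ Gl] : (\bigcup_k G k) (rV_uncons v).2 by rewrite -TG.
  exists (maxn k l) => //; split => /=.
  - by move: Fk; exact/subsetPset/ndF/leq_maxl.
  - by move: Gl; exact/subsetPset/ndG/leq_maxr.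
move=> k; have [mF Fkoo] := Foo k; have [mG Gkoo] := Goo k; split.
  rewrite -[X in measurable X]setTI; apply: measurable_rV_uncons => //.
  exact: measurableX.
rewrite /lebesgue_rV_step /pushforward -comp_preimage.
rewrite (_ : _ \o _ = id) ?preimage_id; last first.
  by apply/funext => x; exact: rV_consK.
by rewrite product_measure1E// lte_mul_pinfty// ge0_fin_numE.
Qed.

HB.instance Definition _ := Measure_isSigmaFinite.Build _ _ _ lebesgue_rV_step
  step_sigma_finite.

End rV_cons.

Section lebesgue_rV.
Context {R : realType}.

(* Lebesgue measure on R^n, as the n-fold product of Lebesgue measure on R. *)
Fixpoint lebesgue_rV (n : nat) : {sigma_finite_measure set 'rV[R]_n -> \bar R} :=
  match n with
  | 0 => dirac (0 : 'rV[R]_0)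
  | m.+1 => lebesgue_rV_step (lebesgue_rV m)
  end.

End lebesgue_rV.

Section euclidean.
Context {R : realType}.

(* The library norm on 'rV[R]_n is the sup norm; this one is Euclidean. *)
Definition enorm n (x : 'rV[R]_n) : R := Num.sqrt (\sum_i x ord0 i ^+ 2).

Lemma measurable_enorm n : measurable_fun [set: 'rV[R]_n] (@enorm n).
Proof.
apply: (measurableT_comp (continuous_measurable_fun (@sqrt_continuous R))).
apply: measurable_sum => i; apply: measurable_funX; exact: measurable_coord.
Qed.

Lemma measurable_invr : measurable_fun [set: R] (@GRing.inv R).
Proof.
have -> : [set: R] = [set 0] `|` ~` [set 0] by rewrite setUv.
apply/measurable_funU => //; first exact: measurableC.
split.
  apply: (@eq_measurable_fun _ _ _ _ _ (cst (0 : R)) (@GRing.inv R)).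
    by move=> x; rewrite inE => -> /=; rewrite invr0.
  exact: measurable_cst.
apply: open_continuous_measurable_fun.
  by apply: closed_openC; exact: closed_eq.
by move=> x; rewrite inE => /= /eqP x0; exact: inv_continuous.
Qed.

Definition unit_ball n : set 'rV[R]_n := [set x | enorm x < 1].

Definition unit_sphere n : set 'rV[R]_n := [set x | enorm x = 1].

Definition radial_proj n (x : 'rV[R]_n) : 'rV[R]_n := (enorm x)^-1 *: x.

Lemma measurable_radial_proj n :
  measurable_fun [set: 'rV[R]_n] (@radial_proj n).
Proof.
apply: measurable_fun_rVP => i; under eq_fun do rewrite mxE.
apply: measurable_funM; last exact: measurable_coord.
exact: (measurableT_comp measurable_invr (@measurable_enorm n)).
Qed.

Definition punctured_ball n : set 'rV[R]_n := [set x | 0 < enorm x < 1].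

Lemma measurable_punctured_ball n : measurable (@punctured_ball n).
Proof.
have -> : @punctured_ball n = setT `&` @enorm n @^-1` `]0, 1[%classic.
  by rewrite setTI; apply/seteqP; split => x /=; rewrite in_itv.
exact: measurable_enorm.
Qed.

(* Surface measure through polar coordinates: the sector {r w | 0 < r < 1, w in A}
   over a Borel set A of the sphere has Lebesgue measure sigma(A) / n. *)
Definition surface_measure n (A : set 'rV[R]_n) : \bar R :=
  (n%:R%:E * lebesgue_rV n [set x | punctured_ball x /\ A (radial_proj x)])%E.

Section surface_measure_instance.
Variable n : nat.

Let m : {measure set 'rV[R]_n -> \bar R} :=
  mscale (NngNum (ler0n R n))
    (measure_function_pushforward__canonical__measure_function_Measure
      (mrestr (lebesgue_rV n) (@measurable_punctured_ball n))
      (@measurable_radial_proj n)).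

Let surface_measureE : @surface_measure n = m.
Proof.
apply/funext => A; rewrite /surface_measure /m/= /mscale/= /pushforward /mrestr.
by congr (_ * lebesgue_rV n _)%E; rewrite setIC.
Qed.

Let surface0 : surface_measure (set0 : set 'rV[R]_n) = 0%E.
Proof. by rewrite surface_measureE measure0. Qed.

Let surface_ge0 (A : set 'rV[R]_n) : (0 <= surface_measure A)%E.
Proof. by rewrite surface_measureE measure_ge0. Qed.

Let surface_sigma_additive : semi_sigma_additive (@surface_measure n).
Proof. by rewrite surface_measureE; exact: measure_semi_sigma_additive. Qed.

HB.instance Definition _ := isMeasure.Build _ _ _ (@surface_measure n)
  surface0 surface_ge0 surface_sigma_additive.

End surface_measure_instance.

Definition sphere_area n : R := fine (surface_measure (@unit_sphere n)).

End euclidean.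

Section smooth.
Context {R : realType} {V : normedModType R}.

Fixpoint Ck (k : nat) (U : set V) (f : V -> R) : Prop :=
  if k is k'.+1 then
    (forall x, U x -> differentiable f x) /\ (forall v, Ck k' U ('D_v f))
  else forall x, U x -> {for x, continuous f}.

Definition Cinfty (U : set V) (f : V -> R) : Prop := forall k, Ck k U f.

(* Smoothness on an arbitrary subset (here an open set or an embedded
   submanifold) of V: local extendability to smooth functions on open sets. *)
Definition smooth_on (X : set V) (f : V -> R) : Prop :=
  forall x, X x -> exists (U : set V) (F : V -> R),
    [/\ open U, U x, Cinfty U F & forall y, U y -> X y -> F y = f y].

(* Functions on X are represented by total functions; their values outside X
   are irrelevant. *)
Definition Ccinfty (X : set V) (f : V -> R) : Prop :=
  smooth_on X f /\
  exists K : set V, [/\ compact K, K `<=` X & forall x, X x -> ~ K x -> f x = 0].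

End smooth.

Section transforms.
Context {R : realType} (n : nat).
Implicit Types (f : 'rV[R]_n -> R) (F g : 'rV[R]_n * R -> R).

Definition cylinder : set ('rV[R]_n * R) := @unit_sphere R n `*` `]0, 2[.

Definition spherical_mean f (z : 'rV[R]_n * R) : R :=
  (sphere_area n)^-1 *
  \int[@surface_measure R n]_(w in @unit_sphere R n)
    patch (fun=> 0) (@unit_ball R n) f (z.1 + z.2 *: w).

Definition in_range_mean g : Prop :=
  exists2 f, Ccinfty (@unit_ball R n) f &
    forall z, cylinder z -> g z = spherical_mean f z.

Definition backprojection F (x : 'rV[R]_n) : R :=
  (sphere_area n)^-1 *
  \int[@surface_measure R n]_(w in @unit_sphere R n) F (w, enorm (x - w)).

Definition Dt F (z : 'rV[R]_n * R) : R :=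
  z.2^-1 * derive1 (fun t => F (z.1, t)) z.2.

Definition filtered g : 'rV[R]_n * R -> R :=
  iter (n - 3) Dt (fun z => z.2 ^+ (n - 2) * g z).

Definition Gamma (a : R) : R :=
  \int[lebesgue_measure]_(t in `]0, +oo[) (t `^ (a - 1) * expR (- t)).

Definition riesz2 f (x : 'rV[R]_n) : R :=
  Gamma ((n%:R - 2) / 2) / (4 * pi `^ (n%:R / 2)) *
  \int[lebesgue_rV n]_(y in @unit_ball R n) (f y / enorm (x - y) ^+ (n - 2)).

Definition in_range_riesz2 (u : 'rV[R]_n -> R) : Prop :=
  exists2 f, Ccinfty (@unit_ball R n) f &
    forall x, unit_ball x -> u x = riesz2 f x.

End transforms.

(* Main.v *)
(* Write n = 2j + 1, D = t^-1 d/dt, and look for g(theta, t) = h(t). Given an odd function o, put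
   S(t) = sum_i (-1)^i b_i o^(i)(t - 1), where D^j = t^(-2j) sum_k b_k t^k (d/dt)^k, and
   H = D^j S. The function x |-> int H(|x - w|) dsigma(w) then vanishes on the ball. It is radial,
   and the n-dimensional radial Laplacian of D^j S is D^j S'', so for a polynomial o induction on the
   degree shows that it is constant; its value at the origin is a multiple of H(1) = 0, because
   B(d/dt) B(-d/dt) o is odd for B = sum_k b_k X^k. Approximating o by polynomials in C^(2j) gives the general
   case. Taking for o an even-order derivative of an odd function made of two bumps, one can solve
   D^(n-3) t^(n-2) h = H with h smooth and supported in [1/2, 3/2].

   If h were M f, integrating f(y) H(|y - p|) over y in the ball and p in the sphere, in polar
   coordinates around p, would give int H h t^(n-1) dt = 0. Integrating by parts, this integral is
   up to sign int (D^m (t^(n-2) h))^2 t dt with m = j - 1, so S' = t D^m (t^(n-2) h) = 0.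
   Thus o is a compactly supported solution of a linear ODE with constant coefficients, hence zero. *)
From HB Require Import structures.
Require Import Defs.
From mathcomp Require Import all_boot all_order all_algebra.
From mathcomp Require Import all_classical all_reals all_analysis.
From mathcomp Require Import measurable_realfun ring lra.

Set Implicit Arguments.
Unset Strict Implicit.
Unset Printing Implicit Defensive.

Import Order.TTheory GRing.Theory Num.Theory.
Import numFieldNormedType.Exports.

Local Open Scope classical_set_scope.
Local Open Scope ring_scope.

(** * Linear maps and Lebesgue measure *)

(** A function of t alone makes both conditions one-dimensional, but inverting D^(n-3) must not
    spoil compact support in ]0, 2[. Each inversion of D integrates against t dt and imposes a
    moment condition; a derivative of order 2m always has an m-fold D-primitive with the same
    support bounds. This forces the order of the derivative taken of the bumps, and its evenness
    keeps the function odd. Second derivatives are also the step of the induction: the Laplacian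
    replaces o by o'', which is odd again. A general smooth o admits no such descent, hence the
    passage to the limit from polynomials. Orders up to 2j must converge because D^j uses j
    derivatives of S and S uses j derivatives of o. Approximation on [-1, 1] is enough, since the
    distances from a point of the ball to the sphere lie in ]0, 2[. Lebesgue measure is given as an
    iterated product and surface measure through sectors. Rotation invariance, polar coordinates and
    integration by parts on the sphere are therefore derived from shears, dilations and Tonelli's
    theorem. *)

Section scaling.
Context {R : realType}.

(** For an invertible linear map the factor [c] is the inverse of the absolute determinant. With
    preimages, the condition speaks of a pushforward and is multiplicative under composition. *)
Definition scales d (T : measurableType d) (mu : set T -> \bar R)
    (f : T -> T) (c : R) :=
  [/\ measurable_fun [set: T] f, 0 <= c &
      forall A, measurable A -> mu (f @^-1` A) = (c%:E * mu A)%E].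

Lemma scales_comp d (T : measurableType d) (mu : set T -> \bar R)
    (f g : T -> T) (a b : R) :
  scales mu f a -> scales mu g b -> scales mu (f \o g) (a * b).
Proof.
move=> [mf a0 fE] [mg b0 gE]; split.
- exact: measurableT_comp.
- exact: mulr_ge0.
- move=> A mA; rewrite comp_preimage gE ?fE ?muleA ?(mulrC a) ?EFinM//.
  by rewrite -[X in measurable X]setTI; exact: mf.
Qed.

Lemma ge0_integral_scales d (T : measurableType d)
    (mu : {measure set T -> \bar R}) (f : T -> T) (c : R) (h : T -> \bar R) :
  scales mu f c -> measurable_fun [set: T] h -> (forall x, 0 <= h x)%E ->
  (\int[mu]_x h (f x) = c%:E * \int[mu]_x h x)%E.
Proof.
move=> [mf c0 fE] mh h0.
have := @ge0_integral_pushforward _ _ _ _ R f mf mu setT h measurableT mh.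
rewrite preimage_setT => <-; last by move=> x _; exact: h0.
transitivity (\int[mscale (NngNum c0) mu]_y h y)%E; last first.
  by rewrite ge0_integral_mscale.
by apply: eq_measure_integral => A mA _; exact: fE.
Qed.

(** Uniqueness of Lebesgue measure: [a] times the pushforward gives each interval []x, y]] its
    length. *)
Lemma scales_affine (a b : R) : 0 < a ->
  scales (@lebesgue_measure R) (fun x : measurableTypeR R => a * x + b) a^-1.
Proof.
move=> a0.
have mf : measurable_fun [set: measurableTypeR R]
    (fun x : measurableTypeR R => a * x + b : measurableTypeR R).
  apply: measurable_funD; last exact: measurable_cst.
  by apply: measurable_funM; [exact: measurable_cst|exact: measurable_id].
split => //; first by rewrite invr_ge0 ltW.
pose mu' := mscale (NngNum (ltW a0))
  (measure_function_pushforward__canonical__measure_function_Measure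
    (@lebesgue_measure R) mf).
move=> A mA; suff -> : lebesgue_measure A = mu' A.
  by rewrite /mu'/= /mscale/= muleA -EFinM mulVf ?mul1e// gt_eqF.
apply: lebesgue_measure_unique => // _ [[x y] _ <-] /=.
rewrite /mu' /= /mscale /= /pushforward.
have -> : (fun z : measurableTypeR R => a * z + b) @^-1` `]x, y]%classic =
    `](x - b) / a, (y - b) / a]%classic.
  apply/seteqP; split => z /=; rewrite !in_itv/= => /andP[h1 h2].
    by rewrite ltr_pdivrMr// ler_pdivlMr//; lra.
  by move: h1 h2; rewrite ltr_pdivrMr// ler_pdivlMr//; lra.
rewrite !lebesgue_measure_itv/= !lte_fin.
rewrite ltr_pM2r ?invr_gt0// ltrD2r; case: ifPn => _; last by rewrite mule0.
by rewrite -!EFinD -EFinM; congr EFin; field; rewrite gt_eqF.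
Qed.

Section product.
Context d1 d2 (T1 : measurableType d1) (T2 : measurableType d2).
Variables (m1 : {sigma_finite_measure set T1 -> \bar R})
  (m2 : {sigma_finite_measure set T2 -> \bar R}).

(** Tonelli: the section of the preimage at [x] is the preimage under [g x] of the section at [f x].
    Letting [g] depend on the first variable is what admits shears. *)
Lemma scales_prod (f : T1 -> T1) (g : T1 -> T2 -> T2) (a b : R) :
  scales m1 f a -> (forall x, scales m2 (g x) b) ->
  measurable_fun [set: T1 * T2] (fun z => g z.1 z.2) ->
  scales (m1 \x m2)%E (fun z => (f z.1, g z.1 z.2)) (a * b).
Proof.
move=> sf sg mg; have [mf a0 _] := sf; have [_ b0 _] := sg point; split.
- by apply: measurable_fun_pair => //; exact: measurableT_comp.
- exact: mulr_ge0.
- move=> A mA; rewrite /product_measure1.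
  transitivity (\int[m1]_x (b%:E * (m2 \o xsection A) (f x)))%E.
    apply: eq_integral => x _ /=; have [_ _ <-] := sg x.
      by congr (m2 _); rewrite !xsectionE.
    exact: measurable_xsection.
  rewrite ge0_integralZl//; last first.
    by apply: measurableT_comp mf; exact: measurable_fun_xsection.
  rewrite (ge0_integral_scales sf (h := m2 \o xsection A)) => [||x//].
  - by rewrite muleA -EFinM mulrC.
  - exact: measurable_fun_xsection.
Qed.

Lemma scales_prod_left (f : T2 -> T1 -> T1) :
  (forall y, scales m1 (f y) 1) ->
  measurable_fun [set: T1 * T2] (fun z => f z.2 z.1) ->
  scales (m1 \x m2)%E (fun z => (f z.2 z.1, z.2)) 1.
Proof.
move=> sf mf.
(* The product measure is defined by integrating over the first factor; here the first factor is the
   one that moves, so the order is exchanged by uniqueness of the product measure. *)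
have prodE (X : set (T1 * T2)) : measurable X ->
    (m1 \x m2)%E X = (\int[m2]_y m1 (ysection X y))%E.
  move=> mX; transitivity ((m1 \x^ m2)%E X) => //.
  by apply: product_measure_unique => //= A B mA mB; exact: product_measure2E.
have mF : measurable_fun [set: T1 * T2] (fun z => (f z.2 z.1, z.2)).
  by apply: measurable_fun_pair => //; exact: measurable_snd.
split => // A mA.
have mFA : measurable ((fun z : T1 * T2 => (f z.2 z.1, z.2)) @^-1` A).
  by rewrite -[X in measurable X]setTI; exact: mF.
rewrite !prodE// mul1e; apply: eq_integral => y _.
have [_ _ /(_ (ysection A y))] := sf y.
rewrite mul1e => <-; last exact: measurable_ysection.
by congr (m1 _); rewrite !ysectionE.
Qed.

End product.

Lemma scales_rV_cons n (F : measurableTypeR R * 'rV[R]_n -> measurableTypeR R * 'rV[R]_n)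
    (f : 'rV[R]_n.+1 -> 'rV[R]_n.+1) (c : R) :
  scales (@lebesgue_measure R \x lebesgue_rV n)%E F c ->
  measurable_fun [set: 'rV[R]_n.+1] f ->
  (forall p, f (rV_cons p) = rV_cons (F p)) ->
  scales (lebesgue_rV n.+1) f c.
Proof.
move=> [mF c0 FE] mf fF; split => // A mA.
rewrite /= /lebesgue_rV_step /pushforward -FE; last first.
  by rewrite -[X in measurable X]setTI; exact: measurable_rV_cons.
congr (_ _); apply/seteqP; split => p /=; by rewrite fF.
Qed.

Lemma rV_cons0 n (p : measurableTypeR R * 'rV[R]_n) : rV_cons p ord0 ord0 = p.1.
Proof. by rewrite mxE unlift_none. Qed.

Lemma rV_consS n (p : measurableTypeR R * 'rV[R]_n) j :
  rV_cons p ord0 (lift ord0 j) = p.2 ord0 j.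
Proof. by rewrite mxE liftK. Qed.

Lemma measurable_rV_affine n (a : R) (b : 'rV[R]_n) :
  measurable_fun [set: 'rV[R]_n] (fun x => a *: x + b).
Proof.
apply: measurable_fun_rVP => i; under eq_fun do rewrite !mxE.
apply: measurable_funD; last exact: measurable_cst.
apply: measurable_funM; [exact: measurable_cst|exact: measurable_coord].
Qed.

Lemma scales_rV_affine n (a : R) (b : 'rV[R]_n) : 0 < a ->
  scales (lebesgue_rV n) (fun x => a *: x + b) (a^-1 ^+ n).
Proof.
move=> a0; elim: n b => [|n IHn] b.
  split => //; first exact: measurable_rV_affine.
  move=> A mA; rewrite expr0 mul1e; congr (_ _); apply/seteqP.
  by split => x /=; rewrite (_ : a *: x + b = x)//; apply/rowP => -[].
pose F (p : measurableTypeR R * 'rV[R]_n) : measurableTypeR R * 'rV[R]_n :=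
  (a * p.1 + b ord0 ord0, a *: p.2 + \row_j b ord0 (lift ord0 j)).
apply: (@scales_rV_cons _ F) => //; last 2 first.
- exact: measurable_rV_affine.
- move=> p; apply/rowP => i; rewrite !mxE.
  by case: unliftP => [j|] -> /=; rewrite ?mxE.
rewrite exprS; apply: (@scales_prod _ _ _ _ (@lebesgue_measure R) (lebesgue_rV n)
  (fun x => a * x + b ord0 ord0)
  (fun _ v => a *: v + \row_j b ord0 (lift ord0 j))).
- exact: scales_affine.
- by move=> _; exact: IHn.
- by apply: (measurableT_comp (measurable_rV_affine _ _)); exact: measurable_snd.
Qed.

Definition shear n (i j : 'I_n) (a : R) (x : 'rV[R]_n) : 'rV[R]_n :=
  x + (a * x ord0 j) *: delta_mx ord0 i.

Lemma measurable_shear n (i j : 'I_n) (a : R) :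
  measurable_fun [set: 'rV[R]_n] (shear i j a).
Proof.
apply: measurable_fun_rVP => k; under eq_fun do rewrite !mxE.
apply: measurable_funD; first exact: measurable_coord.
apply: measurable_funM; last exact: measurable_cst.
apply: measurable_funM; [exact: measurable_cst|exact: measurable_coord].
Qed.

(** Induction on the dimension, by the position of the first coordinate: if it is neither [i] nor
    [j] the shear acts on the tail; if it is [j] the tail is translated; if it is [i] the first
    coordinate is translated by an amount depending on the tail. *)
Lemma scales_shear n (i j : 'I_n) (a : R) : i != j ->
  scales (lebesgue_rV n) (shear i j a) 1.
Proof.
elim: n i j => [[]//|n IHn] i j ij.
have idE : scales (@lebesgue_measure R) id 1.
  split => [||A mA]; [exact: measurable_id|exact: ler01|by rewrite mul1e].
case: (unliftP ord0 i) ij => [i'|] ->; case: (unliftP ord0 j) => [j'|] -> ij.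
- pose F (p : measurableTypeR R * 'rV[R]_n) : measurableTypeR R * 'rV[R]_n :=
    (p.1, shear i' j' a p.2).
  apply: (@scales_rV_cons _ F); last 2 first.
  + exact: measurable_shear.
  + move=> p; apply/rowP => k; rewrite !mxE liftK/=.
    case: (unliftP ord0 k) => [l|] -> /=; rewrite ?mxE ?mulr0 ?addr0//.
  rewrite -[1]mulr1; apply: (@scales_prod _ _ _ _ (@lebesgue_measure R) (lebesgue_rV n)
    id (fun _ v => shear i' j' a v)) => //.
  + by move=> _; apply: IHn; rewrite -(inj_eq (@lift_inj _ ord0)).
  + by apply: (measurableT_comp (measurable_shear _ _ _)); exact: measurable_snd.
- pose F (p : measurableTypeR R * 'rV[R]_n) : measurableTypeR R * 'rV[R]_n :=
    (p.1, 1 *: p.2 + (a * p.1) *: delta_mx ord0 i').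
  apply: (@scales_rV_cons _ F); last 2 first.
  + exact: measurable_shear.
  + move=> p; apply/rowP => k; rewrite !mxE unlift_none/=.
    case: (unliftP ord0 k) => [l|] -> /=; rewrite ?mxE ?mulr0 ?addr0//.
      by rewrite (inj_eq lift_inj) mul1r.
  rewrite -[1]mulr1; apply: (@scales_prod _ _ _ _ (@lebesgue_measure R) (lebesgue_rV n)
    id (fun x v => 1 *: v + (a * x) *: delta_mx ord0 i')) => //.
  + move=> x; have := scales_rV_affine ((a * x) *: delta_mx ord0 i') ltr01.
    by rewrite invr1 expr1n.
  + apply: measurable_fun_rVP => k; under eq_fun do rewrite !mxE.
    apply: measurable_funD; apply: measurable_funM.
    * exact: measurable_cst.
    * by apply: (measurableT_comp (measurable_coord k)); exact: measurable_snd.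
    * apply: measurable_funM; [exact: measurable_cst|exact: measurable_fst].
    * exact: measurable_cst.
- pose F (p : measurableTypeR R * 'rV[R]_n) : measurableTypeR R * 'rV[R]_n :=
    (1 * p.1 + a * p.2 ord0 j', p.2).
  apply: (@scales_rV_cons _ F); last 2 first.
  + exact: measurable_shear.
  + move=> p; apply/rowP => k; rewrite !mxE liftK/=.
    case: (unliftP ord0 k) => [l|] -> /=; rewrite ?mxE ?mulr0 ?addr0//.
      by rewrite mulr1 mul1r.
  apply: (@scales_prod_left _ _ _ _ (@lebesgue_measure R) (lebesgue_rV n)
    (fun v x => 1 * x + a * v ord0 j')).
  + by move=> y; have := scales_affine (a * y ord0 j') ltr01; rewrite invr1.
  + apply: measurable_funD; apply: measurable_funM.
    * exact: measurable_cst.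
    * exact: measurable_fst.
    * exact: measurable_cst.
    * by apply: (measurableT_comp (measurable_coord j')); exact: measurable_snd.
- by rewrite eqxx in ij.
Qed.

End scaling.

(** * Surface measure and polar coordinates *)

Section euclidean_norm.
Context {R : realType} {n : nat}.
Implicit Types x y w : 'rV[R]_n.

Lemma enorm_ge0 x : 0 <= enorm x.
Proof. exact: sqrtr_ge0. Qed.

Lemma enorm_sqr x : enorm x ^+ 2 = \sum_i x ord0 i ^+ 2.
Proof. by rewrite sqr_sqrtr// sumr_ge0// => i _; rewrite sqr_ge0. Qed.

Lemma enormZ (a : R) x : 0 <= a -> enorm (a *: x) = a * enorm x.
Proof.
move=> a0; rewrite /enorm; under eq_bigr do rewrite mxE exprMn.
by rewrite -mulr_sumr sqrtrM ?sqr_ge0// sqrtr_sqr ger0_norm.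
Qed.

Lemma enorm_coord x i : `|x ord0 i| <= enorm x.
Proof.
rewrite -sqrtr_sqr ler_wsqrtr// (bigD1 i)//= lerDl sumr_ge0// => j _.
exact: sqr_ge0.
Qed.

Lemma enorm_radial_proj x : 0 < enorm x -> enorm (radial_proj x) = 1.
Proof.
by move=> x0; rewrite enormZ ?mulVf ?gt_eqF// invr_ge0 ltW.
Qed.

Lemma measurable_unit_sphere : measurable (@unit_sphere R n).
Proof.
have -> : @unit_sphere R n = [set: 'rV[R]_n] `&` @enorm R n @^-1` [set 1].
  by rewrite setTI.
exact: measurable_enorm.
Qed.

Lemma measurable_unit_ball : measurable (@unit_ball R n).
Proof.
have -> : @unit_ball R n = [set: 'rV[R]_n] `&` @enorm R n @^-1` `]-oo, 1[%classic.
  by rewrite setTI; apply/seteqP; split => x /=; rewrite in_itv.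
exact: measurable_enorm.
Qed.

End euclidean_norm.

Section surface.
Context {R : realType} {n : nat}.
Notation lam := (lebesgue_rV n : set 'rV[R]_n -> \bar R).
Notation sigma := (@surface_measure R n).

(** A box has finite measure by induction on the dimension and contains the unit ball. *)
Let cube k : set 'rV[R]_k := [set x | forall i, `|x ord0 i| <= 1].

Let measurable_cube k : measurable (@cube k).
Proof.
have -> : @cube k = \big[setI/setT]_(i < k) [set x : 'rV[R]_k | x ord0 i \in `[-1, 1]].
  rewrite -bigcap_seq; apply/seteqP; split => x /= hx i //=.
    by move=> _; rewrite in_itv/= -ler_norml; exact: hx.
  by have := hx i; rewrite /= mem_index_enum in_itv/= -ler_norml; apply.
apply: big_ind => [//||i _]; first by move=> A B; exact: measurableI.
have := @measurable_coord R k i measurableT `[-1, 1]%classic (measurable_itv _).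
by rewrite setTI.
Qed.

Let cube_lty k : (lebesgue_rV k (@cube k) < +oo)%E.
Proof.
elim: k => [|k IH].
  by apply: le_lt_trans (ltry 1); rewrite [leLHS]/= diracE; case: (_ \in _).
rewrite /= /lebesgue_rV_step /pushforward.
have -> : @rV_cons R k @^-1` @cube k.+1 = `[-1, 1]%classic `*` @cube k.
  apply/seteqP; split => -[a v] /=.
    rewrite in_itv/= -ler_norml => h; split; first by have := h ord0; rewrite rV_cons0.
    by move=> i; have := h (lift ord0 i); rewrite rV_consS.
  rewrite in_itv/= -ler_norml.
  by move=> [h1 h2] i; case: (unliftP ord0 i) => [j|] ->; rewrite ?rV_consS ?rV_cons0.
have := @product_measure1E _ _ _ _ R (@lebesgue_measure R) (lebesgue_rV k)
  `[-1, 1]%classic (@cube k) (measurable_itv _) (@measurable_cube k).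
move=> /= ->; apply: lte_mul_pinfty => //; rewrite lebesgue_measure_itv/=.
by case: ifP; rewrite ?fin_numB.
Qed.

Lemma lebesgue_rV_unit_ball_lty : (lam (@unit_ball R n) < +oo)%E.
Proof.
apply: le_lt_trans (cube_lty n).
rewrite le_measure ?inE//; [exact: measurable_unit_ball|exact: measurable_cube|].
move=> x /= x1 i.
exact: le_trans (enorm_coord x i) (ltW x1).
Qed.

Lemma surface_measureE (A : set 'rV[R]_n) :
  sigma A = (n%:R%:E * lam [set x | punctured_ball x /\ A (radial_proj x)])%E.
Proof. by []. Qed.

(** Finiteness makes bounded measurable functions integrable on the sphere and allows Fubini with
    [sigma] as a factor. *)
Lemma surface_measure_fin_num : fin_num_fun sigma.
Proof.
move=> A mA; rewrite ge0_fin_numE; last exact: measure_ge0.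
rewrite surface_measureE; apply: lte_mul_pinfty; [by rewrite lee_fin|by []|].
apply: le_lt_trans lebesgue_rV_unit_ball_lty.
apply: le_measure; rewrite ?inE.
- apply: (@measurableI _ _ (@punctured_ball R n) (@radial_proj R n @^-1` A)).
    exact: measurable_punctured_ball.
  by rewrite -[X in measurable X]setTI; exact: measurable_radial_proj.
- exact: measurable_unit_ball.
- by move=> x [/andP[_ ? _]].
Qed.

HB.instance Definition _ := @Measure_isFinite.Build _ _ _ sigma
  surface_measure_fin_num.

Lemma surface_measure_setC_sphere : sigma (~` @unit_sphere R n) = 0%E.
Proof.
rewrite surface_measureE (_ : [set x | _ /\ _] = set0) ?measure0 ?mule0//.
rewrite -subset0 => x /= [/andP[x0 _]]; apply.
exact: enorm_radial_proj.
Qed.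

(** By its definition [sigma] is [n] times the pushforward under [radial_proj] of Lebesgue measure
    on the punctured ball, and the complement of the sphere is null for it. *)
Lemma ge0_integral_surface (F : 'rV[R]_n -> \bar R) :
  measurable_fun [set: 'rV[R]_n] F -> (forall w, 0 <= F w)%E ->
  (\int[sigma]_(w in @unit_sphere R n) F w =
   n%:R%:E * \int[lam]_(y in @punctured_ball R n) F (radial_proj y))%E.
Proof.
move=> mF F0.
have mP := @measurable_punctured_ball R n.
have mr := @measurable_radial_proj R n.
have -> : (\int[sigma]_(w in @unit_sphere R n) F w = \int[sigma]_w F w)%E.
  rewrite [RHS](@ge0_negligible_integral _ _ _ _ _ (~` @unit_sphere R n))//.
  - by rewrite setTD setCK.
  - by apply: measurableC; exact: measurable_unit_sphere.
  - exact: surface_measure_setC_sphere.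
pose mu := mrestr (lebesgue_rV n) mP.
pose nu := measure_function_pushforward__canonical__measure_function_Measure
      mu mr.
transitivity (\int[mscale (NngNum (ler0n R n)) nu]_w F w)%E.
  apply: eq_measure_integral => A mA _; rewrite /= /surface_measure /mscale /=.
  by congr (_ * lam _)%E; rewrite [RHS]setIC.
rewrite ge0_integral_mscale//; congr (_ * _)%E.
transitivity (\int[pushforward mu (@radial_proj R n)]_w F w)%E => //.
rewrite ge0_integral_pushforward// preimage_setT.
rewrite (@ge0_negligible_integral _ _ _ _ _ (~` @punctured_ball R n))//.
- rewrite setTD setCK; apply: eq_measure_integral => A mA AP.
  by rewrite /mu /mrestr; congr (lam _); apply/setIidl.
- exact: measurableC.
- exact: measurableT_comp.
- by move=> x _ /=.
- by rewrite /= /mrestr setICl measure0.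
Qed.

Definition rot (i j : 'I_n) (c s : R) (x : 'rV[R]_n) : 'rV[R]_n :=
  \row_k (if k == i then c * x ord0 i - s * x ord0 j
          else if k == j then s * x ord0 i + c * x ord0 j else x ord0 k).

(* A plane rotation is a product of three shears. *)
Lemma scales_rot (i j : 'I_n) (c s : R) : i != j -> -1 < c ->
  c ^+ 2 + s ^+ 2 = 1 -> scales (lebesgue_rV n) (rot i j c s) 1.
Proof.
(* For an angle theta this is -tan(theta / 2), the coefficient of the two outer shears; [-1 < c]
   excludes the half turn, where it is infinite. *)
move=> ij c1 cs; pose a := - s / (1 + c).
have c0 : 1 + c != 0 by rewrite gt_eqF// -ltrBlDl sub0r.
have as1 : 1 + a * s = c.
  apply: (mulIf c0); rewrite /a mulrDl mul1r mulrAC divfK//.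
  rewrite mulNr -expr2 -(addrK (c ^+ 2) (s ^+ 2)) (addrC (s ^+ 2)) cs; ring.
have -> : rot i j c s = shear i j a \o (shear j i s \o shear i j a).
  have shE u v b x k : shear u v b x ord0 k =
      x ord0 k + b * x ord0 v * (k == u)%:R by rewrite !mxE.
  apply/funext => x; apply/rowP => k; rewrite /= !shE !mxE !eqxx.
  rewrite (eq_sym j) (negbTE ij).
  have [->|ki] := eqVneq k i.
    transitivity ((1 + a * s) * x ord0 i + a * (1 + (1 + a * s)) * x ord0 j).
      by rewrite as1 /a divfK//; ring.
    by rewrite (negbTE ij) /= ?mulr1 ?mulr0 ?addr0; ring.
  have [->|kj] := eqVneq k j; rewrite ?mulr1 ?mulr0 ?addr0//.
  by rewrite -as1; ring.
have := scales_comp (scales_shear a ij) (scales_comp (scales_shear s _) (scales_shear a ij)).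
by rewrite !mul1r; apply; rewrite eq_sym.
Qed.

Lemma enorm_rot (i j : 'I_n) (c s : R) x : i != j -> c ^+ 2 + s ^+ 2 = 1 ->
  enorm (rot i j c s x) = enorm x.
Proof.
move=> ij cs; rewrite /enorm; congr Num.sqrt.
rewrite (bigD1 i)//= [RHS](bigD1 i)//= (bigD1 j)/= 1?eq_sym//.
have ji : (j == i) = false by rewrite eq_sym (negbTE ij).
rewrite [in RHS](bigD1 j)/= 1?eq_sym// !mxE !eqxx ji !addrA.
congr (_ + _); last first.
  by apply: eq_bigr => k /andP[ki kj]; rewrite mxE (negbTE ki) (negbTE kj).
transitivity ((c ^+ 2 + s ^+ 2) * (x ord0 i ^+ 2 + x ord0 j ^+ 2)); first by ring.
by rewrite cs mul1r.
Qed.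

Lemma rotZ (i j : 'I_n) (c s a : R) x : rot i j c s (a *: x) = a *: rot i j c s x.
Proof.
by apply/rowP => k; rewrite !mxE; case: eqP => _; [|case: eqP => _]; ring.
Qed.

Lemma rotB (i j : 'I_n) (c s : R) x y :
  rot i j c s (x - y) = rot i j c s x - rot i j c s y.
Proof.
by apply/rowP => k; rewrite !mxE; case: eqP => _; [|case: eqP => _]; ring.
Qed.

Lemma scales_surface_rot (i j : 'I_n) (c s : R) : i != j -> -1 < c ->
  c ^+ 2 + s ^+ 2 = 1 -> scales sigma (rot i j c s) 1.
Proof.
move=> ij c1 cs; have [mr _ rE] := scales_rot ij c1 cs; split => // A mA.
rewrite mul1e !surface_measureE -[in RHS](mul1e (lam _)) -rE; last first.
  apply: (@measurableI _ _ (@punctured_ball R n) (@radial_proj R n @^-1` A)).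
    exact: measurable_punctured_ball.
  by rewrite -[X in measurable X]setTI; exact: measurable_radial_proj.
congr (_ * lam _)%E; apply/seteqP; split => x /=;
  by rewrite /punctured_ball /radial_proj/= enorm_rot// rotZ.
Qed.

Lemma Rintegral_surface_rot (i j : 'I_n) (c s : R) (F : 'rV[R]_n -> R) :
  i != j -> -1 < c -> c ^+ 2 + s ^+ 2 = 1 -> measurable_fun [set: 'rV[R]_n] F ->
  sigma.-integrable (@unit_sphere R n) (EFin \o (F \o rot i j c s)) ->
  \int[sigma]_(w in @unit_sphere R n) F (rot i j c s w) =
  \int[sigma]_(w in @unit_sphere R n) F w.
Proof.
move=> ij c1 cs mF iF; have [mr _ rE] := scales_surface_rot ij c1 cs.
have preS : rot i j c s @^-1` @unit_sphere R n = @unit_sphere R n.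
  by apply/seteqP; split => x; rewrite /unit_sphere/= enorm_rot.
congr fine; rewrite -[in LHS]preS.
rewrite -(@integral_pushforward _ _ _ _ R _ mr sigma _ (EFin \o F))//=.
- by apply: eq_measure_integral => A mA _; rewrite /= /pushforward rE// mul1e.
- exact/measurable_EFinP.
- by rewrite preS.
- exact: measurable_unit_sphere.
Qed.

Lemma integrable_surface (F : 'rV[R]_n -> R) (M : R) :
  measurable_fun [set: 'rV[R]_n] F -> (forall w, unit_sphere w -> `|F w| <= M) ->
  sigma.-integrable (@unit_sphere R n) (EFin \o F).
Proof.
move=> mF FM; apply: (@measurable_bounded_integrable _ _ _ sigma).
- exact: (@measurable_unit_sphere R n).
- by rewrite -ge0_fin_numE//; exact: (surface_measure_fin_num (@measurable_unit_sphere R n)).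
- exact: measurable_funTS.
- exists M; split; first exact: num_real.
  by move=> K MK w wS; apply: le_trans (ltW MK); exact: FM.
Qed.

End surface.

(** * Rules of differentiation in one variable *)

Section derivatives.
Context {R : realType}.
Implicit Types f g : R -> R.

Lemma isdC (x a : R) : is_derive x 1 (fun _ : R => a) 0.
Proof. exact: is_derive_cst. Qed.

Lemma isdI (x : R) : is_derive x 1 (fun y : R => y) 1.
Proof. exact: is_derive_id. Qed.

Lemma isdD f g (x a b : R) : is_derive x 1 f a -> is_derive x 1 g b ->
  is_derive x 1 (fun y => f y + g y) (a + b).
Proof. by move=> ? ?; exact: is_deriveD. Qed.

Lemma isdB f g (x a b : R) : is_derive x 1 f a -> is_derive x 1 g b ->
  is_derive x 1 (fun y => f y - g y) (a - b).
Proof. by move=> ? ?; exact: is_deriveB. Qed.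

Lemma isdM f g (x a b : R) : is_derive x 1 f a -> is_derive x 1 g b ->
  is_derive x 1 (fun y => f y * g y) (a * g x + f x * b).
Proof.
move=> da db; apply: is_derive_eq (is_deriveM da db) _.
by rewrite addrC /GRing.scale/= mulrC.
Qed.

Lemma isdZ f (c x a : R) : is_derive x 1 f a ->
  is_derive x 1 (fun y => c * f y) (c * a).
Proof. by move=> da; have := isdM (isdC x c) da; rewrite mul0r add0r. Qed.

Lemma isdX f (x a : R) p : is_derive x 1 f a ->
  is_derive x 1 (fun y => f y ^+ p) (p%:R * f x ^+ p.-1 * a).
Proof.
move=> da; elim: p => [|p IH]; first by rewrite !mul0r; exact: isdC.
have := isdM da IH; under eq_fun do rewrite -exprS.
move=> /is_derive_eq; apply; case: p {IH} => [|p] /=; first by ring.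
by rewrite -(natr1 p.+1) exprS; ring.
Qed.

Lemma isdV f (x a : R) : f x != 0 -> is_derive x 1 f a ->
  is_derive x 1 (fun y => (f y)^-1) (- a * (f x)^-1 ^+ 2).
Proof.
move=> fx da; apply: is_derive_eq (is_deriveV fx da) _.
by rewrite /GRing.scale/= exprVn; ring.
Qed.

Lemma isd_comp f g (x a b : R) : is_derive x 1 g b -> is_derive (g x) 1 f a ->
  is_derive x 1 (fun y => f (g y)) (a * b).
Proof.
by move=> dg df; apply: is_derive_eq (is_derive1_comp df dg) _.
Qed.

Lemma isd_sum n (f : 'I_n -> R -> R) (x : R) (a : 'I_n -> R) :
  (forall i, is_derive x 1 (f i) (a i)) ->
  is_derive x 1 (fun y => \sum_i f i y) (\sum_i a i).
Proof.
elim: n f a => [|n IH] f a df.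
  by rewrite big_ord0; under eq_fun do rewrite big_ord0; exact: isdC.
rewrite big_ord_recl; under eq_fun do rewrite big_ord_recl.
by apply: isdD => //; exact: IH.
Qed.

Lemma isd_near f g (x a : R) : (\near x, f x = g x) -> is_derive x 1 f a ->
  is_derive x 1 g a.
Proof.
move=> fg df; exact: near_eq_is_derive df.
Qed.

Lemma isd_derive1 f (x a : R) : is_derive x 1 f a -> derive1 f x = a.
Proof. by move=> df; rewrite derive1E derive_val. Qed.

Lemma isd_continuous f (x a : R) : is_derive x 1 f a -> {for x, continuous f}.
Proof. by move=> df; apply/differentiable_continuous/derivable1_diffP. Qed.

End derivatives.

(** * Polar coordinates for nonnegative functions *)

Section polar_coordinates.
Context {R : realType} {n : nat} (n_gt0 : (0 < n)%N).
Notation lam := (lebesgue_rV n : set 'rV[R]_n -> \bar R).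
Notation leb := (@lebesgue_measure R).
Notation sigma := (@surface_measure R n).

Lemma integral_indicM d (T : measurableType d) (mu : {measure set T -> \bar R})
    (D : set T) (f : T -> R) :
  (\int[mu]_(x in D) (f x)%:E = \int[mu]_x (\1_D x * f x)%:E)%E.
Proof.
rewrite integral_mkcond epatch_indic; apply: eq_integral => x _ /=.
by rewrite mulrC.
Qed.

(** The origin is invariant under dilation by 2, which multiplies its finite measure by 2^-n, and n
    > 0. *)
Lemma lebesgue_rV_origin : lam [set x | enorm x = 0] = 0%E.
Proof.
have mO : measurable [set x : 'rV[R]_n | enorm x = 0].
  have := @measurable_enorm R n measurableT [set 0] (measurable_set1 _).
  by rewrite setTI.
have fin : lam [set x | enorm x = 0] \is a fin_num.
  rewrite ge0_fin_numE//; apply: le_lt_trans (@lebesgue_rV_unit_ball_lty R n).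
  rewrite le_measure ?inE//; first exact: measurable_unit_ball.
  by move=> x /= x0; rewrite /unit_ball/= x0.
have [_ _ /(_ _ mO)] := scales_rV_affine (0 : 'rV[R]_n) (ltr0n R 2).
have -> : (fun x : 'rV[R]_n => 2%:R *: x + 0) @^-1` [set x | enorm x = 0] =
    [set x | enorm x = 0].
  apply/seteqP; split => x /=; rewrite addr0 enormZ// => /eqP.
    by rewrite mulf_eq0 pnatr_eq0/= => /eqP.
  by move=> /eqP ->; rewrite mulr0.
rewrite -(fineK fin) -EFinM => -[] /eqP.
rewrite -{1}[fine _]mul1r -subr_eq0 -mulrBl mulf_eq0 subr_eq0 => /orP[|/eqP->//].
by rewrite gt_eqF// exprn_ilt1 ?invr_ge0 ?invf_lt1 ?ltr1n -?lt0n.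
Qed.

(** Evaluates the radial variable left over at the end of the proof of [polar_coordinates]. *)
Lemma integral_power_tail (rho : R) : 0 < rho ->
  (\int[leb]_(t in `]rho, +oo[) (t^-1 ^+ n.+1)%:E = (n%:R^-1 * rho^-1 ^+ n)%:E)%E.
Proof.
move=> r0.
pose F (t : R) := - n%:R^-1 * t^-1 ^+ n.
have nn0 : n%:R != 0 :> R by rewrite pnatr_eq0 -lt0n.
have dV (t : R) m : 0 < t -> is_derive t 1 (fun y : R => y^-1 ^+ m)
    (m%:R * t^-1 ^+ m.-1 * (- 1 * t^-1 ^+ 2)).
  by move=> t0; apply: isdX; apply: isdV; rewrite gt_eqF.
have dF (t : R) : 0 < t -> is_derive t 1 F (t^-1 ^+ n.+1).
  move=> t0; apply: is_derive_eq (isdZ _ (dV t n t0)) _.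
  rewrite -(prednK n_gt0) /= in nn0 *; rewrite !exprS expr0; field.
  by rewrite gt_eqF//= addr1_eq.
have cF (t : R) : 0 < t -> {for t, continuous F} by move=> /dF/isd_continuous.
rewrite integral_itv_obnd_cbnd//; last first.
  by apply/measurable_EFinP/measurable_funX/measurable_funTS; exact: measurable_invr.
rewrite (@ge0_continuous_FTC2y _ _ F _ 0).
- by rewrite /F sub0e -EFinN mulNr opprK.
- by move=> t rt; rewrite exprn_ge0// invr_ge0 ltW// (lt_le_trans r0).
- apply: derivable_within_continuous => t; rewrite in_itv/= andbT => rt.
  by have [] := dV t n.+1 (lt_le_trans r0 rt).
- have -> : 0 = - n%:R^-1 * 0 ^+ n :> R by rewrite expr0n gtn_eqF// mulr0.
  apply: cvgM; first exact: cvg_cst.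
  apply: (@cvg_comp _ _ _ (fun x : R => x^-1) (fun y : R => y ^+ n) _
    (nbhs (0 : R))); last exact: exprn_continuous.
  apply/gtr0_cvgV0; last exact: cvg_id.
  exact: nbhs_pinfty_gt.
- by move=> t rt; have [] := dF t (lt_trans r0 rt).
- by apply: cvg_at_right_filter; exact: cF.
- by move=> t; rewrite in_itv/= andbT => rt; by apply: isd_derive1; apply: dF; exact: lt_trans r0 rt.
Qed.

Ltac mfun := repeat match goal with
 | |- measurable_fun _ (fun _ => ?a) => exact: measurable_cst
 | |- measurable_fun _ (fun x => EFin _) => apply/measurable_EFinP
 | |- measurable_fun _ (fun x => @GRing.mul _ _ _) => apply: measurable_funM
 | |- measurable_fun _ (fun x => @GRing.exp _ _ _) => apply: measurable_funX
 | |- measurable_fun _ (fun x => fst x) => exact: measurable_fst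
 | |- measurable_fun _ (fun x => snd x) => exact: measurable_snd
 | |- measurable_fun _ (fun x => x) => exact: measurable_id
 end.

Lemma indic_punctured_ball_dilation (t : R) (y : 'rV[R]_n) : 0 < t ->
  \1_(@punctured_ball R n) y =
  \1_[set p : measurableTypeR R * 'rV[R]_n | enorm p.2 < p.1] (t, t *: y) *
  \1_(`]0, +oo[%classic) (t * enorm y) :> R.
Proof.
move=> t0; rewrite !indicE -natrM mulnb; congr (_%:R); apply/esym.
congr nat_of_bool; apply/andP/idP; rewrite !inE /punctured_ball/=.
  rewrite in_itv/= andbT (enormZ _ (ltW t0)) pmulr_rgt0// => -[].
  by rewrite -[X in _ < X]mulr1 ltr_pM2l// => -> ->.
move=> /andP[y0 y1]; rewrite in_itv/= andbT (enormZ _ (ltW t0)) pmulr_rgt0//.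
by rewrite -[X in _ < X]mulr1 ltr_pM2l.
Qed.

(** By the definition of [sigma] the right side is an integral over t > 0 and y in the punctured
    ball of a function of t y / |y|. The dilation t -> |y| t removes the normalisation, z = t y then
    isolates F(z), and the remaining integral of t^(-n-1) over t > |z| is |z|^-n / n. *)
Lemma polar_coordinates (F : 'rV[R]_n -> R) :
  measurable_fun [set: 'rV[R]_n] F -> (forall x, 0 <= F x) ->
  (\int[lam]_x (F x)%:E =
   \int[leb]_(t in `]0%R, +oo[) \int[sigma]_(w in @unit_sphere R n)
      (t ^+ n.-1 * F (t *: w))%:E)%E.
Proof.
move=> mF F0.
have eS (x : R) : x ^+ n = x * x ^+ n.-1 by rewrite -exprS prednK.
have nn0 : n%:R != 0 :> R by rewrite pnatr_eq0 -lt0n.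
pose T : set (measurableTypeR R) := `]0, +oo[%classic.
pose B := @punctured_ball R n.
pose C : set (measurableTypeR R * 'rV[R]_n) := [set p | enorm p.2 < p.1].
have mT : measurable T by exact: measurable_itv.
have mB : measurable B by exact: measurable_punctured_ball.
have mn : measurable_fun [set: measurableTypeR R * 'rV[R]_n] (fun p => enorm p.2 : R).
  by apply: (measurableT_comp (@measurable_enorm R n)); exact: measurable_snd.
have mC : measurable C.
  have mlt : measurable_fun [set: measurableTypeR R * 'rV[R]_n]
      (fun p => enorm p.2 < p.1 :> R).
    by apply: measurable_fun_ltr => //; exact: measurable_fst.
  by have := mlt measurableT [set true] I; rewrite setTI.
have mi A : measurable A -> measurable_fun [set: measurableTypeR R * 'rV[R]_n]
    (fun p => \1_A p.1 : R).
  by move=> mA; apply: (measurableT_comp (measurable_indic mA)); exact: measurable_fst.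
have mj A : measurable A -> measurable_fun [set: measurableTypeR R * 'rV[R]_n]
    (fun p => \1_A p.2 : R).
  by move=> mA; apply: (measurableT_comp (measurable_indic mA)); exact: measurable_snd.
have msc d (X : measurableType d) (f : X -> R) (g : X -> 'rV[R]_n) :
    measurable_fun [set: X] f -> measurable_fun [set: X] g ->
    measurable_fun [set: X] (fun x => f x *: g x).
  move=> mf mg; apply: measurable_fun_rVP => i; under eq_fun do rewrite mxE.
  by apply: measurable_funM => //; exact: (measurableT_comp (measurable_coord i)).
(* [K1] is the integrand in (t, y) before any substitution, [K2] after t -> |y| t, and [K3] after z
   = t y, where y in the punctured ball has become 0 < |z| < t. *)
pose K1 (p : measurableTypeR R * 'rV[R]_n) : R :=
  \1_T p.1 * \1_B p.2 * (p.1 ^+ n.-1 * F (p.1 *: radial_proj p.2)).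
pose K2 (p : measurableTypeR R * 'rV[R]_n) : R :=
  \1_T p.1 * \1_B p.2 * (p.1 ^+ n.-1 * enorm p.2 ^+ n * F (p.1 *: p.2)).
pose K3 (p : measurableTypeR R * 'rV[R]_n) : R :=
  \1_T p.1 * \1_C p * (\1_T (enorm p.2) * p.1^-1 ^+ n.+1 * enorm p.2 ^+ n * F p.2).
have mK1 : measurable_fun setT K1.
  rewrite /K1; mfun; [exact: mi|exact: mj|exact: measurable_fst|].
  apply: (measurableT_comp mF).
  apply: msc; first exact: measurable_fst.
  by apply: (measurableT_comp (@measurable_radial_proj R n)); exact: measurable_snd.
have mK2 : measurable_fun setT K2.
  rewrite /K2; mfun; [exact: mi|exact: mj|exact: measurable_fst|exact: mn|].
  by apply: (measurableT_comp mF); apply: msc; [exact: measurable_fst|exact: measurable_snd].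
have mK3 : measurable_fun setT K3.
  rewrite /K3; mfun; [exact: mi|exact: measurable_indic| | |exact: mn|].
  - exact: (measurableT_comp (measurable_indic mT)).
  - by apply: (measurableT_comp measurable_invr); exact: measurable_fst.
  - by apply: (measurableT_comp mF); exact: measurable_snd.
have i0 U (A : set U) x : 0 <= \1_A x :> R by rewrite indicE.
have T0 (p : measurableTypeR R * 'rV[R]_n) (b c : R) : 0 <= b ->
    (0 <= p.1 -> 0 <= c) -> 0 <= \1_T p.1 * b * c.
  move=> b0 c0; rewrite indicE; have [/set_mem|_] := boolP (p.1 \in T).
    by rewrite /T/= in_itv/= andbT => /ltW ?; rewrite !mulr_ge0 ?c0.
  by rewrite !mul0r.
have K10 p : 0 <= K1 p by apply: T0 => // p0; rewrite mulr_ge0// exprn_ge0.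
have K20 p : 0 <= K2 p.
  by apply: T0 => // p0; rewrite !mulr_ge0// ?exprn_ge0// enorm_ge0.
have K30 p : 0 <= K3 p.
  apply: T0 => // p0; apply: mulr_ge0 => //; apply: mulr_ge0; last first.
    by rewrite exprn_ge0// enorm_ge0.
  by apply: mulr_ge0 => //; rewrite exprn_ge0// invr_ge0.
have K1E p : K1 p = \1_T p.1 * \1_B p.2 * (p.1 ^+ n.-1 * F (p.1 *: radial_proj p.2)) by [].
have K2E p : K2 p = \1_T p.1 * \1_B p.2 * (p.1 ^+ n.-1 * enorm p.2 ^+ n * F (p.1 *: p.2)) by [].
have K3E p : K3 p = \1_T p.1 * \1_C p * (\1_T (enorm p.2) * p.1^-1 ^+ n.+1 * enorm p.2 ^+ n * F p.2) by [].
clear i0 T0; clearbody K1 K2 K3.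
have n0 : (0 <= n%:R%:E :> \bar R)%E by rewrite lee_fin.
have E1 : (\int[leb]_(t in T) \int[sigma]_(w in @unit_sphere R n)
      (t ^+ n.-1 * F (t *: w))%:E = n%:R%:E * \int[leb]_t \int[lam]_y (K1 (t, y))%:E)%E.
  rewrite integral_mkcond -ge0_integralZl//.
  - apply: eq_integral => t _; rewrite patchE; case: ifPn => tT.
      rewrite ge0_integral_surface//.
      + by rewrite integral_indicM; congr (_ * _)%E; apply: eq_integral => y _;
          rewrite K1E/= [\1_T _]indicE tT mul1r.
      + apply/measurable_EFinP/measurable_funM; first exact: measurable_cst.
        apply: (measurableT_comp mF).
        by have := measurable_rV_affine t (0 : 'rV[R]_n);
          under eq_fun do rewrite addr0.
      + move: tT => /set_mem; rewrite /T/= in_itv/= andbT => /ltW t0 w.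
        by rewrite lee_fin mulr_ge0// exprn_ge0.
    rewrite integral0_eq ?mule0// => y _.
    by rewrite K1E/= indicE (negbTE tT) !mul0r.
  - apply: (measurable_fun_fubini_tonelli_F (EFin \o K1)) => //.
    exact/measurable_EFinP.
  - by move=> t _; apply: integral_ge0 => y _; rewrite lee_fin.
have fub (K : measurableTypeR R * 'rV[R]_n -> R) : measurable_fun [set: measurableTypeR R * 'rV[R]_n] K ->
    (forall p, 0 <= K p) ->
    (\int[leb]_t \int[lam]_y (K (t, y))%:E = \int[lam]_y \int[leb]_t (K (t, y))%:E)%E.
  move=> mK K0; apply: (fubini_tonelli (EFin \o K)); first exact/measurable_EFinP.
  by move=> p; rewrite lee_fin.
have E2 : (\int[lam]_y \int[leb]_t (K1 (t, y))%:E =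
    \int[lam]_y \int[leb]_t (K2 (t, y))%:E)%E.
  apply: eq_integral => y _.
  have [yB|yB] := boolP (y \in B); last first.
    by rewrite !integral0_eq// => t _; rewrite ?K1E ?K2E/= [\1_B _]indicE (negbTE yB) mulr0 mul0r.
  have /andP[y0 _] := set_mem yB.
  have sy := scales_affine 0 y0.
  have y1 := gt_eqF y0.
  have -> : (\int[leb]_t (K1 (t, y))%:E =
      (enorm y)%:E * \int[leb]_t (K1 (enorm y * t + 0, y))%:E)%E.
    rewrite (ge0_integral_scales (h := fun t => (K1 (t, y))%:E) sy).
    - by rewrite muleA -EFinM divff ?y1// mul1e.
    - by apply/measurable_EFinP; exact: (measurableT_comp mK1 (pair2_measurable _)).
    - by move=> t; rewrite lee_fin.
  rewrite -ge0_integralZl//.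
  - apply: eq_integral => t _; rewrite -EFinM; congr EFin; rewrite K1E K2E /= addr0.
    have -> : \1_T (enorm y * t) = \1_T t :> R.
      rewrite !indicE; congr (_%:R); congr nat_of_bool; apply/idP/idP;
        rewrite !inE /T/= !in_itv/= !andbT pmulr_rgt0//.
    have -> : (enorm y * t) *: radial_proj y = t *: y.
      by rewrite /radial_proj scalerA [_ * t]mulrC -mulrA divff ?y1// mulr1.
    by rewrite exprMn eS; ring.
  - apply/measurable_EFinP; apply: (measurableT_comp mK1).
    apply: measurable_fun_pair; last exact: measurable_cst.
    by have [] := sy.
  - by move=> t _; rewrite lee_fin.
  - by rewrite lee_fin ltW.
have E3 : (\int[leb]_t \int[lam]_y (K2 (t, y))%:E =
    \int[leb]_t \int[lam]_y (K3 (t, y))%:E)%E.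
  apply: eq_integral => t _.
  have [tT|tT] := boolP (t \in T); last first.
    have T0 : \1_T t = 0 :> R by rewrite indicE (negbTE tT).
    by rewrite (integral0_eq lam) ?(integral0_eq lam) => [|y _|y _]; rewrite ?K2E ?K3E/= ?T0 ?mul0r.
  have t0 : 0 < t by move: tT; rewrite inE /T/= in_itv/= andbT.
  have st := scales_rV_affine (0 : 'rV[R]_n) t0.
  have [mt _ _] := st.
  pose h (z : 'rV[R]_n) : R := t ^+ n * K3 (t, z).
  have mh : measurable_fun [set: 'rV[R]_n] h.
    apply: measurable_funM; first exact: measurable_cst.
    exact: (measurableT_comp mK3 (pair1_measurable _)).
  have h0 z : 0 <= h z by apply: mulr_ge0 (K30 _); exact: exprn_ge0 (ltW t0).
  have hE z : h z = t ^+ n * K3 (t, z) by [].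
  clearbody h.
  transitivity (\int[lam]_y (h (t *: y + 0))%:E)%E.
    apply: eq_integral => y _; congr EFin; rewrite hE K2E K3E/= addr0 (enormZ _ (ltW t0)).
    rewrite (indic_punctured_ball_dilation y t0).
    rewrite exprMn [t^-1 ^+ _]exprS exprVn [t ^+ n]eS; field.
    by rewrite expf_neq0 ?gt_eqF.
  rewrite (ge0_integral_scales (h := fun z => (h z)%:E) st).
  - rewrite -ge0_integralZl//.
    + apply: eq_integral => z _; rewrite -EFinM hE mulrA -exprMn mulVf ?gt_eqF//.
      by rewrite expr1n mul1r.
    + exact/measurable_EFinP.
    + by move=> z _; rewrite lee_fin.
    + by rewrite lee_fin exprn_ge0// invr_ge0 ltW.
  - exact/measurable_EFinP.
  - by move=> z; rewrite lee_fin.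
rewrite [RHS]E1 (fub _ mK1 K10) E2 -(fub _ mK2 K20) E3 (fub _ mK3 K30).
clear E1 E2 E3 fub K1E K2E mK1 mK2 K10 K20 K1 K2 mi mj msc mn.
rewrite -ge0_integralZl//; last 2 first.
- apply: (measurable_fun_fubini_tonelli_G (EFin \o K3)); first exact/measurable_EFinP.
  by move=> p; rewrite lee_fin.
- by move=> y _; apply: integral_ge0 => t _; rewrite lee_fin.
have mO : measurable [set x : 'rV[R]_n | enorm x = 0].
  have := @measurable_enorm R n measurableT [set 0] (measurable_set1 _).
  by rewrite setTI.
(* The origin is discarded because [K3] vanishes there while [F] may not. *)
rewrite (@ge0_negligible_integral _ _ _ lam _ [set x | enorm x = 0])//; last 3 first.
- exact/measurable_EFinP.
- by move=> x _; rewrite lee_fin.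
- exact: lebesgue_rV_origin.
rewrite [RHS](@ge0_negligible_integral _ _ _ lam _ [set x | enorm x = 0])//; last 3 first.
- apply: emeasurable_funM => //.
  apply: (measurable_fun_fubini_tonelli_G (EFin \o K3)); first exact/measurable_EFinP.
  by move=> p; rewrite lee_fin.
- move=> x _; rewrite mule_ge0//; apply: integral_ge0 => t _; rewrite lee_fin//.
- exact: lebesgue_rV_origin.
apply: eq_integral => z; rewrite inE => -[_ /= z0].
have {}z0 : 0 < enorm z by rewrite lt_neqAle enorm_ge0 andbT eq_sym; apply/eqP.
transitivity (n%:R%:E * ((enorm z ^+ n * F z)%:E *
    \int[leb]_(t in `]enorm z, +oo[) (t^-1 ^+ n.+1)%:E))%E.
  rewrite integral_power_tail// -!EFinM; congr EFin.
  by rewrite exprVn; field; rewrite nn0/= expf_neq0// gt_eqF.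
congr (_ * _)%E; rewrite integral_indicM -ge0_integralZl//.
- apply: eq_integral => t _; rewrite -EFinM K3E/=; congr EFin.
  have -> : \1_T (enorm z) = 1 :> R by rewrite indicE mem_set// /T/= in_itv/= z0.
  have -> : \1_T t * \1_C (t, z) = \1_(`]enorm z, +oo[) t :> R.
    rewrite !indicE -natrM mulnb; congr (_%:R).
    congr nat_of_bool; apply/andP/idP; rewrite !inE /T /C/= !in_itv/= !andbT.
      by case.
    by move=> zt; split => //; exact: lt_trans zt.
  ring.
- apply/measurable_EFinP/measurable_funM; first exact: measurable_indic.
  by apply: measurable_funX; exact: measurable_invr.
- move=> t _; rewrite lee_fin indicE.
  have [/set_mem|_] := boolP (t \in _); last by rewrite mul0r.
  rewrite /= in_itv/= andbT => zt; rewrite mul1r exprn_ge0// invr_ge0.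
  exact: ltW (lt_trans z0 zt).
- by rewrite lee_fin mulr_ge0// exprn_ge0// ltW.
Qed.

End polar_coordinates.

(** * Orthogonality of radial spherical means to annihilated kernels *)

Section orthogonality.
Context {R : realType} {n : nat} (n_gt0 : (0 < n)%N).
Notation lam := (lebesgue_rV n : set 'rV[R]_n -> \bar R).
Notation leb := (@lebesgue_measure R).
Notation sigma := (@surface_measure R n).

Lemma integral_scales1 d (T : measurableType d) (mu : {measure set T -> \bar R})
    (f : T -> T) (h : T -> R) :
  scales mu f 1 -> measurable_fun [set: T] h ->
  mu.-integrable [set: T] (EFin \o (h \o f)) ->
  (\int[mu]_x (h (f x))%:E = \int[mu]_x (h x)%:E)%E.
Proof.
move=> [mf _ fE] mh ih.
have := @integral_pushforward _ _ _ _ R f mf mu setT (EFin \o h).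
rewrite preimage_setT => <- //.
  by apply: eq_measure_integral => A mA _; rewrite [LHS]fE// mul1e.
exact/measurable_EFinP.
Qed.

(** The weight [c] is nonnegative, so the positive and negative parts of the integrand are [c] times
    those of [F], and the nonnegative case applies to each. Indicators extend the integrand to the
    whole product, where Fubini is available. *)
Lemma integral_polar (F : 'rV[R]_n -> R) :
  measurable_fun [set: 'rV[R]_n] F -> lam.-integrable setT (EFin \o F) ->
  (\int[lam]_x (F x)%:E =
   \int[leb]_t \int[sigma]_w
     (\1_(`]0%R, +oo[%classic) t * \1_(@unit_sphere R n) w *
      (t ^+ n.-1 * F (t *: w)))%:E)%E.
Proof.
move=> mF iF.
pose c (p : measurableTypeR R * 'rV[R]_n) : R :=
  \1_(`]0%R, +oo[%classic) p.1 * \1_(@unit_sphere R n) p.2 * p.1 ^+ n.-1.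
have c0 p : 0 <= c p.
  rewrite /c indicE; have [/set_mem|_] := boolP (p.1 \in _); last by rewrite !mul0r.
  by rewrite /= in_itv/= andbT => /ltW p0; rewrite mul1r indicE mulr_ge0// exprn_ge0.
have mc : measurable_fun setT c.
  rewrite /c; apply: measurable_funM; first apply: measurable_funM.
  - by apply: (measurableT_comp (measurable_indic _)) => //; exact: measurable_fst.
  - apply: (measurableT_comp (measurable_indic (@measurable_unit_sphere R n))).
    exact: measurable_snd.
  - by apply: measurable_funX; exact: measurable_fst.
have ms : measurable_fun setT (fun p : measurableTypeR R * 'rV[R]_n => (p.1 : R) *: p.2).
  apply: measurable_fun_rVP => i; under eq_fun do rewrite mxE.
  apply: measurable_funM; first exact: measurable_fst.
  by apply: (measurableT_comp (measurable_coord i)); exact: measurable_snd.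
have cE (G : 'rV[R]_n -> R) p : \1_(`]0%R, +oo[%classic) p.1 *
    \1_(@unit_sphere R n) p.2 * (p.1 ^+ n.-1 * G (p.1 *: p.2)) =
    c p * G (p.1 *: p.2) by rewrite /c mulrA.
have polE (G : 'rV[R]_n -> R) : measurable_fun setT G -> (forall x, 0 <= G x) ->
    (\int[lam]_x (G x)%:E = \int[leb \x sigma]_p (c p * G (p.1 *: p.2))%:E)%E.
  move=> mG G0; rewrite (polar_coordinates n_gt0 mG G0) integral_mkcond.
  rewrite (fubini_tonelli1 (fun p => (c p * G (p.1 *: p.2))%:E)).
  - apply: eq_integral => t _; rewrite patchE /fubini_F.
    case: ifPn => [tT|tT].
      rewrite integral_indicM; apply: eq_integral => w _.
      by rewrite -cE/= [\1__ t]indicE tT mul1r.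
    rewrite integral0_eq// => w _; by rewrite -cE/= [\1__ t]indicE (negbTE tT) !mul0r.
  - apply/measurable_EFinP; apply: measurable_funM => //.
    exact: (measurableT_comp mG).
  - by move=> p; rewrite lee_fin mulr_ge0.
pose K p := (c p * F (p.1 *: p.2))%:E.
have mK : measurable_fun setT K.
  by apply/measurable_EFinP; apply: measurable_funM => //; exact: (measurableT_comp mF).
have posK : (K^\+ = fun p => (c p * Num.max (F (p.1 *: p.2)) 0)%:E)%E.
  apply/funext => p; rewrite funeposE /K -EFin_max maxr_pMr// mulr0.
  by [].
have negK : (K^\- = fun p => (c p * Num.max (- F (p.1 *: p.2)) 0)%:E)%E.
  apply/funext => p; rewrite funenegE /K -EFinN -EFin_max -mulrN maxr_pMr// mulr0.
  by [].
have mFp : measurable_fun setT (fun x => Num.max (F x) 0).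
  exact: measurable_maxr.
have mFn : measurable_fun setT (fun x => Num.max (- F x) 0).
  by apply: measurable_maxr => //; exact: measurable_funN.
have iK : (leb \x sigma)%E.-integrable setT K.
  apply/integrableP; split => //.
  have := iF => /integrableP[_].
  rewrite (_ : (fun x => _) = fun x => (`|F x|)%:E)// polE//.
    move=> h; apply: le_lt_trans h; rewrite le_eqVlt; apply/orP; left; apply/eqP.
    by apply: eq_integral => p _; rewrite /K/= normrM (ger0_norm (c0 _)).
  exact: measurableT_comp.
transitivity (\int[leb \x sigma]_p K p)%E; last first.
  rewrite -(integral12_prod_meas1 iK); apply: eq_integral => t _; rewrite /fubini_F.
  by apply: eq_integral => w _; rewrite /K -cE.
rewrite integralE [RHS]integralE posK negK.
rewrite -(polE _ mFp)-?(polE _ mFn); last 2 first.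
- by move=> x; rewrite le_max lexx orbT.
- by move=> x; rewrite le_max lexx orbT.
by congr (_ - _)%E; apply: eq_integral => x _; rewrite ?funeposE ?funenegE -?EFin_max.
Qed.

(* Integrate [phi y * H (enorm (y - p))] over [y] and over [p] in the sphere, in both orders. *)
Lemma range_orthogonal (phi : 'rV[R]_n -> R) (h H : R -> R) (M N : R) :
  measurable_fun setT phi -> (forall x, `|phi x| <= M) ->
  (forall x, ~ unit_ball x -> phi x = 0) ->
  measurable_fun setT H -> (forall t, `|H t| <= N) ->
  (forall t, 2 <= t -> H t = 0) ->
  (forall p t, unit_sphere p -> 0 < t < 2 -> h t = (sphere_area n)^-1 *
    \int[sigma]_(w in @unit_sphere R n) phi (p + t *: w)) ->
  (forall x : 'rV[R]_n, unit_ball x ->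
    \int[sigma]_(w in @unit_sphere R n) H (enorm (x - w)) = 0) ->
  leb.-integrable `]0, 2[ (EFin \o (fun t => t ^+ n.-1 * (H t * h t))) ->
  \int[leb]_(t in `]0, 2[) (t ^+ n.-1 * (H t * h t)) = 0.
Proof.
move=> mphi phiM phi0 mH HN H0 hE PH ih.
set J := (X in X = 0).
have M0 : 0 <= M := le_trans (normr_ge0 _) (phiM 0).
have N0 : 0 <= N := le_trans (normr_ge0 _) (HN 0).
set A := @sphere_area R n.
have mS := @measurable_unit_sphere R n.
have mB := @measurable_unit_ball R n.
(* If the area were 0, its inverse would be 0 by convention, and evaluating [hE] at a basis vector
   would give h = 0 on []0, 2[]. *)
have [A0|A0] := eqVneq A 0.
  rewrite /J /Rintegral integral0_eq// => t; rewrite /= in_itv/= => t02.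
  have pS : unit_sphere (delta_mx ord0 (Ordinal n_gt0) : 'rV[R]_n).
    rewrite /unit_sphere/= /enorm (bigD1 (Ordinal n_gt0))//= mxE !eqxx expr1n.
    rewrite big1 ?addr0 ?sqrtr1// => i i0.
    by rewrite mxE (negbTE i0) andbF expr0n.
  by rewrite (hE _ t pS t02) -/A A0 invr0 mul0r !mulr0.
have JE : (J%:E = \int[leb]_(t in `]0%R, 2%R[) (t ^+ n.-1 * (H t * h t))%:E)%E.
  by rewrite /J /Rintegral fineK//; apply: integrable_fin_num.
have mrn : measurable_fun [set: 'rV[R]_n] (fun y => enorm y) := @measurable_enorm R n.
have maff (p : 'rV[R]_n) (t : R) : measurable_fun [set: 'rV[R]_n] (fun w => t *: w + p).
  exact: measurable_rV_affine.
have mp (p : 'rV[R]_n) : measurable_fun [set: 'rV[R]_n] (fun w => w + p).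
  by have := maff p 1; under eq_fun do rewrite scale1r.
have lamB : (lam (@unit_ball R n) < +oo)%E := lebesgue_rV_unit_ball_lty.
have ilam (F : 'rV[R]_n -> R) (C : R) (p : 'rV[R]_n) :
    measurable_fun [set: 'rV[R]_n] F -> (forall y, `|F y| <= C) ->
    (forall y, ~ unit_ball (y + p) -> F y = 0) ->
    lam.-integrable setT (EFin \o F).
  move=> mF FC F0; pose D : set 'rV[R]_n := [set y | unit_ball (y + p)].
  have mD : measurable D.
    by rewrite -[X in measurable X]setTI; exact: mp.
  have -> : EFin \o F = (EFin \o F) \_ D.
    apply/funext => y; rewrite patchE; case: ifPn => // /negP yD /=.
    by rewrite F0// => h1; apply: yD; rewrite inE.
  rewrite -integrable_mkcond//.
  apply: (@measurable_bounded_integrable _ _ _ lam) => //.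
  - have [_ _ /(_ _ mB)] := scales_rV_affine p (@ltr01 R).
    rewrite invr1 expr1n mul1e => lamE; have := lamB; rewrite -lamE.
    by rewrite (_ : _ @^-1` _ = D)//; apply/seteqP; split => y /=; rewrite scale1r.
  - exact: measurable_funTS.
  - exists C; split; first exact: num_real.
    by move=> K CK y _; exact: le_trans (FC y) (ltW CK).
have bnd x t : `|phi x * H t| <= M * N.
  by rewrite normrM ler_pM.
(* Polar coordinates around [p]: the mean over the sphere of radius t is [h t], the factor [A]
   undoes its normalisation, and [H0] cuts the radius at 2. *)
have step1 (p : 'rV[R]_n) : unit_sphere p ->
    (\int[lam]_y (phi (y + p) * H (enorm y))%:E = (A * J)%:E)%E.
  move=> pS.
  have mF : measurable_fun [set: 'rV[R]_n] (fun y => phi (y + p) * H (enorm y)).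
    by apply: measurable_funM; exact: measurableT_comp.
  rewrite integral_polar//; last first.
    by apply: (ilam _ (M * N) p) => // y yB; rewrite phi0// mul0r.
  rewrite EFinM JE -integralZl// integral_mkcond.
  apply: eq_integral => t _; rewrite patchE; case: ifPn => [|tT].
    rewrite inE/= in_itv/= => /andP[t0 t2].
    transitivity (\int[sigma]_(w in @unit_sphere R n)
        (t ^+ n.-1 * H t * phi (p + t *: w))%:E)%E.
      rewrite [RHS]integral_indicM; apply: eq_integral => w _; congr EFin.
      rewrite [\1__ t]indicE mem_set/= ?in_itv/= ?t0// mul1r.
      rewrite [\1__ w]indicE; have [/set_mem wS|_] := boolP (w \in _).
        by rewrite !mul1r enormZ ?ltW// wS mulr1 (addrC p); ring.
      by rewrite !mul0r.
    have iphi : sigma.-integrable (@unit_sphere R n) (EFin \o (fun w => phi (p + t *: w))).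
      apply: (@integrable_surface _ _ _ M) => //.
      under eq_fun do rewrite addrC; exact: (measurableT_comp mphi (maff p t)).
    under eq_integral do rewrite EFinM.
    rewrite integralZl// (hE p t pS)/= ?t0//.
    have -> : (\int[sigma]_(w in @unit_sphere R n) (phi (p + t *: w))%:E =
        (\int[sigma]_(w in @unit_sphere R n) phi (p + t *: w))%:E)%E.
      by rewrite /Rintegral fineK//; apply: integrable_fin_num.
    rewrite -!EFinM -/A; congr EFin; set I := Rintegral _ _ _.
    rewrite [RHS]mulrCA -mulrA; congr (_ * _); rewrite [RHS]mulrCA.
    by congr (_ * _); rewrite mulrA divff ?mul1r.
  rewrite integral0_eq// => w _.
  have [t0|t0] := leP t 0.
    by rewrite indicE memNset ?mul0r//= in_itv/= andbT; apply/negP; rewrite -leNgt.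
  rewrite [\1__ w]indicE; have [/set_mem wS|_] := boolP (w \in _); last first.
    by rewrite mulr0 mul0r.
  rewrite enormZ ?ltW// wS mulr1 H0 ?mulr0// leNgt; apply/negP => t2.
  by apply: (negP tT); rewrite inE/= in_itv/= t0.
have mH2 (p : 'rV[R]_n) : measurable_fun [set: 'rV[R]_n] (fun y => phi y * H (enorm (y - p))).
  apply: measurable_funM => //; apply: (measurableT_comp mH).
  exact: (measurableT_comp mrn).
have step2 (p : 'rV[R]_n) :
    (\int[lam]_y (phi (y + p) * H (enorm y))%:E =
     \int[lam]_y (phi y * H (enorm (y - p)))%:E)%E.
  have := scales_rV_affine p (@ltr01 R); rewrite invr1 expr1n => sp.
  rewrite -(integral_scales1 (h := fun y => phi y * H (enorm (y - p))) sp)//=.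
    by apply: eq_integral => y _; rewrite scale1r addrK.
  apply: (ilam _ (M * N) p) => //=.
    exact: (measurableT_comp (mH2 p) (maff p 1)).
  by move=> y yB; rewrite scale1r phi0// mul0r.
(* The indicator carries the restriction of [p] to the sphere, so that Fubini can be applied on the
   full product. *)
pose L (z : 'rV[R]_n * 'rV[R]_n) : R :=
  \1_(@unit_sphere R n) z.1 * (phi z.2 * H (enorm (z.2 - z.1))).
have mL : measurable_fun setT L.
  apply: measurable_funM.
    by apply: (measurableT_comp (measurable_indic mS)); exact: measurable_fst.
  apply: measurable_funM; first by apply: (measurableT_comp mphi); exact: measurable_snd.
  apply: (measurableT_comp mH); apply: (measurableT_comp mrn).
  apply: measurable_fun_rVP => i; under eq_fun do rewrite !mxE.
  apply: measurable_funB.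
    by apply: (measurableT_comp (measurable_coord i)); exact: measurable_snd.
  by apply: (measurableT_comp (measurable_coord i)); exact: measurable_fst.
have iL : (sigma \x lebesgue_rV n)%E.-integrable setT (EFin \o L).
  apply/integrable12ltyP; first exact/measurable_EFinP.
  apply: (@le_lt_trans _ _ (\int[sigma]_p ((M * N)%:E * lam (@unit_ball R n)))%E).
    apply: ge0_le_integral => //.
    - by move=> p _; exact: integral_ge0.
    - apply: (measurable_fun_fubini_tonelli_F (abse \o (EFin \o L))) => //.
        by apply: measurableT_comp => //; exact/measurable_EFinP.
      by move=> z; exact: abse_ge0.
    - move=> p _; rewrite -integral_cst// [leRHS]integral_mkcond.
      apply: ge0_le_integral => //.
      + apply: measurableT_comp => //; apply/measurable_EFinP.
        exact: (measurableT_comp mL (pair1_measurable _)).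
      + by apply/(measurable_restrictT _ _).1 => //; exact: measurable_cst.
      + move=> y _; rewrite patchE; case: ifPn => [_|yB]; rewrite /= /L/= lee_fin.
          rewrite normrM indicE; case: (_ \in _); rewrite ?normr1 ?mul1r//.
          by rewrite normr0 mul0r mulr_ge0.
        rewrite phi0 ?mul0r ?mulr0 ?normr0// => yB'.
        by move: yB; rewrite mem_set.
  rewrite integral_cst//; apply: lte_mul_pinfty => //.
  - by rewrite mule_ge0// lee_fin mulr_ge0.
  - by rewrite fin_numM// ge0_fin_numE.
  - by rewrite -ge0_fin_numE//; exact: surface_measure_fin_num.
(* Integrating over y first gives [A * J * A], by [step1]; integrating over p first gives 0, by [PH]
   in the ball and because [phi] vanishes outside it. *)
have := Fubini iL.
have -> : (\int[sigma]_p \int[lam]_y (EFin \o L) (p, y) = (A * J * A)%:E)%E.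
  transitivity (\int[sigma]_(p in @unit_sphere R n) (A * J)%:E)%E.
    rewrite [RHS]integral_mkcond; apply: eq_integral => p _; rewrite patchE.
    case: ifPn => pS.
      rewrite -(step1 p (set_mem pS)) step2; apply: eq_integral => y _.
      by rewrite /L/= indicE pS mul1r.
    by apply: integral0_eq => y _; rewrite /L/= indicE (negbTE pS) mul0r.
  rewrite integral_cst// [RHS]EFinM; congr (_ * _)%E.
  by rewrite /A /sphere_area fineK//; exact: surface_measure_fin_num.
have -> : (\int[lam]_y \int[sigma]_p (EFin \o L) (p, y) = 0)%E.
  apply: integral0_eq => y _.
  have [yB|yB] := pselect (unit_ball y); last first.
    by apply: integral0_eq => p _; rewrite /L/= phi0// mul0r mulr0.
  have iH : sigma.-integrable (@unit_sphere R n) (EFin \o (fun p => H (enorm (y - p)))).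
    apply: (@integrable_surface _ _ _ N) => //; apply: (measurableT_comp mH).
    apply: (measurableT_comp mrn).
    apply: measurable_fun_rVP => i; under eq_fun do rewrite !mxE.
    by apply: measurable_funB; [exact: measurable_cst|exact: measurable_coord].
  transitivity ((phi y)%:E * \int[sigma]_(p in @unit_sphere R n) (H (enorm (y - p)))%:E)%E.
    rewrite -integralZl// [RHS]integral_indicM; apply: eq_integral => p _.
    by rewrite /L/=.
  have := PH y yB; rewrite /Rintegral => H00.
  by rewrite -[X in (_ * X)%E]fineK ?H00 ?mule0//; apply: integrable_fin_num.
by move=> [] /eqP; rewrite !mulf_eq0 (negbTE A0) orbF/= => /eqP.
Qed.

End orthogonality.

(** * Radial operators and spherical means of kernels *)

Section jets.
Context {R : realType}.
Implicit Types (S : nat -> R -> R) (p q : {poly R}) (t x : R).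

(* A smooth function is carried around as the sequence of its derivatives. *)
Definition jet S := forall k x, is_derive x 1 (S k) (S k.+1 x).

Lemma jet_shift S j : jet S -> jet (fun k => S (k + j)%N).
Proof. by move=> jS k x; exact: jS. Qed.

Lemma jet_continuous S k : jet S -> continuous (S k).
Proof. by move=> jS x; exact: isd_continuous (jS k x). Qed.

Lemma jet_measurable S k : jet S -> measurable_fun [set: R] (S k).
Proof. by move=> jS; apply: continuous_measurable_fun; exact: jet_continuous. Qed.

(* For [p = \sum_k p_k X^k], the operator [\sum_k p_k t^k (d/dt)^k]. *)
Definition euler_op p S t := \sum_(k < size p) p`_k * (t ^+ k * S k t).

Lemma euler_opE N p S t : (size p <= N)%N ->
  euler_op p S t = \sum_(k < N) p`_k * (t ^+ k * S k t).
Proof.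
move=> pN; rewrite /euler_op (big_ord_widen N (fun k => p`_k * (t ^+ k * S k t)))//.
rewrite big_mkcond; apply: eq_bigr => k _; case: ifPn => //.
by rewrite -leqNgt => kp; rewrite nth_default// mul0r.
Qed.

Lemma euler_opD p q S t : euler_op (p + q) S t = euler_op p S t + euler_op q S t.
Proof.
set N := maxn (size p) (size q).
rewrite !(@euler_opE N) ?leq_maxl ?leq_maxr//; last exact: size_polyD.
by rewrite -big_split/=; apply: eq_bigr => k _; rewrite coefD mulrDl.
Qed.

Lemma euler_opZ c p S t : euler_op (c *: p) S t = c * euler_op p S t.
Proof.
rewrite (@euler_opE (size p)) ?size_scale_leq// mulr_sumr.
by apply: eq_bigr => k _; rewrite coefZ mulrA.
Qed.

Lemma euler_opMX p S t :
  euler_op ('X * p) S t = t * euler_op p (fun k => S k.+1) t.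
Proof.
rewrite (@euler_opE (size p).+1); last by rewrite (leq_trans (size_polyMleq _ _))// size_polyX.
rewrite big_ord_recl coefXM/= mul0r add0r mulr_sumr.
by apply: eq_bigr => k _; rewrite coefXM/= exprS; ring.
Qed.

(** Since t d/dt (t^k S^(k)) = k t^k S^(k) + t^(k+1) S^(k+1), the operator t d/dt acts on symbols by
    p -> X p' + X p. *)
Lemma is_derive_euler_op p S t : jet S -> t != 0 ->
  is_derive t 1 (euler_op p S) (t^-1 * euler_op ('X * p^`() + 'X * p) S t).
Proof.
move=> jS t0; have dk (k : 'I_(size p)) : is_derive t 1 (fun y => p`_k * (y ^+ k * S k y))
    (p`_k * (k%:R * t ^+ k.-1 * S k t + t ^+ k * S k.+1 t)).
  apply: isdZ; apply: isdM; last exact: jS.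
  by have := isdX k (isdI t); rewrite mulr1.
apply: is_derive_eq (isd_sum dk) _.
rewrite (@euler_opE (size p).+1); last first.
  rewrite (leq_trans (size_polyD _ _))// geq_max.
  have h q : (size ('X * q)%R <= (size q).+1)%N.
    by rewrite (leq_trans (size_polyMleq _ _))// size_polyX.
  rewrite h andbT (leq_trans (h _))// ltnS.
  by apply: leq_trans (size_poly _ _) (leq_pred _).
rewrite mulr_sumr.
under [RHS]eq_bigr do rewrite coefD 2!coefXM coef_deriv.
transitivity (\sum_(k < (size p).+1) (p`_k *+ k * t ^+ k.-1 * S k t +
   (if k == 0%N :> nat then 0 else p`_k.-1) * t ^+ k.-1 * S k t)).
  rewrite [RHS]big_split/= [in RHS]big_ord_recr/= nth_default// mul0rn !mul0r addr0.
  rewrite big_ord_recl/= !mul0r add0r -big_split/=; apply: eq_bigr => k _.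
  by rewrite /bump/= add1n/= -mulr_natr; ring.
apply: eq_bigr => -[[|k] /= _] _; first by ring.
by rewrite exprS; field.
Qed.

(* [(t^-1 d/dt)^j = t^-2j \sum_k b_k t^k (d/dt)^k] with [b_k] the coefficients of [radial_poly j]. *)
Fixpoint radial_poly j : {poly R} :=
  if j is i.+1 then
    'X * (radial_poly i)^`() + 'X * radial_poly i - (i.*2)%:R *: radial_poly i
  else 1.

(** The coefficient 1 later allows the differential equation for the odd function to be solved for
    its highest derivative. *)
Lemma radial_poly_lead j :
  (size (radial_poly j) <= j.+1)%N /\ (radial_poly j)`_j = 1.
Proof.
elim: j => [|j [szj ldj]]; first by rewrite /= size_poly1 coef1.
split.
  apply/leq_sizeP => -[//|k]; rewrite ltnS => jk /=.
  rewrite coefB coefD coefZ !coefXM/= coef_deriv !(leq_sizeP _ _ szj)//.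
    by rewrite mul0rn mulr0 subr0 addr0.
  exact: ltnW.
rewrite /= coefB coefD coefZ !coefXM/= coef_deriv ldj (leq_sizeP _ _ szj)//.
by rewrite mul0rn mulr0 add0r subr0.
Qed.

(** Symbol form of t^2 D^(j+2) + (2j + 1) D^(j+1) = D^j (d/dt)^2. The induction moves X^2 past [th];
    the extra term 2 X^2 p turns the shift 2j of the recursion into 2(j + 1). *)
Lemma radial_poly_rec j :
  radial_poly j.+2 + (j.*2.+1)%:R *: radial_poly j.+1 = 'X^2 * radial_poly j.
Proof.
pose th p := 'X * p^`() + 'X * p.
have thD a p q : th (p + a *: q) = th p + a *: th q.
  by rewrite /th derivD derivZ -!mul_polyC; ring.
have rS i : radial_poly i.+1 = th (radial_poly i) - (i.*2)%:R *: radial_poly i by [].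
have thX p : th ('X^2 * p) = 'X^2 * th p + 2%:R *: ('X^2 * p).
  by rewrite /th derivM derivXn/= -!mul_polyC; ring.
elim: j => [|j IH].
  rewrite /= scale0r !subr0 -polyC1 derivC mulr0 add0r mulr1 derivX mulr1.
  by rewrite polyC1 (_ : 1.*2 = 2)%N// (_ : 0.*2 = 0)%N// !scaler_nat; ring.
rewrite [in RHS]rS mulrBr -scalerAr.
have -> : 'X^2 * th (radial_poly j) = th ('X^2 * radial_poly j) - 2%:R *: ('X^2 * radial_poly j).
  by rewrite thX addrK.
rewrite -IH thD [radial_poly j.+3]rS.
have -> : th (radial_poly j.+1) =
    radial_poly j.+2 + (j.+1.*2)%:R *: radial_poly j.+1 by rewrite (rS j.+1) subrK.
by rewrite -!mul2n !scaler_nat; ring.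
Qed.

Definition radial_op j S t := t^-1 ^+ j.*2 * euler_op (radial_poly j) S t.

Lemma is_derive_radial_op j S t : jet S -> t != 0 ->
  is_derive t 1 (radial_op j S) (t * radial_op j.+1 S t).
Proof.
move=> jS t0; have dV := isdX j.*2 (isdV t0 (isdI t)).
apply: is_derive_eq (isdM dV (is_derive_euler_op (radial_poly j) jS t0)) _.
rewrite /radial_op.
have -> : euler_op (radial_poly j.+1) S t =
    euler_op ('X * (radial_poly j)^`() + 'X * radial_poly j) S t -
    j.*2%:R * euler_op (radial_poly j) S t.
  by rewrite [radial_poly _.+1]/= -scaleNr euler_opD euler_opZ mulNr.
rewrite doubleS; case: j.*2 => [|d]; last by rewrite /= !exprS; field.
by rewrite !exprS expr0; field.
Qed.

(* The radial part [(d/dt)^2 + (2j / t) d/dt] of the Laplacian of dimension [2j + 1] maps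
   [radial_op j S] to [radial_op j S'']. *)
Lemma radial_op_rec j S t : t != 0 ->
  t ^+ 2 * radial_op j.+2 S t + (j.*2.+1)%:R * radial_op j.+1 S t =
  radial_op j (fun k => S k.+2) t.
Proof.
move=> t0; rewrite /radial_op.
have E : euler_op ('X^2 * radial_poly j) S t =
    t ^+ 2 * euler_op (radial_poly j) (fun k => S k.+2) t.
  by rewrite expr2 -mulrA !euler_opMX expr2 mulrA.
have {E} : t ^+ 2 * euler_op (radial_poly j) (fun k => S k.+2) t =
   euler_op (radial_poly j.+2) S t + (j.*2.+1)%:R * euler_op (radial_poly j.+1) S t.
  by rewrite -E -radial_poly_rec euler_opD euler_opZ.
move=> /(canRL (mulKf _)) ->; last by rewrite expf_neq0.
by rewrite !doubleS !exprS; field.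
Qed.

Lemma measurable_radial_op j S : jet S -> measurable_fun [set: R] (radial_op j S).
Proof.
move=> jS; apply: measurable_funM.
  by apply: measurable_funX; exact: measurable_invr.
apply: measurable_sum => k; apply: measurable_funM; first exact: measurable_cst.
by apply: measurable_funM; [exact: measurable_funX|exact: jet_measurable].
Qed.

Lemma radial_op_bounded j S (d : R) : jet S -> 0 < d ->
  exists C : R, forall t, d <= t <= 2 -> `|radial_op j S t| <= C.
Proof.
move=> jS d0; have [d2|d2] := leP d 2; last first.
  by exists 0 => t /andP[dt t2]; have := le_trans dt t2; rewrite leNgt d2.
have [|c _ cP] := @EVT_max R (fun t => `|radial_op j S t|) d 2 d2.
  apply: continuous_in_subspaceT => t; rewrite inE/= in_itv/= => /andP[dt _].
  apply: continuous_comp; last exact: norm_continuous.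
  apply: (isd_continuous (is_derive_radial_op j jS _)).
  by rewrite gt_eqF// (lt_le_trans d0).
by exists `|radial_op j S c| => t tI; apply: cP; rewrite in_itv.
Qed.

(* The shift by [1] moves the centre of antisymmetry to the radius of the sphere. *)
Definition kernel_jet j (o : nat -> R -> R) k t : R :=
  \sum_(i < j.+1) (-1) ^+ i * (radial_poly j)`_i * o (k + i)%N (t - 1).

Lemma jet_kernel j o : jet o -> jet (kernel_jet j o).
Proof.
move=> jo k x; apply: isd_sum => i; apply: isdZ.
have := isd_comp (isdB (isdI x) (isdC x 1)) (jo (k + i)%N (x - 1)).
by rewrite subr0 mulr1 addSn.
Qed.

Lemma kernel_jet_shift j o k l t :
  kernel_jet j (fun i => o (i + l)%N) k t = kernel_jet j o (k + l)%N t.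
Proof. by apply: eq_bigr => i _; rewrite addnAC. Qed.

(** The derivatives of the odd function c(x) - c(-x), with the chain-rule sign in order [k]. *)
Definition antisym (c : nat -> R -> R) k x : R := c k x - (-1) ^+ k * c k (- x).

Lemma jet_antisym c : jet c -> jet (antisym c).
Proof.
move=> jc k x; rewrite /antisym; apply: isdB => //.
have := isd_comp (isdB (isdC x 0) (isdI x)) (jc k (0 - x)).
move/(isdZ ((-1) ^+ k)); rewrite !sub0r.
under eq_fun do rewrite sub0r.
by move=> /is_derive_eq; apply; rewrite exprS; ring.
Qed.

(** Two derivatives preserve oddness, so the descent by Laplacians stays within the same class of
    kernels. *)
Lemma antisym_shift2 c k x : antisym c k.+2 x = antisym (fun i => c i.+2) k x.
Proof. by rewrite /antisym !exprS; congr (_ - _); ring. Qed.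

(** At 1 the value is the double sum of (-1)^i b_k b_i o^(k+i)(0). Terms with k + i even vanish by
    hypothesis, and exchanging k and i reverses the sign of the others. *)
Lemma radial_op_kernel1 j (o : nat -> R -> R) :
  (forall k, ~~ odd k -> o k 0 = 0) -> radial_op j (kernel_jet j o) 1 = 0.
Proof.
move=> o0; rewrite /radial_op invr1 expr1n mul1r.
rewrite (@euler_opE j.+1); last by have [] := radial_poly_lead j.
set b := radial_poly j; rewrite /kernel_jet -/b.
set X := \sum_(k < _) _; suff : X = - X by move=> ?; lra.
pose G (k i : 'I_j.+1) := b`_k * b`_i * (-1) ^+ i * o (k + i)%N 0.
have XE : X = \sum_k \sum_i G k i.
  apply: eq_bigr => k _; rewrite expr1n mul1r mulr_sumr; apply: eq_bigr => i _.
  by rewrite subrr /G; ring.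
rewrite {1}XE exchange_big XE -sumrN; apply: eq_bigr => k _.
rewrite -sumrN; apply: eq_bigr => i _; rewrite /G addnC.
have [ki|ki] := boolP (odd (k + i)); last by rewrite o0// !mulr0 oppr0.
move: ki; rewrite -signr_odd -[in RHS]signr_odd oddD.
by case: (odd i); case: (odd k) => //= _; ring.
Qed.

End jets.

(** * Integration by parts on the sphere *)

Section sphere_calculus.
Context {R : realType} {n : nat}.
Notation sigma := (@surface_measure R n).
Notation sph := (@unit_sphere R n).

Lemma is_derive_integral_sphere (f f' : R -> 'rV[R]_n -> R) (a u v C : R) :
  u < a < v ->
  (forall x, u < x < v -> measurable_fun [set: 'rV[R]_n] (f x)) ->
  (forall x w, u < x < v -> sph w -> `|f x w| <= C) ->
  (forall x w, u < x < v -> sph w -> `|f' x w| <= C) ->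
  (forall x w, u < x < v -> sph w -> is_derive x 1 (f^~ w) (f' x w)) ->
  is_derive a 1 (fun x => \int[sigma]_(w in sph) f x w) (\int[sigma]_(w in sph) f' a w).
Proof.
move=> auv mf fC f'C df.
have mS := @measurable_unit_sphere R n.
have Ia : `]u, v[%classic a by rewrite /= in_itv.
have intf x : `]u, v[%classic x -> sigma.-integrable sph (EFin \o f x).
  rewrite /= in_itv/= => xI; apply: (@integrable_surface _ _ _ C); first exact: mf.
  by move=> w; exact: fC.
have derf x w : `]u, v[%classic x -> sph w -> derivable (f^~ w) x 1.
  by rewrite /= in_itv/= => xI wS; have [] := df x w xI wS.
have derE x w : u < x < v -> sph w -> partial1of2 f x w = f' x w.
  by move=> xI wS; apply: isd_derive1; exact: df.
have C0 (w : 'rV[R]_n) : 0 <= `|C| by [].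
have iC : sigma.-integrable sph (EFin \o (fun=> `|C|)).
  by apply: (@integrable_surface _ _ _ `|C|) => [|w _]; rewrite ?normr_id.
have bd x w : `]u, v[%classic x -> sph w -> `|partial1of2 f x w| <= `|C|.
  rewrite /= in_itv/= => xI wS; rewrite derE//.
  exact: le_trans (f'C _ _ xI wS) (ler_norm _).
apply: DeriveDef.
  have := derivable_under_integral mS Ia intf derf C0 iC bd.
  by [].
rewrite -derive1E (differentiation_under_integral mS Ia intf derf C0 iC bd).
by apply: eq_Rintegral => w /set_mem wS; rewrite derE.
Qed.

Lemma isd_constant_itv (f : R -> R) (u v : R) :
  (forall x, u < x < v -> is_derive x 1 f 0) ->
  forall x y, u < x < v -> u < y < v -> f x = f y.
Proof.
move=> df; suff H x y : u < x -> x <= y -> y < v -> f x = f y.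
  move=> x y /andP[ux xv] /andP[uy yv].
  by have [xy|/ltW yx] := leP x y; [exact: H|apply/esym; exact: H].
move=> ux xy yv; have dI z : z \in `[x, y] -> is_derive z 1 f 0.
  rewrite in_itv/= => /andP[xz zy]; apply: df.
  by rewrite (lt_le_trans ux xz) (le_lt_trans zy yv).
have cf : {within `[x, y], continuous f}.
  by apply: derivable_within_continuous => z zI; have [] := dI z zI.
have dI' z : z \in `]x, y[ -> is_derive z 1 f ((fun=> 0) z).
  by move=> zI; apply: dI; exact: subset_itv_oo_cc zI.
have [z zI] := MVT_segment xy dI' cf.
by rewrite mul0r => /eqP; rewrite subr_eq0 => /eqP ->.
Qed.

Lemma Rintegral_sum d (T : measurableType d) (mu : {measure set T -> \bar R})
    (D : set T) (I : Type) (s : seq I) (P : pred I) (F : I -> T -> R) :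
  measurable D -> (forall i, mu.-integrable D (EFin \o F i)) ->
  \int[mu]_(x in D) (\sum_(i <- s | P i) F i x) =
  \sum_(i <- s | P i) \int[mu]_(x in D) F i x.
Proof.
move=> mD iF; have [//] : mu.-integrable D (EFin \o (fun x => \sum_(i <- s | P i) F i x)) /\
  \int[mu]_(x in D) (\sum_(i <- s | P i) F i x) =
  \sum_(i <- s | P i) \int[mu]_(x in D) F i x.
elim: s => [|a s [IH1 IH2]].
  under eq_Rintegral do rewrite big_nil; rewrite big_nil Rintegral_cst// mul0r.
  by split => //; under eq_fun do rewrite big_nil; exact: integrable0.
rewrite big_cons; case: ifPn => Pa.
  under eq_Rintegral do rewrite big_cons Pa; under eq_fun do rewrite big_cons Pa.
  rewrite -IH2 -RintegralD//; split => //.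
  exact: (integrableD mD (iF a) IH1).
under eq_Rintegral do rewrite big_cons (negbTE Pa).
by under eq_fun do rewrite big_cons (negbTE Pa).
Qed.

Variables (i0 : 'I_n) (phi phi' : R -> R) (C : R).
Hypotheses (mphi : measurable_fun [set: R] phi)
  (mphi' : measurable_fun [set: R] phi')
  (phiC : forall s : R, -1 <= s <= 1 -> `|phi s| <= C)
  (phi'C : forall s : R, -1 <= s <= 1 -> `|phi' s| <= C)
  (dphi : forall s : R, -1 <= s <= 1 -> is_derive s 1 phi (phi' s)).

Let coord_le1 (w : 'rV[R]_n) i : sph w -> -1 <= w ord0 i <= 1.
Proof. by move=> wS; rewrite -ler_norml -[leRHS]wS enorm_coord. Qed.

Let C0 : 0 <= C.
Proof.
apply: le_trans (normr_ge0 _) (phiC (s := 0) _).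
by rewrite lerN10 ler01.
Qed.

(* Invariance under rotations in the plane of the coordinates [i0] and [i],
   differentiated at the identity. *)
Lemma surface_rotation_identity i : i0 != i ->
  \int[sigma]_(w in sph)
    (w ord0 i0 * phi (w ord0 i0) - w ord0 i ^+ 2 * phi' (w ord0 i0)) = 0.
Proof.
move=> i0i.
pose c0 e (w : 'rV[R]_n) := cos e * w ord0 i0 - sin e * w ord0 i.
pose c1 e (w : 'rV[R]_n) := sin e * w ord0 i0 + cos e * w ord0 i.
pose f e w := c1 e w * phi (c0 e w).
pose f' e w := c0 e w * phi (c0 e w) - c1 e w ^+ 2 * phi' (c0 e w).
have cs (e : R) : cos e ^+ 2 + sin e ^+ 2 = 1 by rewrite cos2Dsin2.
have c0E e w : c0 e w = rot i0 i (cos e) (sin e) w ord0 i0 by rewrite mxE eqxx.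
have c1E e w : c1 e w = rot i0 i (cos e) (sin e) w ord0 i.
  by rewrite mxE eqxx eq_sym (negbTE i0i).
have rS e w : sph w -> sph (rot i0 i (cos e) (sin e) w).
  by rewrite /unit_sphere/= enorm_rot.
have c0I e w : sph w -> -1 <= c0 e w <= 1 by rewrite c0E => /rS/coord_le1.
have c1I e w : sph w -> `|c1 e w| <= 1 by rewrite ler_norml c1E => /rS/coord_le1.
have c0I' e w : sph w -> `|c0 e w| <= 1 by rewrite ler_norml => /c0I.
have mc0 e : measurable_fun [set: 'rV[R]_n] (c0 e).
  by apply: measurable_funB; apply: measurable_funM => //; exact: measurable_coord.
have mc1 e : measurable_fun [set: 'rV[R]_n] (c1 e).
  by apply: measurable_funD; apply: measurable_funM => //; exact: measurable_coord.
have mf e : measurable_fun [set: 'rV[R]_n] (f e).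
  by apply: measurable_funM => //; exact: measurableT_comp.
have dc0 (e : R) w : is_derive e 1 (c0^~ w) (- c1 e w).
  apply: is_derive_eq (isdB (isdM (is_derive_cos e) (isdC e (w ord0 i0)))
    (isdM (is_derive_sin e) (isdC e (w ord0 i)))) _.
  by rewrite /c1; ring.
have dc1 (e : R) w : is_derive e 1 (c1^~ w) (c0 e w).
  apply: is_derive_eq (isdD (isdM (is_derive_sin e) (isdC e (w ord0 i0)))
    (isdM (is_derive_cos e) (isdC e (w ord0 i)))) _.
  by rewrite /c0; ring.
have df (e : R) w : sph w -> is_derive e 1 (f^~ w) (f' e w).
  move=> wS; apply: is_derive_eq (isdM (dc1 e w)
    (isd_comp (dc0 e w) (dphi (c0I e w wS)))) _.
  by rewrite /f'; ring.
have fC e w : sph w -> `|f e w| <= C + C.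
  move=> wS; rewrite /f normrM -[leRHS]mul1r ler_pM//; first exact: c1I.
  by apply: (le_trans (phiC (c0I e w wS))); rewrite lerDl.
have f'C e w : sph w -> `|f' e w| <= C + C.
  move=> wS; rewrite /f' (le_trans (ler_normB _ _))// !normrM lerD//.
    by rewrite -[leRHS]mul1r ler_pM// ?c0I' ?phiC ?c0I.
  rewrite -[leRHS]mul1r ler_pM// ?mulr_ge0// ?phi'C ?c0I//.
  by rewrite -[leRHS]mulr1 ler_pM// c1I.
have z1 : -1 < (0 : R) < 1 by rewrite ltrN10 ltr01.
have dJ := is_derive_integral_sphere z1 (fun e _ => mf e)
  (fun e w _ => @fC e w) (fun e w _ => @f'C e w) (fun e w _ => @df e w).
(* Small angles suffice for the derivative at 0, and they keep cos e > 0, within the range where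
   rotation invariance was obtained. *)
have JE (e : R) : -1 < e < 1 ->
    \int[sigma]_(w in sph) f e w = \int[sigma]_(w in sph) f 0 w.
  move=> /andP[e1 e2].
  have ce : -1 < cos e.
    rewrite (@lt_trans _ _ 0)// ?ltrN10// cos_gt0_pihalf//.
    have p1 : 1 <= pi / 2 :> R by rewrite ler_pdivlMr// mul1r pi_ge2.
    by rewrite (lt_le_trans e2 p1) andbT (le_lt_trans _ e1)// lerN2.
  have c1' : -1 < 1 :> R by rewrite (lt_trans (ltrN10 _)).
  have c00 w : c0 0 w = w ord0 i0 by rewrite /c0 cos0 sin0 mul1r mul0r subr0.
  have c10 w : c1 0 w = w ord0 i by rewrite /c1 cos0 sin0 mul1r mul0r add0r.
  have fE e' w : f e' w = f 0 (rot i0 i (cos e') (sin e') w).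
    by rewrite /f c00 c10 -c0E -c1E.
  under eq_Rintegral do rewrite fE.
  rewrite (Rintegral_surface_rot (F := f 0))//.
  apply: (@integrable_surface _ _ _ (C + C)).
    rewrite (_ : _ \o _ = f e); first exact: mf.
    by apply/funext => w; rewrite fE.
  by move=> w wS; rewrite /= -fE; exact: fC.
have d0 : is_derive (0 : R) 1 (fun x => \int[sigma]_(w in sph) f x w) 0.
  apply: (isd_near _ (isdC 0 (\int[sigma]_(w in sph) f 0 w))).
  near=> e; apply/esym; apply: JE.
  by apply/andP; split; near: e; [exact: lt_nbhsr|exact: lt_nbhsl].
have := isd_derive1 dJ; rewrite (isd_derive1 d0) => ->.
apply: eq_Rintegral => w _; rewrite /f'.
by rewrite /c0 /c1 cos0 sin0 !mul1r !mul0r subr0 add0r.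
Unshelve. all: by end_near.
Qed.

(* Integration by parts in the coordinate [i0]: the sum of the rotation identities over [i]. *)
Lemma surface_slice_identity :
  \int[sigma]_(w in sph)
    (n.-1%:R * (w ord0 i0 * phi (w ord0 i0))
     - (1 - w ord0 i0 ^+ 2) * phi' (w ord0 i0)) = 0.
Proof.
pose F i (w : 'rV[R]_n) := w ord0 i0 * phi (w ord0 i0) - w ord0 i ^+ 2 * phi' (w ord0 i0).
have mco i : measurable_fun [set: 'rV[R]_n] (fun w : 'rV[R]_n => w ord0 i).
  exact: measurable_coord.
have iF i : sigma.-integrable sph (EFin \o F i).
  apply: (@integrable_surface _ _ _ (C + C)).
    apply: measurable_funB; apply: measurable_funM => //.
    - exact: (measurableT_comp mphi).
    - exact: measurable_funX.
    - exact: (measurableT_comp mphi').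
  move=> w wS; have b j : `|w ord0 j| <= 1 by rewrite ler_norml coord_le1.
  rewrite (le_trans (ler_normB _ _))// !normrM lerD//.
    by rewrite -[leRHS]mul1r ler_pM// phiC// coord_le1.
  rewrite -[leRHS]mul1r ler_pM// ?mulr_ge0// ?phi'C ?coord_le1//.
  by rewrite -[leRHS]mulr1 ler_pM// b.
transitivity (\int[sigma]_(w in sph) (\sum_(i | i0 != i) F i w)); last first.
  rewrite Rintegral_sum//; last exact: measurable_unit_sphere.
  by apply: big1 => i i0i; exact: surface_rotation_identity.
apply: eq_Rintegral => w /set_mem wS.
rewrite big_split/= sumr_const sumrN -mulr_suml -[X in _ = X - _]mulr_natl.
congr (_ - _ * _).
  congr (_%:R * _).
  have := cardC1 i0; rewrite card_ord => <-; apply: eq_card => i.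
  by rewrite !inE eq_sym.
have : \sum_i w ord0 i ^+ 2 = 1 by rewrite -enorm_sqr wS expr1n.
rewrite (bigD1 i0)//= => <-; rewrite addrAC subrr add0r.
by apply: eq_bigl => i; rewrite eq_sym.
Qed.

End sphere_calculus.

(** * Means of radial kernels along the first axis *)

Section axis.
Context {R : realType} {j : nat} (j_gt0 : (0 < j)%N).
Notation n := (j.*2.+1).
Notation sigma := (@surface_measure R n).
Notation sph := (@unit_sphere R n).
Notation i0 := (ord0 : 'I_n).
Implicit Types (S o c : nat -> R -> R) (r s t : R) (w : 'rV[R]_n).

(* The distance from [r] times the first basis vector to a point of the sphere with first
   coordinate [s]. *)
Definition chord r s := Num.sqrt (1 + r ^+ 2 - 2 * r * s).

Let sqr_chord_ge r s : -1 <= s <= 1 -> (1 - `|r|) ^+ 2 <= 1 + r ^+ 2 - 2 * r * s.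
Proof.
move=> s1; have : r * s <= `|r|.
  rewrite (le_trans (ler_norm _))// normrM -[leRHS]mulr1 ler_pM//.
  by rewrite ler_norml.
by have := real_normK (num_real r); lra.
Qed.

Let sqr_chord_le r s : -1 <= s <= 1 -> 1 + r ^+ 2 - 2 * r * s <= (1 + `|r|) ^+ 2.
Proof.
move=> s1; have : - (r * s) <= `|r|.
  rewrite (le_trans (ler_norm _))// normrN normrM -[leRHS]mulr1 ler_pM//.
  by rewrite ler_norml.
by have := real_normK (num_real r); lra.
Qed.

Lemma chord_bounds r s : -1 < r < 1 -> -1 <= s <= 1 ->
  1 - `|r| <= chord r s <= 1 + `|r|.
Proof.
rewrite -ltr_norml => r1 s1.
have r1' : 0 <= 1 - `|r| by rewrite subr_ge0 ltW.
rewrite -(ger0_norm r1') -(ger0_norm (addr_ge0 ler01 (normr_ge0 r))).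
rewrite -(sqrtr_sqr (1 - _)) -(sqrtr_sqr (1 + _)).
by rewrite !ler_wsqrtr ?sqr_chord_ge ?sqr_chord_le.
Qed.

Lemma chord_gt0 r s : -1 < r < 1 -> -1 <= s <= 1 -> 0 < 1 + r ^+ 2 - 2 * r * s.
Proof.
rewrite -ltr_norml => r1 s1; apply: lt_le_trans (sqr_chord_ge r s1).
by rewrite exprn_gt0// subr_gt0.
Qed.

Let chord_neq0 r s : -1 < r < 1 -> -1 <= s <= 1 -> chord r s != 0.
Proof. by move=> r1 s1; rewrite gt_eqF// sqrtr_gt0 chord_gt0. Qed.

(** The chord t satisfies t dt = (r - s) dr, and the factor [t] in the derivative of [radial_op]
    cancels the division by t. *)
Lemma is_derive_chord_l k S r s : jet S -> -1 < r < 1 -> -1 <= s <= 1 ->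
  is_derive r 1 (fun x => radial_op k S (chord x s))
    ((r - s) * radial_op k.+1 S (chord r s)).
Proof.
move=> jS r1 s1.
have dq : is_derive r 1 (fun x => 1 + x ^+ 2 - 2 * x * s) (2 * (r - s)).
  apply: is_derive_eq (isdB (isdD (isdC r 1) (isdX 2 (isdI r)))
    (isdM (isdZ 2 (isdI r)) (isdC r s))) _.
  by rewrite /=; ring.
apply: is_derive_eq (isd_comp (isd_comp dq (is_derive1_sqrt (chord_gt0 r1 s1)))
  (is_derive_radial_op k jS (chord_neq0 r1 s1))) _.
have := chord_neq0 r1 s1; rewrite /chord => h.
set q := Num.sqrt _ in h *; field; exact: h.
Qed.

Lemma is_derive_chord_r k S r s : jet S -> -1 < r < 1 -> -1 <= s <= 1 ->
  is_derive s 1 (fun x => radial_op k S (chord r x))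
    (- r * radial_op k.+1 S (chord r s)).
Proof.
move=> jS r1 s1.
have dq : is_derive s 1 (fun x => 1 + r ^+ 2 - 2 * r * x) (- (2 * r)).
  apply: is_derive_eq (isdB (isdC s (1 + r ^+ 2)) (isdZ (2 * r) (isdI s))) _.
  by ring.
apply: is_derive_eq (isd_comp (isd_comp dq (is_derive1_sqrt (chord_gt0 r1 s1)))
  (is_derive_radial_op k jS (chord_neq0 r1 s1))) _.
have := chord_neq0 r1 s1; rewrite /chord => h.
set q := Num.sqrt _ in h *; field; exact: h.
Qed.

Let coord_le1 w i : sph w -> -1 <= w ord0 i <= 1.
Proof. by move=> wS; rewrite -ler_norml -[leRHS]wS enorm_coord. Qed.

Let measurable_chord r : measurable_fun [set: R] (chord r).
Proof.
apply: (measurableT_comp (continuous_measurable_fun (@sqrt_continuous R))).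
by apply: measurable_funB => //; exact: measurable_funM.
Qed.

Let mop k S r : jet S -> measurable_fun [set: R] (fun s => radial_op k S (chord r s)).
Proof. by move=> jS; exact: (measurableT_comp (measurable_radial_op k jS)). Qed.

Let mopw k S r : jet S ->
  measurable_fun [set: 'rV[R]_n] (fun w => radial_op k S (chord r (w ord0 i0))).
Proof.
by move=> jS; apply: (measurableT_comp (mop k r jS)); exact: measurable_coord.
Qed.

Lemma radial_op_chord_bounded k S (rho : R) : jet S -> rho < 1 ->
  exists2 C : R, 0 <= C & forall r s, `|r| <= rho -> -1 <= s <= 1 ->
    `|radial_op k S (chord r s)| <= C.
Proof.
move=> jS rho1; have d0 : 0 < 1 - rho by rewrite subr_gt0.
have [C CP] := radial_op_bounded k jS d0.
exists `|C| => // r s rr s1; apply: le_trans (ler_norm _); apply: CP.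
have /andP[h1 h2] : 1 - `|r| <= chord r s <= 1 + `|r|.
  by apply: chord_bounds => //; rewrite -ltr_norml (le_lt_trans rr).
by apply/andP; split; lra.
Qed.

(** For [i = 0] this is the unnormalised spherical integral of the kernel seen from the point r e_0.
    The powers of r - w_0 are those produced by differentiating in r, so the family is closed under
    d/dr. *)
Definition mean k i S r :=
  \int[sigma]_(w in sph) ((r - w ord0 i0) ^+ i * radial_op k S (chord r (w ord0 i0))).

Let mcoef r i : measurable_fun [set: 'rV[R]_n] (fun w => (r - w ord0 i0) ^+ i).
Proof.
apply: measurable_funX; apply: measurable_funB => //; exact: measurable_coord.
Qed.

Let iop (a : 'rV[R]_n -> R) (M : R) k S r : jet S -> -1 < r < 1 ->
  measurable_fun [set: 'rV[R]_n] a -> (forall w, sph w -> `|a w| <= M) ->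
  sigma.-integrable sph (EFin \o (fun w => a w * radial_op k S (chord r (w ord0 i0)))).
Proof.
move=> jS r1 ma aM; have [|C C0 CP] := radial_op_chord_bounded k jS (rho := `|r|).
  by rewrite ltr_norml.
apply: (@integrable_surface _ _ _ (M * C)).
  by apply: measurable_funM => //; exact: mopw.
by move=> w wS; rewrite normrM ler_pM// ?aM// CP// coord_le1.
Qed.

Let coef_bound r w i : -1 < r < 1 -> sph w -> `|(r - w ord0 i0) ^+ i| <= 2 ^+ i.
Proof.
move=> /andP[r1 r2] wS; have /andP[w1 w2] := coord_le1 i0 wS.
by rewrite normrX lerXn2r ?nnegrE// ler_norml; apply/andP; split; lra.
Qed.

Lemma is_derive_mean k i S r : jet S -> -1 < r < 1 ->
  is_derive r 1 (mean k i S) (i%:R * mean k i.-1 S r + mean k.+1 i.+1 S r).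
Proof.
(* A radius strictly between |r| and 1: on a whole neighbourhood of [r] the chords stay away from 0,
   which gives the uniform bounds needed under the integral. *)
move=> jS r1; pose rho := (1 + `|r|) / 2.
have rr : `|r| < rho by move: r1; rewrite -ltr_norml /rho => ?; lra.
have rho1 : rho < 1 by move: r1; rewrite -ltr_norml /rho => ?; lra.
have [C1 C10 C1P] := radial_op_chord_bounded k jS rho1.
have [C2 C20 C2P] := radial_op_chord_bounded k.+1 jS rho1.
pose C := 2 ^+ i * C1 + (i%:R * 2 ^+ i.-1 * C1 + 2 ^+ i.+1 * C2).
have p0 : 0 <= i%:R * 2 ^+ i.-1 * C1 + 2 ^+ i.+1 * C2.
  by rewrite addr_ge0// !mulr_ge0// exprn_ge0.
have rI x : - rho < x < rho -> -1 < x < 1 /\ `|x| <= rho.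
  move=> /andP[x1 x2]; rewrite ler_norml; split; apply/andP; split; lra.
pose f x w := (x - w ord0 i0) ^+ i * radial_op k S (chord x (w ord0 i0)).
pose f' x w := i%:R * (x - w ord0 i0) ^+ i.-1 * radial_op k S (chord x (w ord0 i0)) +
  (x - w ord0 i0) ^+ i.+1 * radial_op k.+1 S (chord x (w ord0 i0)).
have rI' : - rho < r < rho by rewrite -ltr_norml.
apply: is_derive_eq (is_derive_integral_sphere (f := f) (f' := f') (C := C) rI' _ _ _ _) _.
- by move=> x _; apply: measurable_funM; [exact: mcoef|exact: mopw].
- move=> x w /rI[x1 xr] wS; rewrite /f /C; apply: (@le_trans _ _ (2 ^+ i * C1)).
    by rewrite normrM ler_pM// ?coef_bound// C1P// coord_le1.
  by rewrite lerDl.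
- move=> x w /rI[x1 xr] wS; rewrite /f' /C.
  apply: (@le_trans _ _ (i%:R * 2 ^+ i.-1 * C1 + 2 ^+ i.+1 * C2)); last first.
    by rewrite lerDr mulr_ge0// exprn_ge0.
  rewrite (le_trans (ler_normD _ _))// lerD//.
    rewrite normrM ler_pM// ?C1P ?coord_le1// normrM ger0_norm ?ler0n//.
    by rewrite ler_wpM2l// coef_bound.
  by rewrite normrM ler_pM// ?C2P ?coord_le1// coef_bound.
- move=> x w /rI[x1 xr] wS.
  have dc := isdX i (isdB (isdI x) (isdC x (w ord0 i0))).
  apply: is_derive_eq (isdM dc (is_derive_chord_l k jS x1 (coord_le1 i0 wS))) _.
  by rewrite /f' exprSr; ring.
have i1 := iop k jS r1 (mcoef r i.-1) (fun w => @coef_bound r w i.-1 r1).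
have i2 := iop k.+1 jS r1 (mcoef r i.+1) (fun w => @coef_bound r w i.+1 r1).
have mS := @measurable_unit_sphere R n.
rewrite /mean -RintegralZl// -RintegralD//.
  by apply: eq_Rintegral => w _; rewrite /f' mulrA.
by have := integrableZl mS i%:R i1; apply: eq_integrable => // w _.
Qed.

Lemma integrable_mean k i S r : jet S -> -1 < r < 1 ->
  sigma.-integrable sph (EFin \o
    (fun w => (r - w ord0 i0) ^+ i * radial_op k S (chord r (w ord0 i0)))).
Proof.
by move=> jS r1; exact: (iop k jS r1 (mcoef r i) (fun w => @coef_bound r w i r1)).
Qed.

(** Integrals against polynomials in the first coordinate are linear in the polynomial, so relations
    between the means reduce to polynomial identities. *)
Let moment k S r (p : {poly R}) :=
  \int[sigma]_(w in sph) (p.[w ord0 i0] * radial_op k S (chord r (w ord0 i0))).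

Let imoment k S r (p : {poly R}) : jet S -> -1 < r < 1 ->
  sigma.-integrable sph
    (EFin \o (fun w => p.[w ord0 i0] * radial_op k S (chord r (w ord0 i0)))).
Proof.
move=> jS r1; have mp : measurable_fun [set: R] (horner p).
  by apply: continuous_measurable_fun; exact: continuous_horner.
apply: (iop (M := \sum_(i < size p) `|p`_i|)) => //.
  by apply: (measurableT_comp mp); exact: measurable_coord.
move=> w wS; rewrite horner_coef (le_trans (ler_norm_sum _ _ _))//.
apply: ler_sum => i _; rewrite normrM -[leRHS]mulr1 ler_pM// normrX.
by rewrite exprn_ile1// ler_norml coord_le1.
Qed.

Let momentD k S r p q : jet S -> -1 < r < 1 ->
  moment k S r p + moment k S r q = moment k S r (p + q).
Proof.
move=> jS r1; have mS := @measurable_unit_sphere R n.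
rewrite /moment -RintegralD//; [|exact: imoment|exact: imoment].
by apply: eq_Rintegral => w _; rewrite hornerD mulrDl.
Qed.

Let momentZ k S r a p : jet S -> -1 < r < 1 ->
  a * moment k S r p = moment k S r (a%:P * p).
Proof.
move=> jS r1; have mS := @measurable_unit_sphere R n.
rewrite /moment -RintegralZl//; last exact: imoment.
by apply: eq_Rintegral => w _; rewrite hornerCM mulrA.
Qed.

Let meanE k i S r : mean k i S r = moment k S r ((r%:P - 'X) ^+ i).
Proof.
by apply: eq_Rintegral => w _; rewrite horner_exp !hornerE.
Qed.

(* [mean j 0 S] is radial; its Laplacian is the mean of the Laplacian of its integrand. *)
Lemma mean_laplacian S r : jet S -> -1 < r < 1 ->
  r * (mean j.+1 0 S r + mean j.+2 2 S r) + j.*2%:R * mean j.+1 1 S r =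
  r * mean j 0 (fun k => S k.+2) r.
Proof.
move=> jS r1; have mS := @measurable_unit_sphere R n.
have jS2 : jet (fun k => S k.+2) by move=> k x; exact: jS.
have jr : `|r| < 1 by rewrite ltr_norml.
have -> : mean j 0 (fun k => S k.+2) r =
    moment j.+1 S r (j.*2.+1)%:R%:P + moment j.+2 S r (1 + (r ^+ 2)%:P - (2 * r)%:P * 'X).
  rewrite /moment -RintegralD//; [|exact: imoment|exact: imoment].
  apply: eq_Rintegral => w /set_mem wS.
  rewrite expr0 mul1r -(radial_op_rec j S (chord_neq0 r1 (coord_le1 i0 wS))).
  have -> : chord r (w ord0 i0) ^+ 2 = 1 + r ^+ 2 - 2 * r * w ord0 i0.
    by rewrite sqr_sqrtr// ltW// chord_gt0// coord_le1.
  by rewrite !hornerE; ring.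
have [C1 C10 C1P] := radial_op_chord_bounded j.+1 jS jr.
have [C2 C20 C2P] := radial_op_chord_bounded j.+2 jS jr.
(* The slice identity is applied to s -> D^(j+1) S at the chord, whose derivative in s is -r D^(j+2)
   S; it accounts for the part of the Laplacian tangent to the sphere. *)
have slice := @surface_slice_identity R n i0
  (fun s => radial_op j.+1 S (chord r s)) (fun s => - r * radial_op j.+2 S (chord r s))
  (C1 + C2) (mop j.+1 r jS).
have {}slice : moment j.+1 S r (j.*2%:R%:P * 'X) + moment j.+2 S r (r%:P * (1 - 'X^2)) = 0.
  rewrite /moment -RintegralD//; [|exact: imoment|exact: imoment].
  rewrite -[RHS]slice//.
  - apply: eq_Rintegral => w _.
    move: (radial_op j.+1 S _) (radial_op j.+2 S _) => e1 e2.
    by rewrite (_ : n.-1 = j.*2)// !hornerE /=; ring.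
  - by apply: measurable_funM => //; exact: mop.
  - by move=> s s1; rewrite (le_trans (C1P r s _ s1))// lerDl.
  - move=> s s1; rewrite normrM normrN -[leRHS]mul1r; apply: ler_pM => //; first exact: ltW.
    by rewrite (le_trans (C2P r s _ s1))// lerDr.
  - by move=> s s1; exact: is_derive_chord_r.
rewrite !meanE.
have -> : (r%:P - 'X) ^+ 0 = 1 :> {poly R} by rewrite expr0.
have -> : moment j.+1 S r ((r%:P - 'X) ^+ 1) =
    r * moment j.+1 S r 1 + (-1) * moment j.+1 S r 'X.
  by rewrite !momentZ// momentD//; congr moment; ring.
have -> : moment j.+2 S r ((r%:P - 'X) ^+ 2) =
    r ^+ 2 * moment j.+2 S r 1 + (- (2 * r)) * moment j.+2 S r 'X + moment j.+2 S r 'X^2.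
  by rewrite !momentZ// !momentD//; congr moment; ring.
have -> : moment j.+1 S r (j.*2.+1)%:R%:P = (j.*2.+1)%:R * moment j.+1 S r 1.
  by rewrite momentZ// mulr1.
have -> : moment j.+2 S r (1 + (r ^+ 2)%:P - (2 * r)%:P * 'X) =
    (1 + r ^+ 2) * moment j.+2 S r 1 + (- (2 * r)) * moment j.+2 S r 'X.
  by rewrite !momentZ// momentD//; congr moment; ring.
have {}slice : j.*2%:R * moment j.+1 S r 'X +
    (r * moment j.+2 S r 1 + (- r) * moment j.+2 S r 'X^2) = 0.
  rewrite -[RHS]slice !momentZ// momentD//; congr (_ + _); congr moment; ring.
rewrite -natr1; set J := j.*2%:R in slice *.
have := slice; move: (moment _ _ _ _) (moment _ _ _ _) (moment _ _ _ _) (moment _ _ _ _) (moment _ _ _ _).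
move=> a b c d e h.
by apply/eqP; rewrite -subr_eq0 -oppr_eq0; apply/eqP; rewrite -[RHS]h; ring.
Qed.

(** If Y is the derivative in r, the Laplace equation reads r Y' + 2j Y = 0, so r^(2j) Y is constant
    and equals its value 0 at r = 0. At r = 0 the equation itself gives Y = 0. *)
Lemma mean_constant S : jet S ->
  (forall r, -1 < r < 1 -> mean j 0 (fun k => S k.+2) r = 0) ->
  forall r, -1 < r < 1 -> mean j 0 S r = mean j 0 S 0.
Proof.
move=> jS m0; have z1 : -1 < (0 : R) < 1 by rewrite ltrN10 ltr01.
have dV r : -1 < r < 1 -> is_derive r 1 (mean j 0 S) (mean j.+1 1 S r).
  by move=> r1; apply: is_derive_eq (is_derive_mean j 0 jS r1) _; rewrite mul0r add0r.
have dY r : -1 < r < 1 ->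
    is_derive r 1 (mean j.+1 1 S) (mean j.+1 0 S r + mean j.+2 2 S r).
  by move=> r1; apply: is_derive_eq (is_derive_mean j.+1 1 jS r1) _; rewrite mul1r.
have ode r : -1 < r < 1 ->
    r * (mean j.+1 0 S r + mean j.+2 2 S r) + j.*2%:R * mean j.+1 1 S r = 0.
  by move=> r1; rewrite mean_laplacian// m0// mulr0.
have jj0 : j.*2%:R != 0 :> R by rewrite pnatr_eq0 double_eq0 -lt0n.
have dz r : -1 < r < 1 -> is_derive r 1 (fun x => x ^+ j.*2 * mean j.+1 1 S x) 0.
  move=> r1; apply: is_derive_eq (isdM (isdX j.*2 (isdI r)) (dY r r1)) _.
  have jE : j.*2 = j.*2.-1.+1 by rewrite prednK// double_gt0.
  have -> : r ^+ j.*2 = r * r ^+ j.*2.-1 by rewrite -exprS -jE.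
  by rewrite -[RHS](mulr0 (r ^+ j.*2.-1)) -(ode r r1); ring.
have Y0 r : -1 < r < 1 -> mean j.+1 1 S r = 0.
  move=> r1; have [->|r0] := eqVneq r 0.
    by have := ode 0 z1; rewrite mul0r add0r => /eqP; rewrite mulf_eq0 (negbTE jj0) => /eqP.
  have := isd_constant_itv dz r1 z1; rewrite expr0n double_eq0 -leqn0 leqNgt j_gt0 mul0r.
  by move=> /eqP; rewrite mulf_eq0 expf_eq0 (negbTE r0) andbF => /eqP.
move=> r r1; apply: (isd_constant_itv _ r1 z1) => x x1.
by apply: is_derive_eq (dV x x1) _; exact: Y0.
Qed.

Lemma mean_origin S : mean j 0 S 0 = radial_op j S 1 * sphere_area n.
Proof.
rewrite /mean -[RHS]Rintegral_cst; last exact: measurable_unit_sphere.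
apply: eq_Rintegral => w _.
by rewrite /chord expr0 mul1r expr0n mulr0 mul0r addr0 subr0 sqrtr1.
Qed.

End axis.

(** * Polynomial approximation of derivatives *)

Section weierstrass.
Context {R : realType}.
Implicit Types (f g h : R -> R) (p q : {poly R}).

(* The expectation of [g K] for [K] a binomial variable with parameters [n] and [x]. *)
Fixpoint bernstein n (g : nat -> R) (x : R) : R :=
  if n is m.+1 then x * bernstein m (g \o succn) x + (1 - x) * bernstein m g x
  else g 0%N.

Lemma bernstein_poly n (g : nat -> R) : exists p, forall x, p.[x] = bernstein n g x.
Proof.
elim: n g => [|n IH] g; first by exists (g 0%N)%:P => x; rewrite hornerC.
have [p pE] := IH (g \o succn); have [q qE] := IH g.
by exists ('X * p + (1 - 'X) * q) => x; rewrite !hornerE pE qE.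
Qed.

Lemma bernsteinD n (g h : nat -> R) x :
  bernstein n (fun k => g k + h k) x = bernstein n g x + bernstein n h x.
Proof.
elim: n g h => [//|n IH] g h /=.
by rewrite [X in x * X](IH (g \o succn) (h \o succn)) IH; ring.
Qed.

Lemma bernsteinZ n (g : nat -> R) (a : R) x :
  bernstein n (fun k => a * g k) x = a * bernstein n g x.
Proof.
elim: n g => [//|n IH] g /=.
by rewrite [X in x * X](IH (g \o succn)) IH; ring.
Qed.

Lemma bernstein_cst n (a : R) x : bernstein n (fun=> a) x = a.
Proof. by elim: n => [//|n IH] /=; rewrite IH; ring. Qed.

Lemma le_bernstein n (g h : nat -> R) x : 0 <= x <= 1 ->
  (forall k, (k <= n)%N -> g k <= h k) -> bernstein n g x <= bernstein n h x.
Proof.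
move=> /andP[x0 x1]; elim: n g h => [|n IH] g h gh; first exact: gh.
rewrite /= lerD// ler_wpM2l ?subr_ge0 ?IH// => k kn; apply: gh => //.
exact: leqW.
Qed.

Lemma bernstein_id n x : bernstein n (fun k => k%:R) x = n%:R * x.
Proof.
elim: n => [|n IH] /=; first by rewrite mul0r.
rewrite (_ : _ \o _ = fun k => k%:R + 1); last by apply/funext => k /=; rewrite natr1.
by rewrite bernsteinD bernstein_cst IH -natr1; ring.
Qed.

Lemma bernstein_sqr n x :
  bernstein n (fun k => k%:R ^+ 2) x = (n%:R * x) ^+ 2 + n%:R * x * (1 - x).
Proof.
elim: n => [|n IH]; first by rewrite /=; ring.
rewrite /= (_ : _ \o _ = fun k => k%:R ^+ 2 + (2 * k%:R + 1)); last first.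
  by apply/funext => k /=; rewrite -natr1; ring.
by rewrite !bernsteinD bernsteinZ bernstein_cst bernstein_id IH -natr1; ring.
Qed.

Lemma bernstein_variance n x : (0 < n)%N ->
  bernstein n (fun k => (x - k%:R / n%:R) ^+ 2) x = x * (1 - x) / n%:R.
Proof.
move=> n0; have nn0 : n%:R != 0 :> R by rewrite pnatr_eq0 -lt0n.
rewrite (_ : (fun k => _) = fun k => x ^+ 2 + ((- 2 * x / n%:R) * k%:R +
    n%:R^-1 ^+ 2 * k%:R ^+ 2)); last by apply/funext => k; field.
rewrite !bernsteinD !bernsteinZ bernstein_cst bernstein_id bernstein_sqr.
by field.
Qed.

(** Bernstein approximation with a Chebyshev-type estimate: |x - y| <= (a + (x - y)^2 / a) / 2
    bounds the expected error by the variance, which is at most 1/n. *)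
Lemma weierstrass01 f (L e : R) : 0 < e ->
  (forall x y, 0 <= x <= 1 -> 0 <= y <= 1 -> `|f x - f y| <= L * `|x - y|) ->
  exists p, forall x, 0 <= x <= 1 -> `|f x - p.[x]| <= e.
Proof.
move=> e0 fL; have L0 : 0 <= L.
  have := fL 0 1; rewrite ler01 !lexx sub0r normrN1 mulr1 => /(_ isT isT).
  exact: le_trans.
(* With n >= a^-2 the variance is at most a^2, so the error is at most L a <= e; the 1 in [L + 1]
   covers L = 0. *)
pose a := e / (L + 1).
have a0 : 0 < a by rewrite divr_gt0// ltr_wpDl.
have [n] : exists n : nat, a ^- 2 <= n%:R.
  by exists (Num.truncn (a ^- 2)).+1; rewrite ltW// truncnS_gt.
move=> na.
have n0' : 0 < n%:R :> R by rewrite (lt_le_trans _ na)// invr_gt0 exprn_gt0.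
have n0 : (0 < n)%N by rewrite -(ltr0n R).
pose y k : R := k%:R / n%:R.
have [p pE] := bernstein_poly n (fun k => f (y k)).
exists p => x x01; rewrite pE.
have bnd (k : nat) : (k <= n)%N -> `|f x - f (y k)| <= L / 2 * (a + a^-1 * (x - y k) ^+ 2).
  move=> kn; have y01 : 0 <= y k <= 1.
    by rewrite divr_ge0//= ler_pdivrMr// mul1r ler_nat.
  apply: le_trans (fL _ _ x01 y01) _; rewrite -mulrA ler_wpM2l//.
  rewrite -real_normK ?num_real//; set d := `|x - y k|.
  rewrite -subr_ge0 (_ : _ - _ = (a - d) ^+ 2 / (2 * a)); last by field; rewrite gt_eqF.
  by rewrite divr_ge0 ?sqr_ge0// mulr_ge0// ltW.
have tot : bernstein n (fun k => L / 2 * (a + a^-1 * (x - y k) ^+ 2)) x <= e.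
  rewrite bernsteinZ bernsteinD bernstein_cst bernsteinZ bernstein_variance//.
  have vx : x * (1 - x) / n%:R <= a ^+ 2.
    rewrite ler_pdivrMr// (@le_trans _ _ 1)//.
      by move: x01 => /andP[x0 x1]; rewrite mulr_ile1 ?subr_ge0// lerBlDr lerDl.
    by rewrite mulrC -ler_pdivrMr ?exprn_gt0// mul1r.
  have h1 : a^-1 * (x * (1 - x) / n%:R) <= a.
    by rewrite mulrC ler_pdivrMr// -expr2.
  apply: (@le_trans _ _ (L / 2 * (a + a))); first by rewrite ler_wpM2l ?divr_ge0// lerD2l.
  rewrite (_ : L / 2 * (a + a) = L * a); last by field.
  by rewrite /a mulrA ler_pdivrMr ?ltr_wpDl// mulrC ler_pM2l// lerDl.
have diff : f x - bernstein n (fun k => f (y k)) x =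
    bernstein n (fun k => f x + (-1) * f (y k)) x.
  by rewrite bernsteinD bernstein_cst bernsteinZ mulN1r.
rewrite ler_norml; apply/andP; split; rewrite diff.
  rewrite lerNl; apply: le_trans tot.
  rewrite -[X in X <= _]mulN1r -bernsteinZ; apply: le_bernstein => // k kn.
  by apply: le_trans (bnd k kn); rewrite !mulN1r (le_trans (ler_norm _))// normrN.
apply: le_trans tot; apply: le_bernstein => // k kn.
by apply: le_trans (bnd k kn); rewrite mulN1r ler_norm.
Qed.

Lemma weierstrass_jet0 (c : nat -> R -> R) (e : R) : jet c -> 0 < e ->
  exists p, forall x, -1 <= x <= 1 -> `|c 0%N x - p.[x]| <= e.
Proof.
move=> jc e0; pose f (u : R) := c 0%N (2 * u - 1).
have m1 : -1 <= (1 : R) by lra.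
have [|z _ zP] := @EVT_max R (fun t => `|c 1%N t|) (-1) 1 m1.
  apply: continuous_in_subspaceT => t _.
  by apply: continuous_comp; [exact: jet_continuous|exact: norm_continuous].
have df (u : R) : is_derive u 1 f (c 1%N (2 * u - 1) * 2).
  have := isd_comp (isdB (isdZ 2 (isdI u)) (isdC u 1)) (jc 0%N (2 * u - 1)).
  by rewrite mulr1 subr0.
have fL x y : 0 <= x <= 1 -> 0 <= y <= 1 -> `|f x - f y| <= (`|c 1%N z| * 2) * `|x - y|.
  wlog xy : x y / x <= y => [H x01 y01|/andP[x0 x1] /andP[y0 y1]].
    by have [xy|/ltW yx] := leP x y; [exact: H|rewrite distrC (distrC x); exact: H].
  have cf : {within `[x, y], continuous f}.
    by apply: derivable_within_continuous => u _; have [] := df u.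
  have [u uI ufE] := MVT_segment xy (fun u _ => df u) cf.
  rewrite distrC ufE (distrC x) normrM ler_wpM2r// normrM (normr_nat R 2) ler_wpM2r//.
  apply: zP; move: uI; rewrite !in_itv/= => /andP[xu uy]; apply/andP; split; lra.
have [q qP] := weierstrass01 e0 fL.
exists (q \Po (2^-1 *: 'X + (2^-1)%:P)) => x /andP[x1 x2].
rewrite horner_comp !hornerE; have := qP (2^-1 * x + 2^-1).
rewrite /f (_ : 2 * _ - 1 = x); last by field.
by apply; apply/andP; split; lra.
Qed.

Definition polyjet p k x : R := (p^`(k)).[x].

Lemma jet_polyjet p : jet (polyjet p).
Proof.
by move=> k x; rewrite /polyjet derivnS; exact: is_derive_poly.
Qed.

Lemma antiderivative_poly q (a : R) : exists p, p^`() = q /\ p.[0] = a.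
Proof.
exists (\poly_(i < (size q).+1) (if i is k.+1 then q`_k / k.+1%:R else a)); split.
  apply/polyP => i; rewrite coef_deriv coef_poly ltnS.
  case: ltnP => [iq|qi]; last by rewrite mul0rn nth_default.
  by rewrite -[LHS]mulr_natr divfK// pnatr_eq0.
by rewrite horner_coef0 coef_poly.
Qed.

(** The derivative is approximated first and then integrated from 0 with the exact initial value;
    since |x| <= 1, integration does not enlarge the error. *)
Lemma weierstrass_jet N (c : nat -> R -> R) (e : R) : jet c -> 0 < e ->
  exists p, forall k x, (k <= N)%N -> -1 <= x <= 1 -> `|c k x - polyjet p k x| <= e.
Proof.
move=> + e0; elim: N c => [|N IH] c jc.
  have [p pP] := weierstrass_jet0 jc e0.
  by exists p => -[|//] x _; exact: pP.
have [q qP] := IH (fun k => c k.+1) (fun k x => jc k.+1 x).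
have [p [pq p0]] := antiderivative_poly q (c 0%N 0).
have pS k : polyjet p k.+1 = polyjet q k.
  by apply/funext => x; rewrite /polyjet derivSn pq.
exists p => -[|k] x kN x1; last by rewrite pS; exact: qP.
pose f x := c 0%N x - polyjet p 0%N x.
have df (y : R) : is_derive y 1 f (c 1%N y - polyjet q 0%N y).
  by rewrite -pS; apply: isdB; [exact: jc|exact: jet_polyjet].
have f0 : f 0 = 0 by rewrite /f /polyjet derivn0 p0 subrr.
have cf a b : {within `[a, b], continuous f}.
  by apply: derivable_within_continuous => u _; have [] := df u.
move: x1 => /andP[x1 x2]; rewrite -/(f x).
have [x0|/ltW x0] := leP 0 x.
  have [u uI] := MVT_segment x0 (fun u _ => df u) (cf 0 x).
  rewrite f0 !subr0 => ->; rewrite normrM -[leRHS]mulr1 ler_pM//.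
    by apply: qP => //; move: uI; rewrite in_itv/= => /andP[u0 u1]; apply/andP; split; lra.
  by rewrite ger0_norm.
have [u uI] := MVT_segment x0 (fun u _ => df u) (cf x 0).
rewrite f0 !sub0r => /eqP; rewrite eqr_oppLR => /eqP ->.
rewrite normrN normrM -[leRHS]mulr1 ler_pM//.
  by apply: qP => //; move: uI; rewrite in_itv/= => /andP[u0 u1]; apply/andP; split; lra.
by rewrite normrN ler0_norm// lerNl.
Qed.

End weierstrass.

(** * Kernels annihilated by the backprojection *)

Section vanishing.
Context {R : realType} {j : nat} (j_gt0 : (0 < j)%N).
Notation n := (j.*2.+1).
Notation sigma := (@surface_measure R n).
Notation sph := (@unit_sphere R n).
Notation i0 := (ord0 : 'I_n).

Lemma antisym_even0 (c : nat -> R -> R) k : ~~ odd k -> antisym c k 0 = 0.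
Proof. by move=> ok; rewrite /antisym -signr_odd (negbTE ok) oppr0; ring. Qed.

(** Passing from p to p'' lowers the size unless p = 0, where the kernel is zero; [mean_constant]
    then reduces the value to the one at the origin. *)
Lemma mean_kernel_poly (p : {poly R}) r : -1 < r < 1 ->
  @mean R j j 0 (kernel_jet j (antisym (polyjet p))) r = 0.
Proof.
have [N] := ubnP (size p); elim: N p r => [//|N IH] p r pN r1.
have jS : jet (kernel_jet j (antisym (polyjet p))).
  exact/jet_kernel/jet_antisym/jet_polyjet.
rewrite (mean_constant j_gt0 jS _ r1).
  by rewrite mean_origin radial_op_kernel1 ?mul0r// => k; exact: antisym_even0.
move=> x x1; have [p0|p0] := eqVneq p 0.
  rewrite /mean; apply: (etrans (eq_Rintegral (g := fun=> 0) _ _)); last first.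
    by rewrite Rintegral_cst ?mul0r//; exact: measurable_unit_sphere.
  move=> w _; rewrite /radial_op /euler_op big1 ?mulr0// => k _.
  rewrite /kernel_jet big1 ?mulr0// => i _.
  have d0 l : (0 : {poly R})^`(l) = 0 by elim: l => // l IHl; rewrite derivnS IHl deriv0.
  by rewrite /antisym /polyjet p0 d0 !horner0 mulr0 subr0 mulr0.
rewrite (_ : (fun k => _) = kernel_jet j (antisym (polyjet (p^`(2))))).
  apply: IH => //; rewrite ltnS in pN; apply: leq_trans pN.
  rewrite derivnS derivn1; apply: leq_ltn_trans (lt_size_deriv p0).
  exact: leq_trans (size_poly _ _) (leq_pred _).
apply/funext => k; apply/funext => t; apply: eq_bigr => i _; congr (_ * _).
rewrite !addSn antisym_shift2; congr (antisym _ _ _).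
by apply/funext => l; apply/funext => y; rewrite /polyjet !derivSn.
Qed.

(** The order 2j adds the j derivatives of [radial_op] to the j derivatives inside [kernel_jet]. The
    chord lies between 1 - |r| and 2, so [K] depends only on [r] and [j], which permits the passage
    to the limit. *)
Lemma mean_kernel_bound r : -1 < r < 1 -> exists2 K : R, 0 <= K &
  forall (o : nat -> R -> R) (e : R), jet o -> 0 <= e ->
    (forall k x, (k <= j.*2)%N -> -1 <= x <= 1 -> `|o k x| <= e) ->
    `|@mean R j j 0 (kernel_jet j o) r| <= K * e.
Proof.
move=> r1; pose b := radial_poly j : {poly R}.
pose B : R := \sum_(i < j.+1) `|b`_i|.
pose E : R := (1 - `|r|)^-1 ^+ j.*2 * \sum_(k < j.+1) `|b`_k| * (2 ^+ k * B).
have A0 : 0 <= @sphere_area R n by rewrite /sphere_area fine_ge0.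
have B0 : 0 <= B by apply: sumr_ge0.
have r1' : 0 < 1 - `|r| by rewrite subr_gt0 ltr_norml.
have E0 : 0 <= E.
  apply: mulr_ge0; first by rewrite exprn_ge0// invr_ge0 ltW.
  by apply: sumr_ge0 => k _; rewrite !mulr_ge0// exprn_ge0.
exists (E * @sphere_area R n); first exact: mulr_ge0.
move=> o e jo e0 oe; have mS := @measurable_unit_sphere R n.
have bnd (w : 'rV[R]_n) : sph w ->
    `|(r - w ord0 i0) ^+ 0 * radial_op j (kernel_jet j o) (chord r (w ord0 i0))| <= E * e.
  move=> wS; rewrite expr0 mul1r.
  have w1 : -1 <= w ord0 i0 <= 1 by rewrite -ler_norml -[leRHS]wS enorm_coord.
  have /andP[] := chord_bounds r1 w1; set t := chord _ _ => t1 t2.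
  have t0 : 0 < t := lt_le_trans r1' t1.
  have tV0 : 0 <= t^-1 by rewrite invr_ge0 (ltW t0).
  rewrite /radial_op normrM (ger0_norm (exprn_ge0 _ tV0)).
  rewrite /E -mulrA; apply: ler_pM => //; first exact: exprn_ge0.
    by rewrite lerXn2r ?nnegrE// ?invr_ge0 ?(ltW r1')// lef_pV2// posrE.
  rewrite (@euler_opE _ j.+1); last by have [] := @radial_poly_lead R j.
  rewrite mulr_suml (le_trans (ler_norm_sum _ _ _))//; apply: ler_sum => k _.
  rewrite normrM -mulrA ler_wpM2l// normrM -mulrA ler_pM//.
    rewrite normrX lerXn2r ?nnegrE// (ger0_norm (ltW t0)).
    by move: r1 r1' t2; rewrite -ltr_norml => ? ? ?; lra.
  rewrite /kernel_jet mulr_suml (le_trans (ler_norm_sum _ _ _))//; apply: ler_sum => i _.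
  rewrite normrM normrM normrX normrN1 expr1n mul1r ler_wpM2l// oe//.
    by rewrite -addnn leq_add// -ltnS.
  rewrite -ler_norml ler_norml; move: r1 t1 t2; rewrite -ltr_norml => r1 t1 t2.
  by apply/andP; split; lra.
have iF := @integrable_mean R j j 0 _ _ (jet_kernel j jo) r1.
have iC : sigma.-integrable sph (EFin \o (fun=> E * e)).
  by apply: (@integrable_surface _ _ _ `|E * e|).
apply: le_trans (le_normr_Rintegral mS iF) _.
rewrite mulrAC -[leRHS](Rintegral_cst sigma mS).
apply: le_Rintegral => //; have := integrable_norm iF.
by apply: eq_integrable.
Qed.

Lemma radial_op_kernelB (o p : nat -> R -> R) t :
  radial_op j (kernel_jet j (fun k x => o k x - p k x)) t =
  radial_op j (kernel_jet j o) t - radial_op j (kernel_jet j p) t.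
Proof.
rewrite /radial_op -mulrBr; congr (_ * _).
rewrite /euler_op -sumrB; apply: eq_bigr => k _.
rewrite -mulrBr -mulrBr /kernel_jet -sumrB; congr (_ * (_ * _)).
by apply: eq_bigr => i _; rewrite mulrBr.
Qed.

Lemma mean_kernel_antisym (c : nat -> R -> R) r : jet c -> -1 < r < 1 ->
  @mean R j j 0 (kernel_jet j (antisym c)) r = 0.
Proof.
move=> jc r1; have [K K0 KP] := mean_kernel_bound r1.
apply/eqP; rewrite -normr_le0; apply/ler_addgt0Pr => d d0; rewrite add0r.
(* The 2 compensates for antisymmetrisation, which doubles the error of approximation. *)
pose e := d / (2 * (K + 1)).
have e0 : 0 < e by rewrite divr_gt0// mulr_gt0// ltr_wpDl.
have [p pP] := weierstrass_jet j.*2 jc e0.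
pose q k x := antisym c k x - antisym (polyjet p) k x.
have jq : jet q.
  by move=> k x; apply: isdB; apply: jet_antisym => //; exact: jet_polyjet.
have mS := @measurable_unit_sphere R n.
have iS o (jo : jet o) := @integrable_mean R j j 0 _ _ (jet_kernel j jo) r1.
have -> : @mean R j j 0 (kernel_jet j (antisym c)) r = @mean R j j 0 (kernel_jet j q) r.
  rewrite -[LHS]subr0 -(mean_kernel_poly p r1) /mean -RintegralB//; last 2 first.
  - exact/iS/jet_antisym.
  - exact/iS/jet_antisym/jet_polyjet.
  by apply: eq_Rintegral => w _; rewrite -mulrBr -radial_op_kernelB.
apply: le_trans (KP q (e + e) jq _ _) _.
- by rewrite addr_ge0 ?ltW.
- move=> k x kj x1; have -> : q k x = (c k x - polyjet p k x) +
      - ((-1) ^+ k * (c k (- x) - polyjet p k (- x))) by rewrite /q /antisym; ring.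
  rewrite (le_trans (ler_normD _ _))// lerD ?pP//.
  by rewrite normrN normrM normrX normrN1 expr1n mul1r pP// lerN2 lerNl andbC.
have K1 : K + 1 != 0 by rewrite gt_eqF// ltr_wpDl.
rewrite (_ : e + e = d / (K + 1)); last by rewrite /e; field.
by rewrite mulrA ler_pdivrMr ?ltr_wpDl// mulrC ler_pM2l// lerDl.
Qed.

End vanishing.

(** * From the axis to all points of the ball *)

Section backprojection_kernel.
Context {R : realType} {j : nat} (j_gt0 : (0 < j)%N).
Notation n := (j.*2.+1).
Notation sigma := (@surface_measure R n).
Notation sph := (@unit_sphere R n).
Notation i0 := (ord0 : 'I_n).

Lemma enormB_sphere (x w : 'rV[R]_n) : sph w ->
  enorm (x - w) ^+ 2 = 1 + enorm x ^+ 2 - 2 * (\sum_i x ord0 i * w ord0 i).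
Proof.
move=> wS; transitivity (enorm w ^+ 2 + enorm x ^+ 2 - 2 * (\sum_i x ord0 i * w ord0 i));
  last by rewrite (wS : enorm w = 1) expr1n.
rewrite !enorm_sqr mulr_sumr -big_split/= -sumrB; apply: eq_bigr => i _.
by rewrite !mxE; ring.
Qed.

Lemma enormB_sphere_bounds (x w : 'rV[R]_n) : sph w -> enorm x < 1 ->
  1 - enorm x <= enorm (x - w) <= 1 + enorm x.
Proof.
move=> wS x1; have x0 := enorm_ge0 x.
(* Cauchy-Schwarz in the form |a w - b x|^2 >= 0, later with a = |x| and b = 1 or -1. *)
have cs (a b : R) : 0 <= a ^+ 2 + b ^+ 2 * enorm x ^+ 2 - 2 * a * b * (\sum_i x ord0 i * w ord0 i).
  have <- : \sum_i (a * w ord0 i - b * x ord0 i) ^+ 2 =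
      a ^+ 2 + b ^+ 2 * enorm x ^+ 2 - 2 * a * b * (\sum_i x ord0 i * w ord0 i).
    transitivity (a ^+ 2 * enorm w ^+ 2 + b ^+ 2 * enorm x ^+ 2 -
        2 * a * b * (\sum_i x ord0 i * w ord0 i)).
      rewrite !enorm_sqr !mulr_sumr -big_split/= -sumrB; apply: eq_bigr => i _; ring.
    by rewrite (wS : enorm w = 1) expr1n mulr1.
  by apply: sumr_ge0 => i _; exact: sqr_ge0.
have sqE := enormB_sphere x wS.
have [h1 h2] : - enorm x <= \sum_i x ord0 i * w ord0 i /\
    \sum_i x ord0 i * w ord0 i <= enorm x.
  have [xp|] := ltP 0 (enorm x); last first.
    move=> x00; have xE : enorm x = 0 by apply/eqP; rewrite eq_le x00 x0.
    have := cs 1 1; have := cs 1 (-1); rewrite xE.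
    suff -> : \sum_i x ord0 i * w ord0 i = 0 by rewrite oppr0.
    apply: big1 => i _; have := enorm_coord x i; rewrite xE normr_le0 => /eqP ->.
    by rewrite mul0r.
  have := cs (enorm x) 1; have := cs (enorm x) (-1).
  set d := \sum_i _; rewrite expr1n mul1r sqrrN expr1n mul1r !mulr1 => a1 a2.
  split; rewrite -(ler_pM2l xp); lra.
have e0 := enorm_ge0 (x - w).
apply/andP; split.
  by rewrite -(ler_pXn2r (ltn0Sn 1)) ?nnegrE ?subr_ge0 ?(ltW x1)// sqE; lra.
by rewrite -(ler_pXn2r (ltn0Sn 1)) ?nnegrE ?addr_ge0// sqE; lra.
Qed.

Variables (c : nat -> R -> R).
Hypothesis jc : jet c.
Let H := radial_op j (kernel_jet j (antisym c)).
Let jS : jet (kernel_jet j (antisym c)).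
Proof. exact/jet_kernel/jet_antisym. Qed.
Let v (x : 'rV[R]_n) := \int[sigma]_(w in sph) H (enorm (x - w)).

Let v_axis (x : 'rV[R]_n) : enorm x < 1 ->
  (forall i, i != i0 -> x ord0 i = 0) -> v x = 0.
Proof.
move=> x1 xi; pose r := x ord0 i0.
have r1 : -1 < r < 1.
  by rewrite -ltr_norml (le_lt_trans (enorm_coord x i0)).
have xE : enorm x ^+ 2 = r ^+ 2.
  by rewrite enorm_sqr (bigD1 i0)//= big1 ?addr0// => i /xi ->; rewrite expr0n.
rewrite /v -(mean_kernel_antisym j_gt0 jc r1) /mean.
apply: eq_Rintegral => w /set_mem wS; rewrite expr0 mul1r; congr (H _).
rewrite -[LHS]ger0_norm ?enorm_ge0// -sqrtr_sqr enormB_sphere// xE.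
congr Num.sqrt; rewrite (bigD1 i0)//= big1 ?addr0; first by rewrite mulrA.
by move=> i /xi ->; rewrite mul0r.
Qed.

(** The integration variable is rotated together with the point: distances do not change and [sigma]
    is invariant. *)
Let v_rot (x : 'rV[R]_n) i (a b : R) : i != i0 -> -1 < a -> a ^+ 2 + b ^+ 2 = 1 ->
  enorm x < 1 -> v (rot i0 i a b x) = v x.
Proof.
move=> ii0 a1 ab x1; have i0i : i0 != i by rewrite eq_sym.
have d0 : 0 < 1 - enorm x by rewrite subr_gt0.
have [C CP] := radial_op_bounded j jS d0.
pose F w := H (enorm (rot i0 i a b x - w)).
have mF : measurable_fun [set: 'rV[R]_n] F.
  apply: (measurableT_comp (measurable_radial_op j jS)).
  apply: (measurableT_comp (@measurable_enorm R n)).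
  apply: measurable_fun_rVP => k; under eq_fun do rewrite !mxE.
  by apply: measurable_funB => //; exact: measurable_coord.
have FE w : F (rot i0 i a b w) = H (enorm (x - w)).
  by rewrite /F -rotB enorm_rot.
rewrite {1}/v -(Rintegral_surface_rot i0i a1 ab mF).
  by apply: eq_Rintegral => w _; rewrite FE.
have [mr _ _] := scales_rot i0i a1 ab.
apply: (@integrable_surface _ _ _ C); first exact: measurableT_comp.
move=> w wS; rewrite /= FE; apply: CP.
have /andP[-> h] := enormB_sphere_bounds wS x1.
by rewrite (le_trans h)// lerD2l ltW.
Qed.

(** Plane rotations through the first axis clear the coordinates of [x] one at a time from the last
    one down, until [v_axis] applies; [k] bounds the index of the last nonzero coordinate. *)
Lemma integral_kernel_eq0 (x : 'rV[R]_n) : unit_ball x ->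
  \int[sigma]_(w in sph) radial_op j (kernel_jet j (antisym c)) (enorm (x - w)) = 0.
Proof.
rewrite /unit_ball/= -/H -/(v x).
suff : forall k (x : 'rV[R]_n), enorm x < 1 ->
    (forall i : 'I_n, (k < i)%N -> x ord0 i = 0) -> v x = 0.
  by move=> /(_ n x) hx x1; apply: hx => // i; rewrite ltnNge (ltnW (ltn_ord i)).
elim=> [|k IH] {}x x1 xk.
  by apply: v_axis => // i i0'; apply: xk; rewrite lt0n.
have [kn|kn] := ltnP k.+1 n; last first.
  by apply: IH => // i ki; have := leq_trans kn ki; rewrite leqNgt ltn_ord.
pose i : 'I_n := Ordinal kn; have ii0 : i != i0 by [].
have [xi0|xi0] := eqVneq (x ord0 i) 0.
  apply: IH => // l; rewrite leq_eqVlt => /predU1P[kl|]; last exact: xk.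
  by rewrite (_ : l = i)//; apply/val_inj.
pose rho := Num.sqrt (x ord0 i0 ^+ 2 + x ord0 i ^+ 2).
have q0 : 0 < x ord0 i0 ^+ 2 + x ord0 i ^+ 2.
  by rewrite ltr_wpDl ?sqr_ge0// lt_neqAle sqr_ge0 eq_sym sqrf_eq0 xi0.
have rho0 : 0 < rho by rewrite sqrtr_gt0.
have rho2 : rho ^+ 2 = x ord0 i0 ^+ 2 + x ord0 i ^+ 2 by rewrite sqr_sqrtr// ltW.
(* The sign makes the cosine [a] nonnegative, hence greater than -1, so the half turn is avoided. *)
pose e : R := if 0 <= x ord0 i0 then 1 else -1.
have e2 : e ^+ 2 = 1 by rewrite /e; case: ifP => _; rewrite ?sqrrN expr1n.
pose a := e * x ord0 i0 / rho; pose b := - e * x ord0 i / rho.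
have ab : a ^+ 2 + b ^+ 2 = 1.
  rewrite (_ : _ + _ = e ^+ 2 * (x ord0 i0 ^+ 2 + x ord0 i ^+ 2) / rho ^+ 2).
    by rewrite e2 mul1r rho2 divff// gt_eqF.
  by rewrite /a /b; field; rewrite gt_eqF.
have a1 : -1 < a.
  rewrite (@lt_le_trans _ _ 0)// /a divr_ge0 ?(ltW rho0)// /e.
  by have [h|/ltW h] := leP 0 (x ord0 i0); rewrite ?mul1r ?mulN1r ?oppr_ge0.
rewrite -(v_rot ii0 a1 ab x1); apply: IH.
  by rewrite enorm_rot// eq_sym.
move=> l; rewrite leq_eqVlt => /predU1P[kl|kl].
  have -> : l = i by apply/val_inj.
  by rewrite mxE (negbTE ii0) eqxx /a /b; field; rewrite gt_eqF.
have li0 : l != i0 by apply: contraTneq kl => ->.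
have li : l != i by apply: contraTneq kl => -> /=; rewrite ltnn.
by rewrite mxE (negbTE li0) (negbTE li) xk.
Qed.

End backprojection_kernel.

(** * The radial counterexample *)

Section jet_constructions.
Context {R : realType}.
Implicit Types (f g : nat -> R -> R) (x t : R).

Definition D1 (u : R -> R) t : R := t^-1 * derive1 u t.

Lemma iter_D1 f i : jet f -> iter i D1 (f 0%N) = radial_op i f.
Proof.
move=> jf; elim: i => [|i IH] /=.
  apply/funext => t; rewrite /radial_op mul1r (@euler_opE _ 1) ?size_poly1//.
  by rewrite big_ord_recl big_ord0 coef1 expr0 !mul1r addr0.
(* At t = 0 both sides are 0, because [0^-1 = 0]. *)
rewrite IH; apply/funext => t; rewrite /D1; have [->|t0] := eqVneq t 0.
  by rewrite /radial_op invr0 expr0n doubleS/= !mul0r.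
by rewrite (isd_derive1 (is_derive_radial_op i jf t0)) mulKf.
Qed.

(** Leibniz rule without binomial coefficients: order k + 1 of f g is order k of f' g + f g'. *)
Fixpoint jet_mul f g k x : R :=
  if k is l.+1 then jet_mul (f \o succn) g l x + jet_mul f (g \o succn) l x
  else f 0%N x * g 0%N x.

Lemma jet_succ f : jet f -> jet (f \o succn).
Proof. by move=> jf k x; exact: jf. Qed.

Lemma jet_jet_mul f g : jet f -> jet g -> jet (jet_mul f g).
Proof.
move=> jf jg k; elim: k f g jf jg => [|k IH] f g jf jg x.
  exact: (isdM (jf 0%N x) (jg 0%N x)).
by apply: isdD; [apply: IH => //; exact: jet_succ|apply: IH => //; exact: jet_succ].
Qed.

Lemma jet_mul_eq0 f g x : (forall k, f k x = 0) \/ (forall k, g k x = 0) ->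
  forall k, jet_mul f g k x = 0.
Proof.
move=> fg k; elim: k f g fg => [|k IH] f g fg /=.
  by case: fg => ->; rewrite ?mul0r ?mulr0.
rewrite !IH ?addr0//; case: fg => h; [left|right|left|right] => //.
- by move=> l; exact: h.
- by move=> l; exact: h.
Qed.

Lemma jet_affine f (a b : R) : jet f -> jet (fun k x => a ^+ k * f k (a * x + b)).
Proof.
move=> jf k x; have := isd_comp (isdD (isdZ a (isdI x)) (isdC x b)) (jf k (a * x + b)).
by move/(isdZ (a ^+ k)) => /is_derive_eq; apply; rewrite exprSr; ring.
Qed.

(** The interval is [-1/2, 1/2] shifted by 1; it is compact in ]0, 2[, so division by powers of t is
    harmless. *)
Definition supported f := forall k x, ~~ (2^-1 <= x <= 3 / 2) -> f k x = 0.

Lemma supported0 f k : supported f -> f k 0 = 0.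
Proof. by move=> sf; apply: sf; apply/negP => /andP[h _]; lra. Qed.

(** The derivatives of x^-p f(x), through (x^-p f)' = x^-p f' - p x^(-p-1) f. *)
Fixpoint jet_divX p f k x : R :=
  if k is l.+1 then jet_divX p (f \o succn) l x - p%:R * jet_divX p.+1 f l x
  else x^-1 ^+ p * f 0%N x.

Lemma jet_divX_eq0 p f x : (forall k, f k x = 0) -> forall k, jet_divX p f k x = 0.
Proof.
move=> f0 k; elim: k p f f0 => [|k IH] p f f0 /=; first by rewrite f0 mulr0.
by rewrite IH ?IH ?mulr0 ?subr0// => l; exact: f0.
Qed.

Lemma jet_jet_divX p f : jet f -> supported f -> jet (jet_divX p f).
Proof.
move=> jf sf k; elim: k p f jf sf => [|k IH] p f jf sf x; last first.
  apply: isdB; first by apply: IH; [exact: jet_succ|move=> l y; exact: sf].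
  by apply: isdZ; exact: IH.
have [->|x0] := eqVneq x 0; last first.
  apply: is_derive_eq (isdM (isdX p (isdV x0 (isdI x))) (jf 0%N x)) _.
  rewrite /=; case: p => [|p]; first by rewrite /=; ring.
  by rewrite /= !exprS; ring.
apply: (@isd_near _ (fun=> 0)); last first.
  by apply: is_derive_eq (isdC 0 0) _; rewrite /= !supported0//; ring.
near=> y; rewrite /= sf ?mulr0//; apply/negP => /andP[h _].
have : y < 2^-1 by near: y; apply: lt_nbhsl; rewrite invr_gt0.
by rewrite ltNge h.
Unshelve. all: by end_near.
Qed.

(* With [Z f = x f' + (1 - 2m) f] one has [f^(2m) = D1 ((Z f)^(2m - 2))]. *)
Lemma exists_D1_primitive m f : jet f -> supported f ->
  exists g, [/\ jet g, supported g & iter m D1 (g 0%N) = f m.*2].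
Proof.
elim: m f => [|m IH] f jf sf; first by exists f.
pose z l x := x * f l.+1 x + (l.+1%:R - (m.+1.*2)%:R) * f l x.
have jz : jet z.
  move=> l x; apply: is_derive_eq (isdD (isdM (isdI x) (jf l.+1 x))
    (isdZ (l.+1%:R - (m.+1.*2)%:R) (jf l x))) _.
  by rewrite /z -(natr1 l.+1); ring.
have sz : supported z by move=> l x hx; rewrite /z !sf// !mulr0 addr0.
have [g [jg sg gE]] := IH z jz sz.
exists g; split=> //=; rewrite gE; apply/funext => x; rewrite /D1.
(* In order 2m + 1 the coefficient of f^(l) in [z] is zero; the constant in [z] was chosen for
   this. *)
rewrite (isd_derive1 (jz m.*2 x)) /z -doubleS subrr mul0r addr0.
have [->|x0] := eqVneq x 0; last by rewrite mulKf.
by rewrite invr0 mul0r supported0.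
Qed.

End jet_constructions.

(** * A smooth bump function *)

Section bump.
Context {R : realType}.
Implicit Types (x y : R) (p : {poly R}).

(** The family p(1/x) exp(-1/x) is closed under differentiation: p is replaced by X^2 (p - p'). *)
Definition flat p x : R := if 0 < x then p.[x^-1] * expR (- x^-1) else 0.

(** Settles the origin, the only point where [flat] is not locally given by one formula: the
    difference quotient is O(h). *)
Lemma is_derive0_quadratic (f : R -> R) (C : R) : f 0 = 0 ->
  (forall y, `|y| <= 1 -> `|f y| <= C * y ^+ 2) -> is_derive (0 : R) 1 f 0.
Proof.
move=> f0 fC.
have lim : h^-1 *: (f (h + 0) - f 0) @[h --> (0 : R)^'] --> (0 : R).
  have C0 : 0 <= C.
    by have := fC 1; rewrite normr1 lexx expr1n mulr1 => /(_ isT); exact: le_trans.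
  apply/cvgr0Pnorm_le => e e0; near=> h.
  have h0 : h != 0 by near: h; exact: nbhs_dnbhs_neq.
  have hC : `|h| <= e / (C + 1).
    near: h; apply: dnbhs0_le; by rewrite divr_gt0// ltr_wpDl.
  have h1 : `|h| <= 1 by near: h; apply: dnbhs0_le.
  rewrite addr0 f0 subr0 normrZ normfV ler_pdivrMl ?normr_gt0//.
  apply: le_trans (fC h h1) _; rewrite -real_normK ?num_real// expr2 mulrCA ler_wpM2l//.
  rewrite (le_trans (_ : _ <= (C + 1) * `|h|))//; first by rewrite ler_wpM2r// lerDl.
  by rewrite mulrC -ler_pdivlMr// ltr_wpDl.
apply: DeriveDef; first by apply/cvg_ex; exists 0; under eq_fun do rewrite scaler1.
by rewrite -derive1E /derive1; exact/cvg_lim.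
Unshelve. all: by end_near.
Qed.

(** From y / K <= exp(y / K), raised to the power K. *)
Lemma expR_power_bound K y : 0 <= y -> y ^+ K * expR (- y) <= K%:R ^+ K.
Proof.
case: K => [|K] y0; first by rewrite !expr0 mul1r -expR0 ler_expR oppr_le0.
rewrite expRN ler_pdivrMr ?expR_gt0//.
have -> : y = (y / K.+1%:R) * K.+1%:R by rewrite divfK.
rewrite expRM_natr exprMn mulrC ler_wpM2l ?exprn_ge0//.
rewrite lerXn2r ?nnegrE ?expR_ge0 ?divr_ge0//.
by apply: le_trans (expR_ge1Dx _); rewrite lerDr.
Qed.

(** Each monomial is bounded with two extra powers of 1/y, which supply the factor y^2. *)
Lemma flat_quadratic p : exists C : R, forall y, `|y| <= 1 -> `|flat p y| <= C * y ^+ 2.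
Proof.
exists (\sum_(i < size p) `|p`_i| * (i + 2)%:R ^+ (i + 2)) => y _.
rewrite /flat; case: ifPn => [y0|_]; last first.
  by rewrite normr0 mulr_ge0 ?sqr_ge0// sumr_ge0.
rewrite horner_coef !mulr_suml (le_trans (ler_norm_sum _ _ _))//.
apply: ler_sum => i _; rewrite !normrM -!mulrA ler_wpM2l//.
have yV : 0 <= y^-1 by rewrite invr_ge0 ltW.
rewrite !ger0_norm ?expR_ge0 ?exprn_ge0//.
rewrite -ler_pdivrMr ?exprn_gt0//; apply: le_trans (expR_power_bound (i + 2) yV).
by rewrite exprD mulrAC (exprVn y 2).
Qed.

Lemma is_derive_flat p x : is_derive x 1 (flat p) (flat ('X^2 * (p - p^`())) x).
Proof.
have [x0|x0|->] := ltgtP x 0.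
- rewrite {2}/flat ltNge ltW//=; apply: isd_near (isdC x 0).
  near=> y; have y0 : y < 0 by near: y; exact: lt_nbhsl.
  by rewrite /flat ltNge (ltW y0).
- have x1 : x != 0 by rewrite gt_eqF.
  apply: (@isd_near _ (fun y => p.[y^-1] * expR (- y^-1))).
    near=> y; have y0 : 0 < y by near: y; exact: lt_nbhsr.
    by rewrite /flat y0.
  have dV := isdV x1 (isdI x).
  have dN : is_derive x 1 (fun y : R => - y^-1) (x^-1 ^+ 2).
    have := isdZ (-1) dV; under eq_fun do rewrite mulN1r.
    by move/is_derive_eq; apply; ring.
  apply: is_derive_eq (isdM (isd_comp dV (is_derive_poly p x^-1))
    (isd_comp dN (is_derive_expR (- x^-1)))) _.
  by rewrite /flat x0 hornerM hornerXn hornerD hornerN; ring.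
have [C CP] := flat_quadratic p.
rewrite {2}/flat ltxx; apply: (is_derive0_quadratic _ CP).
by rewrite /flat ltxx.
Unshelve. all: by end_near.
Qed.

Fixpoint flat_poly k : {poly R} :=
  if k is l.+1 then 'X^2 * (flat_poly l - (flat_poly l)^`()) else 1.

Definition flat_jet k := flat (flat_poly k).

Lemma jet_flat : jet flat_jet.
Proof. by move=> k x; exact: is_derive_flat. Qed.

(** The factors exp(-1/x) and exp(-1/(1/2 - x)) confine the support to [0, 1/2]. As it lies on one
    side of 0, antisymmetrisation produces two bumps that do not cancel. *)
Definition bump_fun : nat -> R -> R :=
  jet_mul flat_jet (fun k x => (-1) ^+ k * flat_jet k (-1 * x + 2^-1)).

Lemma jet_bump : jet bump_fun.
Proof. by apply: jet_jet_mul; [exact: jet_flat|apply: jet_affine; exact: jet_flat]. Qed.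

Lemma bump_eq0 k x : ~~ (0 < x < 2^-1) -> bump_fun k x = 0.
Proof.
move=> hx; apply: jet_mul_eq0; have [x0|x0] := ltP 0 x; [right|left] => l.
  rewrite /flat_jet /flat ifF ?mulr0//; apply/negP => h; apply: (negP hx).
  by rewrite x0/=; lra.
by rewrite /flat_jet /flat ltNge x0.
Qed.

Lemma bump_gt0 x : 0 < x < 2^-1 -> 0 < bump_fun 0 x.
Proof.
move=> /andP[x0 x1]; rewrite /bump_fun /= mul1r /flat_jet /flat x0.
have -> : 0 < -1 * x + 2^-1 by lra.
by rewrite /= !hornerE !mulr_gt0 ?expR_gt0.
Qed.

End bump.

(** * Uniqueness for linear differential equations *)

Section linear_ode.
Context {R : realType}.

(* Gronwall's inequality for the sum of the [u k ^+ 2]. *)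
Lemma linear_ode_eq0 (u : nat -> R -> R) (N : nat) (q : nat -> R) (a : R) :
  jet u -> (0 < N)%N -> (forall x, u N x = \sum_(k < N) q k * u k x) ->
  (forall k, (k < N)%N -> u k a = 0) -> forall x, a <= x -> u 0%N x = 0.
Proof.
move=> ju N0 uN ua x ax.
pose E x := \sum_(k < N) u k x ^+ 2.
(* The 2 bounds the terms 2 u_k u_(k+1) with k + 1 < N, and the sum bounds the last one, where u_N
   is replaced by the equation. *)
pose C := 2 + 2 * \sum_(k < N) `|q k|.
have E0 y : 0 <= E y by apply: sumr_ge0 => k _; exact: sqr_ge0.
have uE y k : (k < N)%N -> u k y ^+ 2 <= E y.
  move=> kN; rewrite /E (bigD1 (Ordinal kN))//= lerDl.
  by apply: sumr_ge0 => i _; exact: sqr_ge0.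
have dE (y : R) : is_derive y 1 E (\sum_(k < N) 2 * u k y * u k.+1 y).
  apply: isd_sum => k; apply: is_derive_eq (isdX 2 (ju k y)) _.
  by rewrite /=; ring.
have uu y (s t : R) : s ^+ 2 <= E y -> t ^+ 2 <= E y -> `|2 * s * t| <= 2 * E y.
  move=> sE tE; have := sqr_ge0 (s - t); have := sqr_ge0 (s + t).
  by rewrite ler_norml => ? ?; apply/andP; split; lra.
have dEC y : \sum_(k < N) 2 * u k y * u k.+1 y <= N%:R * (C * E y).
  have -> : N%:R * (C * E y) = \sum_(k < N) (C * E y).
    by rewrite sumr_const card_ord mulr_natl.
  apply: ler_sum => k _; have [kN|] := ltnP k.+1 N.
    apply: le_trans (ler_norm _) (le_trans (uu y _ _ (uE y k _) (uE y _ kN)) _) => //.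
    by rewrite ler_wpM2r// /C lerDl mulr_ge0// sumr_ge0.
  move=> Nk; have -> : k.+1 = N by apply/eqP; rewrite eqn_leq Nk ltn_ord.
  rewrite uN mulr_sumr (@le_trans _ _ (2 * (\sum_(i < N) `|q i|) * E y))//; last first.
    by rewrite ler_wpM2r// /C lerDr.
  rewrite -mulrA mulr_suml mulr_sumr; apply: ler_sum => i _.
  have -> : 2 * u k y * (q i * u i y) = q i * (2 * u k y * u i y) by ring.
  rewrite (le_trans (ler_norm _))// normrM mulrCA ler_wpM2l//.
  by apply: uu; exact: uE.
pose D := N%:R * C.
pose F y := E y * expR (- D * y).
have dF (y : R) : is_derive y 1 F ((\sum_(k < N) 2 * u k y * u k.+1 y - D * E y) * expR (- D * y)).
  apply: is_derive_eq (isdM (dE y) (isd_comp (isdZ (- D) (isdI y))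
    (is_derive_expR (- D * y)))) _.
  by ring.
have cF : {within `[a, x], continuous F}.
  by apply: derivable_within_continuous => y _; have [] := dF y.
have Fx : F x <= F a.
  have F'0 y : y \in `]a, x[ -> derive1 F y <= 0.
    move=> _; rewrite (isd_derive1 (dF y)) mulr_le0_ge0 ?expR_ge0// subr_le0 /D -mulrA.
    exact: dEC.
  have dF' y : y \in `]a, x[ -> derivable F y 1 by move=> _; have [] := dF y.
  by apply: (ler0_derive1_le_cc dF' F'0 cF); rewrite ?in_itv/= ?lexx ?ax.
have Fa : F a = 0 by rewrite /F /E big1 ?mul0r// => k _; rewrite ua ?expr0n.
have Ex : E x <= 0 by rewrite -(pmulr_lle0 _ (expR_gt0 (- D * x))) -Fa.
by have := le_trans (uE x 0%N N0) Ex; rewrite le_eqVlt ltNge sqr_ge0 orbF sqrf_eq0 => /eqP.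
Qed.

End linear_ode.

(** * Integration by parts for D with the weight t *)

Section energy.
Context {R : realType}.
Notation leb := (@lebesgue_measure R).
Implicit Types (f : nat -> R -> R) (q F : R -> R) (t x : R).

Lemma integrable_itv q (a b : R) c d : continuous q ->
  leb.-integrable [set` Interval (BSide c a) (BSide d b)] (EFin \o q).
Proof.
move=> cq; apply: (@integrableS _ _ _ leb `[a, b]%classic) => //.
  by apply: subset_itv; case: c; case: d; rewrite bnd_simp.
apply: continuous_compact_integrable; first exact: segment_compact.
exact: continuous_subspaceT.
Qed.

Lemma Rintegral_derivative F q (a b : R) : a < b -> continuous q ->
  (forall x, is_derive x 1 F (q x)) -> \int[leb]_(x in `]a, b[) q x = F b - F a.
Proof.
move=> ab cq dF.
have iq := @integrable_itv q a b false true cq.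
rewrite Rintegral_itv_bndo_bndc// Rintegral_itv_obnd_cbnd; last exact: integrable_itv.
rewrite /Rintegral (@continuous_FTC2 _ q F)// ; first exact: continuous_subspaceT.
- have cF x : {for x, continuous F} by exact: isd_continuous (dF x).
  split; first by move=> x _; apply: ex_derive.
  + by apply: cvg_at_right_filter; exact: cF.
  + by apply: cvg_at_left_filter; exact: cF.
- by move=> x _; rewrite (isd_derive1 (dF x)).
Qed.

Lemma continuous_ge0_integral_eq0 q (a b : R) : continuous q ->
  (forall x, a < x < b -> 0 <= q x) -> \int[leb]_(x in `]a, b[) q x = 0 ->
  forall x, a < x < b -> q x = 0.
Proof.
move=> cq q0 I0 x xab; apply/eqP; rewrite eq_le q0// andbT leNgt; apply/negP => qx.
have /nbhs_ballP[d /= d0 dP] : \forall y \near x, q x / 2 < q y.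
  have q2 : q x / 2 < q x by lra.
  exact: (cq x _ (lt_nbhsr q2)).
pose l := Num.max a (x - d); pose r := Num.min b (x + d).
have lr : l < x < r by rewrite gt_max lt_min; lra.
have lrab : `]l, r[ `<=` `]a, b[.
  by apply: subset_itv; rewrite bnd_simp ?le_max ?ge_min lexx.
have qlr y : `]l, r[%classic y -> q x / 2 <= q y.
  rewrite /= in_itv/= gt_max lt_min => /andP[/andP[_ h1] /andP[_ h2]].
  by apply/ltW/dP; rewrite /ball/= ltr_norml; lra.
have ile : \int[leb]_(y in `]l, r[) q y <= 0.
  rewrite -I0; apply: fine_le.
  - by apply: integrable_fin_num => //; exact: integrable_itv.
  - by apply: integrable_fin_num => //; exact: integrable_itv.
  apply: ge0_subset_integral => //.
    by apply/measurable_EFinP; apply: measurable_funTS; exact: continuous_measurable_fun.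
have : \int[leb]_(y in `]l, r[) (q x / 2) <= 0.
  apply: le_trans ile; apply: le_Rintegral => //; last exact: integrable_itv.
  by apply: integrable_itv => y; exact: cst_continuous.
rewrite Rintegral_cst; last exact: measurable_itv.
set len := fine _; have -> : len = r - l.
  apply: (etrans (congr1 fine (lebesgue_measure_itv `]l, r[))).
  by rewrite /= lte_fin -EFinB ifT//; have /andP[] := lr; exact: lt_trans.
by rewrite leNgt mulr_gt0//; lra.
Qed.

Lemma radial_op_eq0 i f t : (forall k, f k t = 0) -> radial_op i f t = 0.
Proof.
by move=> f0; rewrite /radial_op /euler_op big1 ?mulr0// => k _; rewrite f0 !mulr0.
Qed.

(** At 0, where division fails, the function vanishes on a neighbourhood. *)
Lemma is_derive_radial_op_supported i f t : jet f -> supported f ->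
  is_derive t 1 (radial_op i f) (t * radial_op i.+1 f t).
Proof.
move=> jf sf; have [->|t0] := eqVneq t 0; last exact: is_derive_radial_op.
rewrite mul0r; apply: (isd_near _ (isdC 0 0)).
near=> y; rewrite radial_op_eq0// => k; apply: sf; apply/negP => /andP[h _].
have : y < 2^-1 by near: y; apply: lt_nbhsl; rewrite invr_gt0.
by rewrite ltNge h.
Unshelve. all: by end_near.
Qed.

Lemma continuous_radial_op_supported i f : jet f -> supported f ->
  continuous (radial_op i f).
Proof.
by move=> jf sf t; exact: isd_continuous (is_derive_radial_op_supported i t jf sf).
Qed.

(** The weight t makes D antisymmetric, since t D = d/dt. *)
Definition energy f i l := \int[leb]_(t in `]0, 2[) (t * (radial_op i f t * radial_op l f t)).

Lemma continuous_energy f i l : jet f -> supported f ->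
  continuous (fun t => t * (radial_op i f t * radial_op l f t)).
Proof.
move=> jf sf t; have d k := is_derive_radial_op_supported k t jf sf.
exact: isd_continuous (isdM (isdI t) (isdM (d i) (d l))).
Qed.

Lemma energy_parts f i l : jet f -> supported f ->
  energy f i l.+1 = - energy f i.+1 l.
Proof.
move=> jf sf; apply/eqP; rewrite -addr_eq0 addrC /energy -RintegralD//; last 2 first.
- by apply: integrable_itv; exact: continuous_energy.
- by apply: integrable_itv; exact: continuous_energy.
have cE : continuous (fun t => t * (radial_op i.+1 f t * radial_op l f t) +
    t * (radial_op i f t * radial_op l.+1 f t)).
  move=> t; have d k := is_derive_radial_op_supported k t jf sf.
  exact: isd_continuous (isdD (isdM (isdI t) (isdM (d i.+1) (d l)))
                             (isdM (isdI t) (isdM (d i) (d l.+1)))).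
have dE t : is_derive t 1 (fun t => radial_op i f t * radial_op l f t)
   (t * (radial_op i.+1 f t * radial_op l f t) + t * (radial_op i f t * radial_op l.+1 f t)).
  apply: is_derive_eq (isdM (is_derive_radial_op_supported i t jf sf)
    (is_derive_radial_op_supported l t jf sf)) _; ring.
rewrite (Rintegral_derivative (ltr0n _ 2) cE dE) !radial_op_eq0 ?subrr// => k;
  by apply: sf; apply/negP => /andP[h1 h2]; lra.
Qed.

(** Moving [m] of the operators D to the other factor makes the two orders equal; the integral
    becomes a signed integral of a square. *)
Lemma energy_shift f i m : jet f -> supported f ->
  energy f i (i + m.*2) = (-1) ^+ m * energy f (i + m) (i + m).
Proof.
move=> jf sf; suff h k l : energy f i (k + l) = (-1) ^+ k * energy f (i + k) l.
  by rewrite -addnn addnCA h addnC.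
elim: k i => [|k IH] i0; first by rewrite mul1r addn0.
by rewrite addSn energy_parts// IH addnS addSn exprS; ring.
Qed.

Lemma energy_eq0 f m : jet f -> supported f -> energy f m m = 0 ->
  forall t, radial_op m f t = 0.
Proof.
move=> jf sf e0 t.
have [tI|tI] := boolP (0 < t < 2); last first.
  apply: radial_op_eq0 => k; apply: sf; apply: contra tI => /andP[h1 h2]; lra.
have x0 x : 0 < x < 2 -> 0 <= x * (radial_op m f x * radial_op m f x).
  by move=> /andP[/ltW x0 _]; rewrite mulr_ge0// -expr2 sqr_ge0.
have /eqP := continuous_ge0_integral_eq0 (@continuous_energy f m m jf sf) x0 e0 tI.
have tN0 : t != 0 by move: tI; case: eqP => // ->; rewrite ltxx.
by rewrite mulf_eq0 (negbTE tN0)/= mulf_eq0 orbb => /eqP.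
Qed.

End energy.

(** * Construction of the radial kernel and its primitive *)

Section radial_kernel.
Context {R : realType}.
Notation leb := (@lebesgue_measure R).
Implicit Types (t x : R).

Lemma antisym_shift (c : nat -> R -> R) m k x :
  antisym (fun i => c (i + m.*2)%N) k x = antisym c (k + m.*2)%N x.
Proof. by rewrite /antisym exprD -mul2n exprM sqrrN !expr1n mulr1. Qed.

Lemma antisym_bump_eq0 k x : ~~ (- 2^-1 < x < 2^-1) -> antisym bump_fun k x = 0.
Proof.
by move=> hx; rewrite /antisym !bump_eq0 ?mulr0 ?subr0//;
  apply: contra hx => /andP[h1 h2]; lra.
Qed.

Lemma supported_kernel_bump j : supported (kernel_jet j (antisym (@bump_fun R))).
Proof.
move=> k x hx; rewrite /kernel_jet big1// => i _; rewrite antisym_bump_eq0 ?mulr0//.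
by apply: contra hx => /andP[h1 h2]; lra.
Qed.

(** Vanishing would be a differential equation of order k + j for the odd function, with highest
    coefficient (-1)^j and none below order k; [q] lists the coefficients after solving for the
    highest order. *)
Lemma kernel_bump_neq0 j k : (0 < j)%N ->
  ~ (forall t, kernel_jet j (antisym (@bump_fun R)) k t = 0).
Proof.
move=> j0 K0; pose q l : R := if (l < k)%N then 0 else
  - ((-1) ^+ (l - k) * (radial_poly j)`_(l - k)) * (-1) ^+ j.
have jw : jet (antisym (@bump_fun R)) by apply: jet_antisym; exact: jet_bump.
have ode x : antisym bump_fun (k + j)%N x = \sum_(l < k + j) q l * antisym bump_fun l x.
  have := K0 (x + 1); rewrite /kernel_jet addrK big_ord_recr/=.
  have [_ ->] := @radial_poly_lead R j; rewrite mulr1.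
  move/(congr1 (fun y => (-1) ^+ j * y)); rewrite mulrDr mulrA -exprD addnn.
  rewrite -mul2n exprM sqrrN !expr1n mul1r mulr0 => /eqP; rewrite addrC addr_eq0 => /eqP ->.
  rewrite big_split_ord/= [X in X + _]big1 ?add0r; last first.
    by move=> i _; rewrite /q ltn_ord mul0r.
  rewrite mulr_sumr -sumrN; apply: eq_bigr => i _.
  by rewrite /q ltnNge leq_addr/= addKn; ring.
(* All derivatives vanish at -1, left of both bumps, whereas 1/4 is inside the right bump and its
   mirror image lies outside the support of [bump_fun]. *)
have := @linear_ode_eq0 R _ (k + j)%N q (-1) jw _ ode _ 4^-1.
rewrite addn_gt0 j0 orbT => /(_ isT) h.
have {}h : antisym bump_fun 0%N (4^-1 : R) = 0.
  apply: h => [l _|]; last by lra.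
  by rewrite antisym_bump_eq0//; apply/negP => /andP[h1 h2]; lra.
have := @bump_gt0 R 4^-1; move: h.
rewrite /antisym expr0 mul1r (@bump_eq0 _ _ (- 4^-1)) ?subr0; last first.
  by apply/negP => /andP[h1 h2]; lra.
move=> ->; rewrite ltxx => h; have // : false.
by apply: h; lra.
Qed.

(** With j = m + 1 and D^m Th = Phi^(2m), the kernel is H = D^j Phi^(2m) = D^(2m+1) Th. It remains
    to choose [h] with t^(2j-1) h = D Th. *)
Lemma exists_radial_kernel j : (0 < j)%N -> exists h c : nat -> R -> R,
  let H := radial_op j (kernel_jet j (antisym c)) in
  [/\ jet h /\ supported h, jet c,
      iter j.-1.*2 D1 (fun t => t ^+ j.*2.-1 * h 0%N t) = H,
      continuous H /\ (forall t, ~~ (2^-1 <= t <= 3 / 2) -> H t = 0)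
    & \int[leb]_(t in `]0, 2[) (t ^+ j.*2 * (H t * h 0%N t)) <> 0].
Proof.
case: j => [//|m] _; set j := m.+1.
pose Phi := kernel_jet j (antisym (@bump_fun R)).
have jPhi : jet Phi by apply/jet_kernel/jet_antisym; exact: jet_bump.
have [Th [jTh sTh ThE]] := exists_D1_primitive m jPhi (@supported_kernel_bump j).
(* The shift by the even number 2m commutes with antisymmetrisation and turns the kernel into the
   derivative of [Phi] of order 2m. *)
pose c k := @bump_fun R (k + m.*2)%N.
have cE : kernel_jet j (antisym c) = fun k => Phi (k + m.*2)%N.
  apply/funext => k; apply/funext => t; rewrite /Phi -kernel_jet_shift.
  by apply: eq_bigr => i _; rewrite antisym_shift.
have jc : jet c by apply: jet_shift; exact: jet_bump.
have HE : radial_op j (kernel_jet j (antisym c)) = radial_op m.*2.+1 Th.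
  rewrite -!iter_D1//; last by apply/jet_kernel/jet_antisym.
  by rewrite cE add0n -ThE -iterD -addnn.
have DTh t : D1 (Th 0%N) t = t^-1 * Th 1%N t.
  by rewrite /D1 (isd_derive1 (jTh 0%N t)).
(* h = t^(-2j) Th', smooth because [Th] vanishes near 0. *)
exists (jet_divX j.*2 (Th \o succn)), c => /=; split => //.
- split.
    by apply: jet_jet_divX; [exact: jet_succ|move=> k x; exact: sTh].
  by move=> k x hx; apply: jet_divX_eq0 => l; exact: sTh.
- rewrite HE -iter_D1// iterSr; congr iter; apply/funext => t.
  rewrite DTh /j doubleS/= mulrA; have [->|t0] := eqVneq t 0.
    by rewrite invr0 !mul0r !expr0n/= !mul0r.
  by rewrite [t^-1 ^+ _]exprS mulrCA -exprMn divff// expr1n mulr1.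
- rewrite HE; split; first exact: continuous_radial_op_supported.
  by move=> t tI; rewrite radial_op_eq0// => k; exact: sTh.
rewrite HE => I0.
(* Since t^(2j) h = Th' = t D Th, the integrand is t (D Th) (D^(2m+1) Th). *)
have E0 : energy Th 1 (1 + m.*2) = 0.
  rewrite -[RHS]I0; apply: eq_Rintegral => t; rewrite inE/= in_itv/= => /andP[t0 _].
  rewrite -(iter_D1 1 jTh)/= DTh add1n exprVn.
  have -> : t * (t^-1 * Th 1%N t * radial_op m.*2.+1 Th t) =
     (t * t^-1) * (radial_op m.*2.+1 Th t * Th 1%N t) by ring.
  have -> : t ^+ j.*2 * (radial_op m.*2.+1 Th t * (t ^- j.*2 * Th 1%N t)) =
     (t ^+ j.*2 * t ^- j.*2) * (radial_op m.*2.+1 Th t * Th 1%N t) by ring.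
  by rewrite !divff ?expf_neq0 ?gt_eqF.
move: E0; rewrite energy_shift// => /eqP; rewrite mulf_eq0 signr_eq0/= => /eqP.
move=> /(energy_eq0 jTh sTh) r0.
(* Zero energy gives D^(m+1) Th = 0, that is, Phi^(2m+1) / t = 0. *)
apply: (@kernel_bump_neq0 j m.*2.+1) => // t; rewrite -/Phi.
have [->|t0] := eqVneq t 0.
  exact: (supported0 _ (@supported_kernel_bump j)).
have := r0 t; rewrite -iter_D1//= ThE /D1 (isd_derive1 (jPhi _ t)) => /eqP.
by rewrite mulf_eq0 invr_eq0 (negbTE t0) => /eqP.
Qed.

End radial_kernel.

(** * Topology and Borel sets of Euclidean space *)

Section euclidean_topology.
Context {R : realType}.

Lemma compact_support_bounded (T : topologicalType) (f : T -> R) (K : set T) :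
  compact K -> continuous f -> (forall x, ~ K x -> f x = 0) ->
  exists M : R, forall x, `|f x| <= M.
Proof.
move=> cK cf f0; have [K0|/set0P K0] := eqVneq K set0.
  by exists 0 => x; rewrite f0 ?normr0// K0.
have cg : {within K, continuous (fun x => `|f x|)}.
  apply: continuous_subspaceT => x; apply: (@continuous_comp _ _ _ f); first exact: cf.
  exact: norm_continuous.
have [c _ cP] := compact_EVT_max K0 cK cg.
exists `|f c| => x; have [Kx|nKx] := pselect (K x); first by apply: cP; rewrite inE.
by rewrite f0// normr0.
Qed.

Context {n : nat}.
Implicit Types (x v : 'rV[R]_n) (A : set 'rV[R]_n).

Lemma continuous_enorm : continuous (@enorm R n).
Proof.
have cX (i : 'I_n) (x : 'rV[R]_n) : {for x, continuous (fun y : 'rV[R]_n => y ord0 i ^+ 2)}.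
  apply: (@continuous_comp _ _ _ (fun y : 'rV[R]_n => y ord0 i) (fun t => t ^+ 2)).
    exact: coord_continuous.
  exact: exprn_continuous.
have cs (s : seq 'I_n) (x : 'rV[R]_n) :
    continuous_at x (fun y : 'rV[R]_n => \sum_(i <- s) y ord0 i ^+ 2).
  elim: s => [|i s IH].
    by under eq_fun do rewrite big_nil; exact: cst_continuous.
  under eq_fun do rewrite big_cons.
  exact: (cvgD (cX i x) IH).
move=> x; apply: (@continuous_comp _ _ _ (fun x => \sum_i x ord0 i ^+ 2) Num.sqrt).
  exact: cs.
exact: sqrt_continuous.
Qed.

Lemma open_unit_ball : open (@unit_ball R n).
Proof.
rewrite (_ : @unit_ball R n = @enorm R n @^-1` [set y | y < 1]); last by [].
apply: open_comp; last exact: open_lt.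
by move=> x _; exact: continuous_enorm.
Qed.

Lemma compact_unit_sphere : compact (@unit_sphere R n).
Proof.
apply: (@subclosed_compact _ _ [set v : 'rV[R]_n | forall i, `[-1, 1]%classic (v ord0 i)]).
- rewrite (_ : @unit_sphere R n = @enorm R n @^-1` [set y | y = 1]); last by [].
  apply: preimage_closed; last exact: closed_eq.
  by move=> x _; exact: continuous_enorm.
- by apply: (@rV_compact R n (fun=> `[-1, 1]%classic)) => _; exact: segment_compact.
- by move=> x /= x1 i; rewrite in_itv/= -ler_norml -x1; exact: enorm_coord.
Qed.

(* An open set is the union of the cubes with rational centre and radius 1/k that it contains. *)
Lemma open_measurable_rV A : open A -> measurable A.
Proof.
move=> oA.
pose B (p : 'rV[rat]_n * nat) :=
  [set y : 'rV[R]_n | forall i : 'I_n, `|ratr (p.1 ord0 i) - y ord0 i| < p.2.+1%:R^-1 :> R].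
have mB p : measurable (B p : set 'rV[R]_n).
  rewrite (_ : B p = \bigcap_(i in [set: 'I_n])
      (fun y : 'rV[R]_n => y ord0 i) @^-1` ball (ratr (p.1 ord0 i) : R) p.2.+1%:R^-1).
    apply: fin_bigcap_measurable => // i _; rewrite -[X in measurable X]setTI.
    by apply: measurable_coord => //; exact: measurable_ball.
  by apply/seteqP; split => [y By i _|y By i]; exact: By.
rewrite (_ : A = \bigcup_p (if `[< B p `<=` A >] then B p else set0)).
  by apply: countable_bigcupT_measurable => // p; case: ifP.
apply/seteqP; split => [x Ax|x [p _]]; last by case: asboolP => // h /h.
have /nbhs_ballP[e /= e0 eA] := open_nbhs_nbhs (conj oA Ax).
have [N Ne] : exists N, N.+1%:R^-1 < e / 2 :> R.
  have e2 : 0 < e / 2 by rewrite divr_gt0.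
  have [N _ NP] := near_infty_natSinv_lt (PosNum e2).
  by exists N; exact: NP (leqnn N).
have ex i : exists q : rat, `|ratr q - x ord0 i| < N.+1%:R^-1 :> R.
  have [|q] := @rat_in_itvoo R (x ord0 i - N.+1%:R^-1) (x ord0 i + N.+1%:R^-1).
    by rewrite ltrD2l gtrN// invr_gt0.
  by rewrite in_itv/= -ltr_distl; exists q.
have [q qP] := choice ex.
exists (\row_i q i, N) => //; case: asboolP => [_ /= i|]; first by rewrite mxE.
case => y By; apply: eA; split=> // i j; rewrite ord1 /ball/=.
have := By j; have := qP j; rewrite /= mxE => h1 h2.
rewrite [e]splitr (le_lt_trans (ler_distD (ratr (q j)) _ _))// distrC.
by apply: ltrD; apply: lt_trans Ne.
Qed.

Lemma continuous_measurable_rV (f : 'rV[R]_n -> R) :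
  continuous f -> measurable_fun [set: 'rV[R]_n] f.
Proof.
move=> cf; apply: (measurability _ (RGenOInfty.measurableE R)).
move=> _ [_ [x ->] <-]; rewrite setTI; apply: open_measurable_rV.
by apply: open_comp; [move=> y _; exact: cf|exact: rray_open].
Qed.

End euclidean_topology.

(** * Smooth functions with compact support *)

Section compactly_supported.
Context {R : realType} {n : nat}.

(** The constant [a] closes the family under directional derivatives: along [v] the order rises by
    one and [a] is multiplied by [v.2]. *)
Lemma Ck_jet_snd (h : nat -> R -> R) k l (a : R) : jet h ->
  Ck k [set: 'rV[R]_n * R] (fun z => a * h l z.2).
Proof.
move=> jh; have csnd : continuous (snd : 'rV[R]_n * R -> R) by move=> z; exact: cvg_snd.
have df b i (t : R) : is_derive t 1 (fun y => b * h i y) (b * h i.+1 t).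
  by apply: isdZ; exact: jh.
have Df b i (t : R) : differentiable (fun y => b * h i y) t.
  by apply/derivable1_diffP; case: (df b i t).
have DF b i (z : 'rV[R]_n * R) : differentiable (fun z => b * h i z.2) z.
  apply: (@differentiable_comp R _ _ _ snd (fun y => b * h i y)) => //.
  exact: linear_differentiable.
elim: k l a => [|k IH] l a; first by move=> z _; exact: differentiable_continuous.
split=> [z _|v]; first exact: DF.
rewrite (_ : 'D_v _ = fun z => (v.2 * a) * h l.+1 z.2)//.
apply/funext => z; rewrite deriveE; last exact: DF.
rewrite (@diff_comp R _ _ _ snd (fun y => a * h l y))//; last exact: linear_differentiable.
rewrite /= diff_lin// diff1E//= (isd_derive1 (df a l z.2)).
by rewrite /GRing.scale/= mulrA.
Qed.

Lemma Ccinfty_radial (h : nat -> R -> R) : jet h -> supported h ->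
  Ccinfty (@cylinder R n) (fun z => h 0%N z.2).
Proof.
move=> jh sh; split.
  move=> z _; exists setT, (fun z => 1 * h 0%N z.2); split => //.
  - exact: openT.
  - by move=> k; exact: Ck_jet_snd.
  - by move=> y _ _; rewrite mul1r.
exists (@unit_sphere R n `*` `[2^-1, 3 / 2]%classic); split.
- by apply: compact_setX; [exact: compact_unit_sphere|exact: segment_compact].
- move=> [p t] [/= p1]; rewrite !in_itv/= => /andP[h1 h2]; split => //=.
  by rewrite in_itv/=; lra.
- move=> [p t] [/= p1 _] nK; apply: sh; apply: contra_notN nK => tI.
  by split => //=; rewrite in_itv.
Qed.

(** Inside the ball the local smooth extension gives continuity; outside it the function vanishes on
    the complement of the closed set [K], a neighbourhood of the point. *)
Lemma Ccinfty_patch_continuous (f : 'rV[R]_n -> R) : Ccinfty (@unit_ball R n) f ->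
  continuous (patch (fun=> 0) (@unit_ball R n) f) /\
  exists M : R, forall x, `|patch (fun=> 0) (@unit_ball R n) f x| <= M.
Proof.
move=> [sf [K [cK KB f0]]]; set phi := patch _ _ _.
have phi0 x : ~ K x -> phi x = 0.
  by rewrite /phi patchE; case: ifPn => // /set_mem xB nK; exact: f0.
have cphi (x : 'rV[R]_n) : continuous_at x phi.
  have [xB|xB] := pselect (unit_ball x).
    have [U [F [oU Ux CF FE]]] := sf x xB.
    have Fphi : {near x, F =1 phi}.
      have : \forall y \near x, U y by exact: open_nbhs_nbhs.
      have : \forall y \near x, unit_ball y.
        by apply: open_nbhs_nbhs; split => //; exact: open_unit_ball.
      apply: filterS2 => y yB Uy; rewrite /phi patchE mem_set// FE//.
    rewrite /continuous_at; have <- : F x = phi x by exact: nbhs_singleton Fphi.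
    exact: (cvg_trans (near_eq_cvg Fphi) (CF 0%N x Ux)).
  have nK : ~ K x by move/KB.
  have phi_near : {near x, (fun=> 0 : R) =1 phi}.
    have : \forall y \near x, (~` K) y.
      apply: open_nbhs_nbhs; split => //; apply: closed_openC.
      by apply: compact_closed => //; exact: norm_hausdorff.
    by apply: filterS => y Ky; rewrite phi0.
  rewrite /continuous_at phi0//.
  exact: (cvg_trans (near_eq_cvg phi_near) (cvg_cst _)).
by split => //; exact: compact_support_bounded cK cphi phi0.
Qed.

End compactly_supported.

(** * Assembly of the counterexample *)

Section counterexample.
Context {R : realType}.
Implicit Types (u : R -> R).

Lemma iter_Dt n u i : iter i (@Dt R n) (fun z => u z.2) = fun z => iter i D1 u z.2.
Proof. by elim: i => [//|i IH]; rewrite iterS IH. Qed.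

Lemma filtered_radial j u : (0 < j)%N ->
  filtered (fun z : 'rV[R]_j.*2.+1 * R => u z.2) =
  fun z => iter j.-1.*2 D1 (fun t => t ^+ j.*2.-1 * u t) z.2.
Proof.
case: j => [//|m] _; rewrite /filtered -iter_Dt /=.
by rewrite doubleS !subSS subn0.
Qed.

Lemma exists_radial_counterexample j : (0 < j)%N ->
  exists g : 'rV[R]_j.*2.+1 * R -> R,
    [/\ Ccinfty (@cylinder R j.*2.+1) g,
        forall x : 'rV[R]_j.*2.+1, unit_ball x -> backprojection (filtered g) x = 0
      & ~ in_range_mean g].
Proof.
move=> j0; have [h [c [[jh sh] jc hE [cH H0] I0]]] := @exists_radial_kernel R j j0.
set H := radial_op j (kernel_jet j (antisym c)) in hE cH H0 I0.
exists (fun z => h 0%N z.2); split.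
- exact: Ccinfty_radial.
- move=> x xB; rewrite filtered_radial// hE /backprojection/=.
  by rewrite (integral_kernel_eq0 j0 jc xB) mulr0.
(* A preimage [f], extended by zero, is continuous and bounded, so [range_orthogonal] would make the
   nonzero integral [I0] vanish. *)
case => f /Ccinfty_patch_continuous[cphi [M phiM]] gE; apply: I0.
have HK t : ~ `[2^-1, 3 / 2]%classic t -> H t = 0.
  by move=> tI; apply: H0; apply: contra_notN tI => tI; rewrite /= in_itv.
have [N HN] := compact_support_bounded (@segment_compact R _ _) cH HK.
apply: (range_orthogonal (ltn0Sn _) (continuous_measurable_rV cphi) phiM _ _ HN).
- by move=> x xB; rewrite patchE memNset.
- exact: continuous_measurable_fun.
- by move=> t t2; apply: H0; clear hE; apply/negP => /andP[h1 h2]; lra.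
- by move=> p t p1 t02; have := gE (p, t); apply; split => //=; rewrite in_itv.
- by move=> x xB; exact: integral_kernel_eq0.
apply: integrable_itv => t; apply: cvgM; first exact: exprn_continuous.
by apply: cvgM; [exact: cH|exact: jet_continuous].
Qed.

(** The zero function is the potential of zero, so the counterexample satisfies the hypothesis of
    the refuted assertion. *)
Lemma in_range_riesz2_0 n (v : 'rV[R]_n -> R) : (forall x, unit_ball x -> v x = 0) ->
  in_range_riesz2 v.
Proof.
move=> v0; exists (fun=> 0); last first.
  move=> x xB; rewrite v0// /riesz2; under eq_Rintegral do rewrite mul0r.
  by rewrite Rintegral_cst ?mul0r ?mulr0//; exact: measurable_unit_ball.
split.
  move=> x _; exists setT, (fun=> 0); split => //; first exact: openT.
  elim=> [|k IH] /=; first by move=> y _; exact: cst_continuous.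
  split=> [y _|u]; first exact: differentiable_cst.
  by rewrite (_ : 'D_u _ = fun=> 0)//; apply/funext => y; exact: derive_cst.
by exists set0; split => //; exact: compact0.
Qed.

End counterexample.

Unset Implicit Arguments.

Theorem theorem1p3 (R : realType) (n : nat) (n_ge3 : (3 <= n)%N)
    (n_odd : odd n) :
  (exists g : 'rV[R]_n * R -> R,
    [/\ Ccinfty (@cylinder R n) g,
        forall x : 'rV[R]_n, unit_ball x -> backprojection (filtered g) x = 0
      & ~ in_range_mean g]) /\
  ~ (forall g : 'rV[R]_n * R -> R,
      Ccinfty (@cylinder R n) g ->
      in_range_riesz2 (backprojection (filtered g)) ->
      in_range_mean g).
Proof.
have nE : n = n./2.*2.+1 by rewrite -[LHS]odd_double_half n_odd.
have j0 : (0 < n./2)%N by rewrite half_gt0; exact: ltnW.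
rewrite nE; move: n./2 j0 => j {n n_ge3 n_odd nE} j0.
have [g [gC Pg gN]] := @exists_radial_counterexample R j j0.
split; first by exists g.
by move=> all_range; apply/gN/all_range => //; exact: in_range_riesz2_0.
Qed.
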